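(* Let $\mu>0$ and $v\in X$. There exist constants $\mathcal{R}_1,\mathcal{R}_2,\mathcal{R}'>0$ and an integer threshold $m_0$, all depending only on $\mu,\gamma,\|f\|,L$ and $|v|_X$, such that if $m\ge m_0$ then every solution $w\in Y$ on $\mathbb{R}$ of $$iw_s+w_{xx}+|w|^2w+i\gamma w=f-i\mu\,[P_m w-v]$$ (with $L$-periodic boundary conditions) satisfies $$\sup_{s\in\mathbb{R}}\|w(s)\|\le \mathcal{R}_0:=\frac{\|f\|}{\sqrt{\gamma(\gamma+\mu)}}+\sqrt{\frac{\mu}{\gamma+\mu}}\,|v|_X+\sqrt{\frac{\mu}{\gamma+\mu}},$$ $$\sup_{s}\|w(s)\|_{H^1}\le\mathcal{R}_1,\qquad \sup_s\|w(s)\|_{H^2}\le \mathcal{R}_2,\qquad \sup_s\|w_s(s)\|\le\mathcal{R}'.$$ Moreover, for fixed $\gamma,\|f\|,L,|v|_X$, one has $\mathcal{R}_1=O(\mu^{1/2})$, $\mathcal{R}_2=O(\mu^2)$, $\mathcal{R}'=O(\mu^2)$ and one may take $m_0=O(\mu^4)$ as $\mu\to\infty$.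
   Context: Fix $0<L<\infty$, $\gamma>0$ and a time-independent $f\in L^2_{per}[0,L]$, $f\ne0$. $\|\cdot\|$ is the $L^2(0,L)$ norm, $\|w\|_{H^1}^2=\|w\|^2+\|w_x\|^2$, $\|w\|_{H^2}^2=\|w\|^2+\|w_{xx}\|^2$. $P_m$ is the $L^2$-orthogonal projection onto $H_m=\mathrm{span}\{e^{2\pi ikx/L}:|k|\le m\}$. $X=C^1_b(\mathbb{R},P_mH^2)$ is the space of continuously differentiable maps $v:\mathbb{R}\to P_mH^2_{per}$ with finite norm $|v|_X=\sup_{s}\|v(s)\|+\sup_s\|v_s(s)\|$; $Y=C_b(\mathbb{R},H^2)$ is the space of continuous maps $w:\mathbb{R}\to H^2_{per}$ with $|w|_Y=\sup_s\|w(s)\|_{H^2}<\infty$. *)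

(* Defs.v *)
(* classical reals. L^2_per functions are represented by their
   Fourier coefficients w.r.t. e_k(x) = exp(2 pi i k x / L), k in Z
   (Parseval:  ||w||^2 = L * sum_k |c_k|^2). *)
From Stdlib Require Import Reals ZArith.
Open Scope R_scope.

Definition C := (R * R)%type.
Definition C0 : C := (0, 0).
Definition Ci : C := (0, 1).
Definition Cadd (z w : C) : C := (fst z + fst w, snd z + snd w).
Definition Csub (z w : C) : C := (fst z - fst w, snd z - snd w).
Definition Cmul (z w : C) : C :=
  (fst z * fst w - snd z * snd w, fst z * snd w + snd z * fst w).
Definition Cconj (z : C) : C := (fst z, - snd z).
Definition Cscal (r : R) (z : C) : C := (r * fst z, r * snd z).
Definition Cnorm2 (z : C) : R := fst z ^ 2 + snd z ^ 2.

(* a periodic function on [0,L], given by its Fourier coefficients *)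
Definition FSeq := Z -> C.

(* wave number of mode k: d/dx e_k = i (kappa L k) e_k *)
Definition kappa (L : R) (k : Z) : R := 2 * PI * IZR k / L.

Fixpoint symsum (g : Z -> R) (n : nat) : R :=
  match n with
  | O => g 0%Z
  | S p => symsum g p + g (Z.of_nat n) + g (- Z.of_nat n)%Z
  end.
Fixpoint Csymsum (g : Z -> C) (n : nat) : C :=
  match n with
  | O => g 0%Z
  | S p => Cadd (Cadd (Csymsum g p) (g (Z.of_nat n))) (g (- Z.of_nat n)%Z)
  end.

(* weighted squared norm  L * sum_k wt k |c_k|^2  is <= B *)
Definition wsum_le (wt : Z -> R) (L : R) (c : FSeq) (B : R) : Prop :=
  forall n, L * symsum (fun k => wt k * Cnorm2 (c k)) n <= B.
Definition L2sq_le (L : R) (c : FSeq) (B : R) : Prop := wsum_le (fun _ => 1) L c B.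
(* ||c||_{H^1}^2 = ||c||^2 + ||c_x||^2 <= B *)
Definition H1sq_le (L : R) (c : FSeq) (B : R) : Prop :=
  wsum_le (fun k => 1 + kappa L k ^ 2) L c B.
(* ||c||_{H^2}^2 = ||c||^2 + ||c_xx||^2 <= B *)
Definition H2sq_le (L : R) (c : FSeq) (B : R) : Prop :=
  wsum_le (fun k => 1 + kappa L k ^ 4) L c B.

Definition L2norm_is (L : R) (c : FSeq) (r : R) : Prop :=
  Un_cv (fun n => sqrt (L * symsum (fun k => Cnorm2 (c k)) n)) r.

Definition Pm (m : nat) (c : FSeq) : FSeq :=
  fun k => if (Z.abs k <=? Z.of_nat m)%Z then c k else C0.
Definition in_Hm (m : nat) (c : FSeq) : Prop :=
  forall k, (Z.of_nat m < Z.abs k)%Z -> c k = C0.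

Definition has_deriv (u u' : R -> FSeq) : Prop :=
  forall s k,
    derivable_pt_lim (fun t => fst (u t k)) s (fst (u' s k)) /\
    derivable_pt_lim (fun t => snd (u t k)) s (snd (u' s k)).

(* v in X = C^1_b(R, P_m H^2), with derivative v' *)
Definition in_X (L : R) (m : nat) (v v' : R -> FSeq) : Prop :=
  (forall s, in_Hm m (v s)) /\
  has_deriv v v' /\
  (forall k, continuity (fun s => fst (v' s k)) /\ continuity (fun s => snd (v' s k))) /\
  (exists B, forall s, L2sq_le L (v s) B /\ L2sq_le L (v' s) B).

Definition Xnorm_is (L : R) (v v' : R -> FSeq) (V : R) : Prop :=
  exists a b,
    is_lub (fun r => exists s, L2norm_is L (v s) r) a /\
    is_lub (fun r => exists s, L2norm_is L (v' s) r) b /\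
    V = a + b.

(* w in Y = C_b(R, H^2_per) *)
Definition in_Y (L : R) (w : R -> FSeq) : Prop :=
  (exists B, forall s, H2sq_le L (w s) B) /\
  (forall s eps, 0 < eps -> exists delta, 0 < delta /\
     forall t, Rabs (t - s) < delta ->
       H2sq_le L (fun k => Csub (w t k) (w s k)) (eps ^ 2)).

(* N is the k-th Fourier coefficient of |w|^2 w, i.e.
   N = sum_{a,b in Z} c_a conj(c_b) c_{k-a+b}  (limit of square partial sums) *)
Definition cubic_partial (c : FSeq) (k : Z) (n : nat) : C :=
  Csymsum (fun a => Csymsum (fun b =>
     Cmul (Cmul (c a) (Cconj (c b))) (c (k - a + b)%Z)) n) n.
Definition cubic_coef (c : FSeq) (k : Z) (N : C) : Prop :=
  Un_cv (fun n => fst (cubic_partial c k n)) (fst N) /\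
  Un_cv (fun n => snd (cubic_partial c k n)) (snd N).

(* w in Y solves  i w_s + w_xx + |w|^2 w + i gamma w = f - i mu (P_m w - v)
   on R (L-periodic), with time derivative ws; the equation is stated
   mode by mode in Fourier variables. *)
Definition is_solution (L gamma mu : R) (m : nat) (f : FSeq)
    (v : R -> FSeq) (w ws : R -> FSeq) : Prop :=
  in_Y L w /\ has_deriv w ws /\
  forall s k, exists N, cubic_coef (w s) k N /\
    Cadd (Cadd (Cadd (Cmul Ci (ws s k)) (Cscal (- (kappa L k ^ 2)) (w s k))) N)
         (Cmul Ci (Cscal gamma (w s k)))
    = Csub (f k) (Cmul Ci (Cscal mu (Csub (Pm m (w s) k) (v s k)))).

Definition bigR0 (mu gamma nf V : R) : R :=
  nf / sqrt (gamma * (gamma + mu)) + sqrt (mu / (gamma + mu)) * V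
  + sqrt (mu / (gamma + mu)).

(* Main.v *)
(* Write La = 1 + mu and g = f + i mu v, so that w_s = i (w_xx + |w|^2 w - g) - gamma w - mu P_m w.
   Three functionals are damped along w: |w|^2, the energy
   |w_x|^2 - |w|_4^4 / 2 + 2 Re (w, g), and |w_s|^2 + Re (w^2, w_x^2).  In the energy, v enters
   through g and hence only via v and v_s in L^2, never via v_x; in the last one the correction
   turns the term Re (i w^2, w_s^2), which the damping cannot absorb, into lower-order terms.
   A quantity that is bounded on the whole line forgets its past, so only the forcing remains.

   Damping at the rate gamma gives |w| = O(La) and then |w_x| = O(La^4).  If m >> La^4 the high
   modes have |Q_m w| <= 1, the damping of |w|^2 has the full rate gamma + mu, and |w| <= R_0 = O(1).
   Running the estimates again gives |w_x| = O(La) and |w_xx| = O(La^4), hence |Q_m w_x| <= 1; the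
   energy is now damped at the rate gamma + mu, whence |w_x| = O(La^(1/2)) and |w_xx|, |w_s| = O(La^2).

   The identities are proved for the truncations P_n w, sampled at 4 n + 1 equispaced points:
   averages over this grid integrate trigonometric polynomials of degree at most 4 n exactly, so
   quartic expressions are finite sums of pointwise products.  The truncation error tends to 0
   in H^2, uniformly on compact time intervals, because w is continuous in H^2. *)
From Stdlib Require Import Reals ZArith Lra Lia List Psatz IndefiniteDescription.
Require Import Defs.
Open Scope R_scope.

(** The obstacle is that w is only in H^2, while the second-order identity contains two space
    derivatives of w_s. On modes up to n one has w_s = [vfield] + i eps, where eps is the error of
    truncating the cubic term; all other terms act mode by mode. Two derivatives of eps cost
    kappa_n^2, which is exactly what the H^2 tail of w gives back.

    eps tends to 0 only on compact time intervals, at a speed depending on the solution. This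
    suffices because Gronwall on the line fixes the length of the interval before n. Bounds that
    depend on the solution multiply only vanishing terms, so the final constants depend on the data
    alone.

    The first two inequalities carry a rate rho and a defect E. The pair gamma, 0 is always
    admissible; the pair gamma + mu, 1 is admissible once the high modes have norm at most 1. That 1
    becomes the last summand of R_0. Once |w| = O(1), the forcing of the energy is of order La^2,
    and dividing it by gamma + mu instead of gamma brings |w_x|^2 from O(La^2) to O(La). *)

Definition C1 : C := (1, 0).
Definition Copp (z : C) : C := (- fst z, - snd z).

Lemma C_ext (z w : C) : fst z = fst w -> snd z = snd w -> z = w.
Proof. destruct z, w; simpl; intros -> ->; reflexivity. Qed.

Lemma C_ring_theory : ring_theory C0 C1 Cadd Cmul Csub Copp eq.
Proof.
constructor; intros; apply C_ext; simpl; ring.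
Qed.

Add Ring Cring : C_ring_theory.

(** * Real inner product and modulus of complex numbers *)

Definition rdot (z w : C) : R := fst z * fst w + snd z * snd w.
Definition cmod (z : C) : R := sqrt (Cnorm2 z).

Lemma Cnorm2_nonneg z : 0 <= Cnorm2 z.
Proof. unfold Cnorm2; nra. Qed.

Lemma cmod_nonneg z : 0 <= cmod z.
Proof. apply sqrt_pos. Qed.

Lemma cmod_sqr z : cmod z * cmod z = Cnorm2 z.
Proof. apply sqrt_sqrt, Cnorm2_nonneg. Qed.

Lemma rdot_self z : rdot z z = Cnorm2 z.
Proof. unfold rdot, Cnorm2; ring. Qed.

Lemma cmod_mul z w : cmod (Cmul z w) = cmod z * cmod w.
Proof.
unfold cmod; rewrite <- sqrt_mult by apply Cnorm2_nonneg.
f_equal; unfold Cnorm2, Cmul; simpl; ring.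
Qed.

Lemma cmod_conj z : cmod (Cconj z) = cmod z.
Proof. unfold cmod; f_equal; unfold Cnorm2, Cconj; simpl; ring. Qed.

Lemma cmod_Ci_mul z : cmod (Cmul Ci z) = cmod z.
Proof. unfold cmod; f_equal; unfold Cnorm2, Ci, Cmul; simpl; ring. Qed.

Lemma cmod_scal r z : cmod (Cscal r z) = Rabs r * cmod z.
Proof.
unfold cmod; rewrite <- sqrt_Rsqr_abs, <- sqrt_mult;
  [f_equal; unfold Cnorm2, Cscal, Rsqr; simpl; ring | apply Rle_0_sqr | apply Cnorm2_nonneg].
Qed.

Lemma cmod_le_sqr z r : 0 <= r -> Cnorm2 z <= r * r -> cmod z <= r.
Proof.
intros Hr H; rewrite <- (sqrt_square r Hr); apply sqrt_le_1_alt; exact H.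
Qed.

Lemma sqr_le_le a b : 0 <= b -> a * a <= b * b -> a <= b.
Proof. intros; nra. Qed.

Lemma Rabs_le_both x a : Rabs x <= a -> - a <= x <= a.
Proof.
intros H; assert (H1 := Rle_abs x); assert (H2 := Rle_abs (- x)).
rewrite Rabs_Ropp in H2; lra.
Qed.

Lemma rdot_le z w : Rabs (rdot z w) <= cmod z * cmod w.
Proof.
assert (Hz := cmod_nonneg z); assert (Hw := cmod_nonneg w).
apply sqr_le_le; [nra|].
rewrite <- Rabs_mult, Rabs_pos_eq by exact (Rle_0_sqr (rdot z w)).
replace (cmod z * cmod w * (cmod z * cmod w))
  with ((cmod z * cmod z) * (cmod w * cmod w)) by ring.
rewrite !cmod_sqr; unfold rdot, Cnorm2.
assert (H := Rle_0_sqr (fst z * snd w - snd z * fst w)); unfold Rsqr in H; lra.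
Qed.

Lemma cmod_add z w : cmod (Cadd z w) <= cmod z + cmod w.
Proof.
assert (Hz := cmod_nonneg z); assert (Hw := cmod_nonneg w).
apply cmod_le_sqr; [lra|].
assert (H := rdot_le z w); apply Rabs_le_both in H.
assert (E : Cnorm2 (Cadd z w) = Cnorm2 z + Cnorm2 w + 2 * rdot z w)
  by (unfold Cnorm2, rdot, Cadd; simpl; ring).
rewrite E, <- !cmod_sqr; nra.
Qed.

Lemma fst_le_cmod z : Rabs (fst z) <= cmod z.
Proof.
assert (H := rdot_le z C1).
replace (rdot z C1) with (fst z) in H by (unfold rdot, C1; simpl; ring).
replace (cmod C1) with 1 in H; [lra|].
unfold cmod, Cnorm2, C1; simpl.
replace (1 * (1 * 1) + 0 * (0 * 1)) with 1 by ring; now rewrite sqrt_1.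
Qed.

Lemma snd_le_cmod z : Rabs (snd z) <= cmod z.
Proof.
assert (H := fst_le_cmod (Cmul (Copp Ci) z)).
replace (fst (Cmul (Copp Ci) z)) with (snd z) in H by (unfold Copp, Ci; simpl; ring).
replace (cmod (Cmul (Copp Ci) z)) with (cmod z) in H; [exact H|].
unfold cmod; f_equal; unfold Cnorm2, Copp, Ci, Cmul; simpl; ring.
Qed.

Lemma cmod_C0 : cmod C0 = 0.
Proof. unfold cmod; rewrite <- sqrt_0; f_equal; unfold Cnorm2, C0; simpl; ring. Qed.

(** * Finite sums *)

Definition rsum {A} (l : list A) (f : A -> R) : R :=
  fold_right (fun a s => f a + s) 0 l.
Definition csum {A} (l : list A) (f : A -> C) : C :=
  (rsum l (fun a => fst (f a)), rsum l (fun a => snd (f a))).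

Lemma rsum_ext {A} (l : list A) f g :
  (forall a, In a l -> f a = g a) -> rsum l f = rsum l g.
Proof.
induction l as [|a l IH]; simpl; intros H; [reflexivity|].
rewrite (H a), IH; auto.
Qed.

Lemma rsum_add {A} (l : list A) f g :
  rsum l (fun a => f a + g a) = rsum l f + rsum l g.
Proof. induction l as [|a l IH]; simpl; [ring|rewrite IH; ring]. Qed.

Lemma rsum_scal {A} (l : list A) r f :
  rsum l (fun a => r * f a) = r * rsum l f.
Proof. induction l as [|a l IH]; simpl; [ring|rewrite IH; ring]. Qed.

Lemma rsum_sub {A} (l : list A) f g :
  rsum l (fun a => f a - g a) = rsum l f - rsum l g.
Proof. induction l as [|a l IH]; simpl; [ring|rewrite IH; ring]. Qed.

Lemma rsum_zero {A} (l : list A) f :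
  (forall a, In a l -> f a = 0) -> rsum l f = 0.
Proof.
induction l as [|a l IH]; simpl; intros H; [reflexivity|].
rewrite (H a), IH; auto; ring.
Qed.

Lemma rsum_le {A} (l : list A) f g :
  (forall a, In a l -> f a <= g a) -> rsum l f <= rsum l g.
Proof.
induction l as [|a l IH]; simpl; intros H; [lra|].
assert (f a <= g a) by auto; assert (rsum l f <= rsum l g) by auto; lra.
Qed.

Lemma rsum_nonneg {A} (l : list A) f :
  (forall a, In a l -> 0 <= f a) -> 0 <= rsum l f.
Proof.
intros H; rewrite <- (rsum_zero l (fun _ => 0)) by auto; now apply rsum_le.
Qed.

Lemma rsum_abs {A} (l : list A) f : Rabs (rsum l f) <= rsum l (fun a => Rabs (f a)).
Proof.
induction l as [|a l IH]; simpl; [rewrite Rabs_R0; lra|].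
assert (H := Rabs_triang (f a) (rsum l f)); lra.
Qed.

Lemma rsum_const {A} (l : list A) r : rsum l (fun _ => r) = INR (length l) * r.
Proof.
induction l as [|a l IH]; [simpl; ring|].
change (length (a :: l)) with (S (length l)); rewrite S_INR; simpl; rewrite IH; ring.
Qed.

Lemma rsum_exchange {A B} (l : list A) (k : list B) f :
  rsum l (fun a => rsum k (fun b => f a b)) = rsum k (fun b => rsum l (fun a => f a b)).
Proof.
induction l as [|a l IH]; simpl.
- symmetry; apply rsum_zero; auto.
- now rewrite IH, rsum_add.
Qed.

Lemma rsum_mem_le {A} (l : list A) f a :
  (forall b, In b l -> 0 <= f b) -> In a l -> f a <= rsum l f.
Proof.
induction l as [|b l IH]; simpl; intros H [].
- subst; assert (0 <= rsum l f) by (apply rsum_nonneg; auto); lra.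
- assert (0 <= f b) by auto; assert (f a <= rsum l f) by auto; lra.
Qed.

Lemma rsum_single (l : list Z) (f : Z -> R) (k : Z) :
  NoDup l -> (forall a, a <> k -> f a = 0) -> In k l -> rsum l f = f k.
Proof.
intros Hl Hf; induction Hl as [|a l Ha Hl IH]; simpl; intros [].
- subst; rewrite rsum_zero; [ring|]. intros a Hal; apply Hf; intros ->; contradiction.
- rewrite IH by assumption. rewrite (Hf a); [ring|]. intros ->; contradiction.
Qed.

Lemma csum_ext {A} (l : list A) f g :
  (forall a, In a l -> f a = g a) -> csum l f = csum l g.
Proof.
intros H; apply C_ext; simpl; apply rsum_ext; intros a Ha; now rewrite H.
Qed.

Lemma csum_add {A} (l : list A) f g :
  csum l (fun a => Cadd (f a) (g a)) = Cadd (csum l f) (csum l g).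
Proof. apply C_ext; simpl; apply rsum_add. Qed.

Lemma csum_sub {A} (l : list A) f g :
  csum l (fun a => Csub (f a) (g a)) = Csub (csum l f) (csum l g).
Proof. apply C_ext; simpl; apply rsum_sub. Qed.

Lemma csum_mul {A} (l : list A) z f :
  csum l (fun a => Cmul z (f a)) = Cmul z (csum l f).
Proof.
apply C_ext; simpl; rewrite <- !rsum_scal; [rewrite rsum_sub|rewrite rsum_add]; reflexivity.
Qed.

Lemma csum_mulr {A} (l : list A) z f :
  csum l (fun a => Cmul (f a) z) = Cmul (csum l f) z.
Proof.
replace (Cmul (csum l f) z) with (Cmul z (csum l f)) by ring.
rewrite <- csum_mul; apply csum_ext; intros; ring.
Qed.

Lemma csum_scal {A} (l : list A) r f :
  csum l (fun a => Cscal r (f a)) = Cscal r (csum l f).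
Proof. apply C_ext; simpl; apply rsum_scal. Qed.

Lemma csum_conj {A} (l : list A) f :
  csum l (fun a => Cconj (f a)) = Cconj (csum l f).
Proof.
apply C_ext; simpl; [reflexivity|].
replace (- rsum l (fun a => snd (f a))) with (-1 * rsum l (fun a => snd (f a))) by ring.
rewrite <- rsum_scal; apply rsum_ext; intros; ring.
Qed.

Lemma csum_zero {A} (l : list A) f :
  (forall a, In a l -> f a = C0) -> csum l f = C0.
Proof.
intros H; apply C_ext; simpl; apply rsum_zero; intros a Ha; now rewrite H.
Qed.

Lemma csum_exchange {A B} (l : list A) (k : list B) f :
  csum l (fun a => csum k (fun b => f a b)) = csum k (fun b => csum l (fun a => f a b)).
Proof. apply C_ext; simpl; apply rsum_exchange. Qed.

Lemma csum_cons {A} (a : A) l f : csum (a :: l) f = Cadd (f a) (csum l f).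
Proof. reflexivity. Qed.

Lemma cmod_csum {A} (l : list A) f : cmod (csum l f) <= rsum l (fun a => cmod (f a)).
Proof.
induction l as [|a l IH].
- change (csum nil f) with C0. rewrite cmod_C0; simpl; lra.
- rewrite csum_cons; simpl. assert (H := cmod_add (f a) (csum l f)); lra.
Qed.

Lemma csum_single (l : list Z) (f : Z -> C) (k : Z) :
  NoDup l -> (forall a, a <> k -> f a = C0) -> In k l -> csum l f = f k.
Proof.
intros Hl Hf Hk; apply C_ext; simpl; rewrite (rsum_single _ _ k); auto;
  intros a Ha; now rewrite Hf.
Qed.

Lemma rsum_cauchy_schwarz {A} (l : list A) (f g : A -> R) :
  rsum l (fun a => f a * g a) * rsum l (fun a => f a * g a)
  <= rsum l (fun a => f a * f a) * rsum l (fun a => g a * g a).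
Proof.
induction l as [|a l IH]; simpl; [lra|].
set (p := rsum l (fun a => f a * g a)) in *.
set (x := rsum l (fun a => f a * f a)) in *.
set (y := rsum l (fun a => g a * g a)) in *.
assert (Hx : 0 <= x) by (apply rsum_nonneg; intros; nra).
assert (Hy : 0 <= y) by (apply rsum_nonneg; intros; nra).
(* The cross term of the expanded product: by the induction hypothesis its square is at most 4 s^2
   t^2 x y, and (s^2 y - t^2 x)^2 >= 0 compares this with the square of the right-hand side. *)
assert (Hs : 2 * (f a * g a) * p <= f a * f a * y + g a * g a * x).
{ set (s := f a) in *; set (t := g a) in *.
  assert (Hss : 0 <= s * s) by apply Rle_0_sqr; assert (Htt : 0 <= t * t) by apply Rle_0_sqr.
  assert (0 <= s * s * y) by now apply Rmult_le_pos.
  assert (0 <= t * t * x) by now apply Rmult_le_pos.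
  apply sqr_le_le; [lra|].
  assert (4 * (s * s) * (t * t) * (p * p) <= 4 * (s * s) * (t * t) * (x * y)).
  { apply Rmult_le_compat_l; [|exact IH].
    apply Rmult_le_pos; [lra|exact Htt]. }
  assert (HH := Rle_0_sqr (s * s * y - t * t * x)); unfold Rsqr in HH; lra. }
lra.
Qed.

(** * Weighted inner products *)

(** One definition serves both sides of Parseval: Fourier modes with weight [L], grid values with
    weight [L / INR M]. Only the real part of the Hermitian product is kept, so multiplication by i
    is antisymmetric. *)
Definition wdot {A} (lam : R) (l : list A) (a b : A -> C) : R :=
  lam * rsum l (fun i => rdot (a i) (b i)).
Definition nrm {A} (lam : R) (l : list A) (a : A -> C) : R := sqrt (wdot lam l a a).

Section WeightedDot.
Context {A : Type} (lam : R) (l : list A) (Hlam : 0 <= lam).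
Implicit Types a b c : A -> C.

Lemma wdot_ext a a' b b' :
  (forall i, In i l -> rdot (a i) (b i) = rdot (a' i) (b' i)) ->
  wdot lam l a b = wdot lam l a' b'.
Proof. intros H; unfold wdot; f_equal; now apply rsum_ext. Qed.

Lemma wdot_sym a b : wdot lam l a b = wdot lam l b a.
Proof. apply wdot_ext; intros; unfold rdot; ring. Qed.

Lemma wdot_addl a b c :
  wdot lam l (fun i => Cadd (a i) (b i)) c = wdot lam l a c + wdot lam l b c.
Proof.
unfold wdot; rewrite <- Rmult_plus_distr_l, <- rsum_add; f_equal.
apply rsum_ext; intros; unfold rdot; simpl; ring.
Qed.

Lemma wdot_subl a b c :
  wdot lam l (fun i => Csub (a i) (b i)) c = wdot lam l a c - wdot lam l b c.
Proof.
unfold wdot; rewrite <- Rmult_minus_distr_l, <- rsum_sub; f_equal.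
apply rsum_ext; intros; unfold rdot; simpl; ring.
Qed.

Lemma wdot_scall r a c :
  wdot lam l (fun i => Cscal r (a i)) c = r * wdot lam l a c.
Proof.
unfold wdot; rewrite <- Rmult_assoc, (Rmult_comm r), Rmult_assoc; f_equal.
rewrite <- rsum_scal; apply rsum_ext; intros; unfold rdot; simpl; ring.
Qed.

Lemma wdot_self_nonneg a : 0 <= wdot lam l a a.
Proof.
apply Rmult_le_pos; [exact Hlam|].
apply rsum_nonneg; intros; rewrite rdot_self; apply Cnorm2_nonneg.
Qed.

Lemma nrm_nonneg a : 0 <= nrm lam l a.
Proof. apply sqrt_pos. Qed.

Lemma nrm_sqr a : nrm lam l a * nrm lam l a = wdot lam l a a.
Proof. apply sqrt_sqrt, wdot_self_nonneg. Qed.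

Lemma nrm_le a r : 0 <= r -> wdot lam l a a <= r * r -> nrm lam l a <= r.
Proof.
intros Hr H; rewrite <- (sqrt_square r Hr); now apply sqrt_le_1_alt.
Qed.

Lemma nrm_ext a b :
  (forall i, In i l -> a i = b i) -> nrm lam l a = nrm lam l b.
Proof. intros H; unfold nrm; f_equal; apply wdot_ext; intros; now rewrite H. Qed.

(** Discrete Hölder inequality for products of several factors: two of them are measured in [nrm],
    all others enter through the uniform bound [P]. *)
Lemma rsum_bound_nrm (h : A -> R) a b P :
  0 <= P ->
  (forall i, In i l -> Rabs (h i) <= P * (cmod (a i) * cmod (b i))) ->
  Rabs (lam * rsum l h) <= P * (nrm lam l a * nrm lam l b).
Proof.
intros HP H.
assert (Ha := nrm_nonneg a); assert (Hb := nrm_nonneg b).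
rewrite Rabs_mult, (Rabs_pos_eq lam) by exact Hlam.
assert (H1 : rsum l (fun i => cmod (a i) * cmod (b i)) * lam <= nrm lam l a * nrm lam l b).
{ apply sqr_le_le; [nra|].
  replace (nrm lam l a * nrm lam l b * (nrm lam l a * nrm lam l b))
    with ((nrm lam l a * nrm lam l a) * (nrm lam l b * nrm lam l b)) by ring.
  rewrite !nrm_sqr; unfold wdot.
  assert (CS := rsum_cauchy_schwarz l (fun i => cmod (a i)) (fun i => cmod (b i))).
  simpl in CS.
  assert (E : forall d : A -> C, rsum l (fun i => cmod (d i) * cmod (d i))
                                 = rsum l (fun i => rdot (d i) (d i)))
    by (intros; apply rsum_ext; intros; now rewrite cmod_sqr, rdot_self).
  rewrite !E in CS.
  assert (0 <= lam * lam) by nra.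
  apply Rmult_le_compat_l with (r := lam * lam) in CS; [|assumption].
  lra. }
assert (H2 : Rabs (rsum l h) <= P * rsum l (fun i => cmod (a i) * cmod (b i))).
{ eapply Rle_trans; [apply rsum_abs|]. rewrite <- rsum_scal; apply rsum_le; exact H. }
apply Rle_trans with (lam * (P * rsum l (fun i => cmod (a i) * cmod (b i)))).
- now apply Rmult_le_compat_l.
- replace (lam * (P * rsum l (fun i => cmod (a i) * cmod (b i))))
    with (P * (rsum l (fun i => cmod (a i) * cmod (b i)) * lam)) by ring.
  now apply Rmult_le_compat_l.
Qed.

Lemma wdot_le a b : Rabs (wdot lam l a b) <= nrm lam l a * nrm lam l b.
Proof.
unfold wdot; rewrite <- (Rmult_1_l (nrm lam l a * nrm lam l b)).
apply rsum_bound_nrm; [lra|]. intros; rewrite Rmult_1_l; apply rdot_le.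
Qed.

Lemma nrm_add a b :
  nrm lam l (fun i => Cadd (a i) (b i)) <= nrm lam l a + nrm lam l b.
Proof.
assert (Ha := nrm_nonneg a); assert (Hb := nrm_nonneg b).
apply nrm_le; [lra|].
rewrite wdot_addl, (wdot_sym a), (wdot_sym b), !wdot_addl, (wdot_sym b a).
assert (H := wdot_le a b); apply Rabs_le_both in H.
rewrite <- !nrm_sqr; nra.
Qed.

Lemma nrm_le_pointwise a b P :
  0 <= P -> (forall i, In i l -> cmod (a i) <= P * cmod (b i)) ->
  nrm lam l a <= P * nrm lam l b.
Proof.
intros HP H; assert (Hb := nrm_nonneg b).
apply nrm_le; [nra|].
replace (P * nrm lam l b * (P * nrm lam l b)) with (P * P * (nrm lam l b * nrm lam l b)) by ring.
rewrite nrm_sqr; unfold wdot.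
replace (P * P * (lam * rsum l (fun i => rdot (b i) (b i))))
  with (lam * (P * P * rsum l (fun i => rdot (b i) (b i)))) by ring.
apply Rmult_le_compat_l; [exact Hlam|].
rewrite <- rsum_scal; apply rsum_le; intros i Hi.
rewrite !rdot_self, <- !cmod_sqr.
assert (H0 := H i Hi); assert (Hai := cmod_nonneg (a i)); nra.
Qed.

Lemma nrm_scal r a : nrm lam l (fun i => Cscal r (a i)) <= Rabs r * nrm lam l a.
Proof.
apply nrm_le_pointwise; [apply Rabs_pos|]. intros; rewrite cmod_scal; lra.
Qed.

Lemma nrm_le_eqmod a b :
  (forall i, In i l -> cmod (a i) <= cmod (b i)) -> nrm lam l a <= nrm lam l b.
Proof.
intros H; rewrite <- (Rmult_1_l (nrm lam l b)).
apply nrm_le_pointwise; [lra|]. intros; rewrite Rmult_1_l; auto.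
Qed.

End WeightedDot.

(** * Modes and the grid *)

Fixpoint modes (n : nat) : list Z :=
  match n with
  | O => 0%Z :: nil
  | S p => Z.of_nat n :: (- Z.of_nat n)%Z :: modes p
  end.

Lemma In_modes n k : In k (modes n) <-> (Z.abs k <= Z.of_nat n)%Z.
Proof.
induction n as [|n IH]; [simpl; lia|].
change (In k (modes (S n))) with
  (Z.of_nat (S n) = k \/ (- Z.of_nat (S n))%Z = k \/ In k (modes n)).
rewrite IH; lia.
Qed.

Lemma NoDup_modes n : NoDup (modes n).
Proof.
induction n as [|n IH].
- constructor; [easy|constructor].
- constructor; [|constructor; [|exact IH]].
  + intros [H|H]; [lia|]. apply In_modes in H; lia.
  + intros H; apply In_modes in H; lia.
Qed.

Lemma symsum_modes g n : symsum g n = rsum (modes n) g.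
Proof. induction n as [|n IH]; simpl; [ring|]. rewrite IH; simpl; ring. Qed.

Lemma Csymsum_modes g n : Csymsum g n = csum (modes n) g.
Proof.
induction n as [|n IH].
- apply C_ext; simpl; ring.
- change (Csymsum g (S n)) with
    (Cadd (Cadd (Csymsum g n) (g (Z.of_nat (S n)))) (g (- Z.of_nat (S n))%Z)).
  change (modes (S n)) with (Z.of_nat (S n) :: (- Z.of_nat (S n))%Z :: modes n).
  rewrite !csum_cons, IH; ring.
Qed.

Lemma rsum_modes_mono g n p :
  (forall k, 0 <= g k) -> (n <= p)%nat -> rsum (modes n) g <= rsum (modes p) g.
Proof.
intros Hg H; induction H as [|p H IH]; [lra|].
change (modes (S p)) with (Z.of_nat (S p) :: (- Z.of_nat (S p))%Z :: modes p); simpl.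
assert (H1 := Hg (Z.of_nat (S p))); assert (H2 := Hg (- Z.of_nat (S p))%Z).
simpl in H1, H2; lra.
Qed.

Lemma rsum_modes_restrict g h n p :
  (n <= p)%nat ->
  (forall k, (Z.abs k <= Z.of_nat n)%Z -> h k = g k) ->
  (forall k, (Z.of_nat n < Z.abs k)%Z -> h k = 0) ->
  rsum (modes p) h = rsum (modes n) g.
Proof.
intros H H1 H2; induction H as [|p H IH].
- apply rsum_ext; intros k Hk; apply H1; now apply In_modes.
- change (modes (S p)) with (Z.of_nat (S p) :: (- Z.of_nat (S p))%Z :: modes p).
  cbn [rsum fold_right]. fold (rsum (modes p) h).
  rewrite IH, (H2 (Z.of_nat (S p))), (H2 (- Z.of_nat (S p))%Z) by lia; ring.
Qed.

Lemma csum_modes_restrict g h n p :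
  (n <= p)%nat ->
  (forall k, (Z.abs k <= Z.of_nat n)%Z -> h k = g k) ->
  (forall k, (Z.of_nat n < Z.abs k)%Z -> h k = C0) ->
  csum (modes p) h = csum (modes n) g.
Proof.
intros H H1 H2; apply C_ext; apply rsum_modes_restrict; auto; intros k Hk;
  (now rewrite H1 by assumption) || (now rewrite H2 by assumption).
Qed.

Definition grid (M : nat) : list nat := seq 0 M.
(** The phase of mode k at the sampling point x = j L / M; the period cancels, so one grid serves
    every [L]. *)
Definition phase (M : nat) (k : Z) (j : nat) : R := 2 * PI * IZR k * INR j / INR M.
Definition ebas (M : nat) (k : Z) (j : nat) : C := (cos (phase M k j), sin (phase M k j)).

Lemma ebas_add M k l j : ebas M (k + l) j = Cmul (ebas M k j) (ebas M l j).
Proof.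
unfold ebas; replace (phase M (k + l) j) with (phase M k j + phase M l j)
  by (unfold phase; rewrite plus_IZR; unfold Rdiv; ring).
rewrite cos_plus, sin_plus; apply C_ext; simpl; ring.
Qed.

Lemma ebas_opp M k j : ebas M (- k) j = Cconj (ebas M k j).
Proof.
unfold ebas; replace (phase M (- k) j) with (- phase M k j)
  by (unfold phase; rewrite opp_IZR; unfold Rdiv; ring).
rewrite cos_neg, sin_neg; reflexivity.
Qed.

Lemma ebas_0 M j : ebas M 0 j = C1.
Proof.
unfold ebas; replace (phase M 0 j) with 0 by (unfold phase, Rdiv; ring).
now rewrite cos_0, sin_0.
Qed.

Lemma cmod_ebas M k j : cmod (ebas M k j) = 1.
Proof.
unfold cmod; rewrite <- sqrt_1; f_equal; unfold Cnorm2, ebas; simpl.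
assert (H := sin2_cos2 (phase M k j)); unfold Rsqr in H; lra.
Qed.

Lemma ebas_succ M k j : ebas M k (S j) = Cmul (ebas M k 1) (ebas M k j).
Proof.
unfold ebas; replace (phase M k (S j)) with (phase M k 1 + phase M k j)
  by (unfold phase; rewrite (S_INR j); change (INR 1) with 1; unfold Rdiv; ring).
rewrite cos_plus, sin_plus; apply C_ext; simpl; ring.
Qed.

(** Half angles reduce the equation [ebas M k j = C1] to the vanishing of a single sine, whose zeros
    are the multiples of pi. *)
Lemma ebas_double M k j :
  fst (ebas M k j) = 1 - 2 * sin (phase M k j / 2) * sin (phase M k j / 2)
  /\ snd (ebas M k j) = 2 * sin (phase M k j / 2) * cos (phase M k j / 2).
Proof.
unfold ebas; simpl.
replace (phase M k j) with (2 * (phase M k j / 2)) at 1 4 by field.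
now rewrite cos_2a_sin, sin_2a.
Qed.

Lemma ebas_end M k : (0 < M)%nat -> ebas M k M = C1.
Proof.
intros HM; destruct (ebas_double M k M) as [H1 H2].
assert (Hs : sin (phase M k M / 2) = 0).
{ apply sin_eq_0_1; exists k; unfold phase; field; apply not_0_INR; lia. }
apply C_ext; [rewrite H1|rewrite H2]; rewrite Hs; simpl; ring.
Qed.

Lemma ebas_one_neq M k : (0 < Z.abs k < Z.of_nat M)%Z -> ebas M k 1 <> C1.
Proof.
intros Hk He; destruct (ebas_double M k 1) as [H1 _].
rewrite He in H1; simpl in H1.
assert (Hs : sin (phase M k 1 / 2) = 0) by nra.
apply sin_eq_0_0 in Hs; destruct Hs as [q Hq].
assert (HM : 0 < INR M) by (apply lt_0_INR; lia).
assert (HP := PI_RGT_0).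
assert (E : IZR k = IZR q * INR M).
{ unfold phase in Hq; change (INR 1) with 1 in Hq.
  replace (2 * PI * IZR k * 1 / INR M / 2) with (PI * (IZR k / INR M)) in Hq by (field; lra).
  assert (E0 : IZR k / INR M = IZR q) by nra.
  rewrite <- E0; field; lra. }
rewrite INR_IZR_INZ, <- mult_IZR in E; apply eq_IZR in E.
assert (q = 0 \/ 1 <= Z.abs q)%Z by lia.
destruct H as [->|H]; [lia|].
subst k; rewrite Z.abs_mul in Hk; nia.
Qed.

Lemma csum_seq_telescope (f : nat -> C) M :
  csum (seq 0 M) (fun j => Csub (f (S j)) (f j)) = Csub (f M) (f 0%nat).
Proof.
assert (H : forall a m, csum (seq a m) (fun j => Csub (f (S j)) (f j))
                        = Csub (f (a + m)%nat) (f a)).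
{ intros a m; revert a; induction m as [|m IH]; intros a.
  - rewrite Nat.add_0_r; change (csum (seq a 0) (fun j => Csub (f (S j)) (f j))) with C0; ring.
  - cbn [seq]; rewrite csum_cons, IH.
    replace (S a + m)%nat with (a + S m)%nat by lia; ring. }
apply (H 0%nat M).
Qed.

(** Geometric sum of ratio zeta = [ebas M k 1]: multiplied by zeta - 1 it telescopes to zeta^M - 1 =
    0, and zeta differs from 1. *)
Lemma csum_ebas_zero M k :
  (0 < Z.abs k < Z.of_nat M)%Z -> csum (grid M) (ebas M k) = C0.
Proof.
intros Hk; set (s := csum (grid M) (ebas M k)).
assert (E : Cmul (Csub (ebas M k 1) C1) s = C0).
{ unfold s; rewrite <- csum_mul.
  rewrite (csum_ext _ _ (fun j => Csub (ebas M k (S j)) (ebas M k j)))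
    by (intros; rewrite (ebas_succ M k a); ring).
  unfold grid; rewrite csum_seq_telescope, ebas_end by lia.
  replace (ebas M k 0) with C1; [ring|].
  unfold ebas; replace (phase M k 0) with 0 by (unfold phase, Rdiv; simpl; ring).
  now rewrite cos_0, sin_0. }
assert (E2 : cmod (Csub (ebas M k 1) C1) * cmod s = 0).
{ rewrite <- cmod_mul, E; apply cmod_C0. }
assert (Hz : forall z, cmod z = 0 -> z = C0).
{ intros z Hz; assert (H := cmod_sqr z); rewrite Hz in H; unfold Cnorm2 in H.
  apply C_ext; simpl; nra. }
apply Rmult_integral in E2; destruct E2 as [E2|E2]; apply Hz in E2; [|exact E2].
exfalso; apply (ebas_one_neq M k Hk).
replace (ebas M k 1) with (Cadd (Csub (ebas M k 1) C1) C1) by ring.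
rewrite E2; ring.
Qed.

Lemma csum_ebas_0 M : csum (grid M) (ebas M 0) = (INR M, 0).
Proof.
rewrite (csum_ext _ _ (fun _ => C1)) by (intros; apply ebas_0).
apply C_ext; simpl; rewrite rsum_const; unfold grid; rewrite length_seq; ring.
Qed.

(** * Synthesis from modes, sampled coefficients, Parseval and Bessel *)

Definition synth (n M : nat) (c : Z -> C) (j : nat) : C :=
  csum (modes n) (fun k => Cmul (c k) (ebas M k j)).
Definition coef (M : nat) (h : nat -> C) (k : Z) : C :=
  Cscal (/ INR M) (csum (grid M) (fun j => Cmul (h j) (ebas M (- k) j))).

Lemma synth_add n M a b j :
  synth n M (fun k => Cadd (a k) (b k)) j = Cadd (synth n M a j) (synth n M b j).
Proof.
unfold synth; rewrite <- csum_add; apply csum_ext; intros; ring.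
Qed.

Lemma synth_sub n M a b j :
  synth n M (fun k => Csub (a k) (b k)) j = Csub (synth n M a j) (synth n M b j).
Proof.
unfold synth; rewrite <- csum_sub; apply csum_ext; intros; ring.
Qed.

Lemma synth_mul n M z a j :
  synth n M (fun k => Cmul z (a k)) j = Cmul z (synth n M a j).
Proof.
unfold synth; rewrite <- csum_mul; apply csum_ext; intros; ring.
Qed.

Lemma synth_ext n M a b j :
  (forall k, (Z.abs k <= Z.of_nat n)%Z -> a k = b k) -> synth n M a j = synth n M b j.
Proof.
intros H; apply csum_ext; intros k Hk; rewrite H; auto; now apply In_modes.
Qed.

Lemma cmod_synth n M c j : cmod (synth n M c j) <= rsum (modes n) (fun k => cmod (c k)).
Proof.
eapply Rle_trans; [apply cmod_csum|]; apply rsum_le; intros k _.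
rewrite cmod_mul, cmod_ebas; lra.
Qed.

Lemma csum_rdot {A} (l : list A) f z : rdot z (csum l f) = rsum l (fun a => rdot z (f a)).
Proof. unfold rdot; simpl. rewrite <- !rsum_scal, <- rsum_add; reflexivity. Qed.

Lemma csum_rdotl {A} (l : list A) f z : rdot (csum l f) z = rsum l (fun a => rdot (f a) z).
Proof.
replace (rdot (csum l f) z) with (rdot z (csum l f)) by (unfold rdot; ring).
rewrite csum_rdot; apply rsum_ext; intros; unfold rdot; ring.
Qed.

(** Duality: [coef] is the adjoint of [synth] for the two weighted products, with an arbitrary grid
    function [h]. It carries pairings with nonlinear expressions from modes to grid values, where
    they are pointwise products. *)
Lemma wdot_grid_synth L n M h b :
  wdot (L / INR M) (grid M) h (synth n M b) = wdot L (modes n) (coef M h) b.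
Proof.
unfold wdot, Rdiv; rewrite Rmult_assoc; f_equal.
unfold coef; rewrite <- rsum_scal.
rewrite (rsum_ext (grid M) _ (fun j => rsum (modes n) (fun k =>
   / INR M * rdot (h j) (Cmul (b k) (ebas M k j)))))
  by (intros; unfold synth; rewrite csum_rdot, <- rsum_scal; reflexivity).
rewrite rsum_exchange; apply rsum_ext; intros k _.
rewrite rsum_scal.
transitivity (/ INR M * rdot (csum (grid M) (fun j => Cmul (h j) (ebas M (- k) j))) (b k)).
- f_equal; rewrite csum_rdotl; apply rsum_ext; intros j _.
  rewrite ebas_opp; unfold rdot; simpl; ring.
- unfold rdot; simpl; ring.
Qed.

Lemma coef_synth n M c k :
  (Z.abs k + Z.of_nat n < Z.of_nat M)%Z -> coef M (synth n M c) k = Pm n c k.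
Proof.
intros H.
assert (HM : INR M <> 0) by (apply not_0_INR; lia).
unfold coef.
rewrite (csum_ext (grid M) _ (fun j => csum (modes n) (fun l =>
   Cmul (c l) (ebas M (l - k) j))))
  by (intros; unfold synth; rewrite <- csum_mulr; apply csum_ext; intros;
      unfold Z.sub; rewrite ebas_add; ring).
rewrite csum_exchange.
(* Aliasing is excluded here: l - k has absolute value below M, so the grid sum of mode l - k
   vanishes unless l = k. *)
assert (E : forall l, In l (modes n) ->
  csum (grid M) (fun j => Cmul (c l) (ebas M (l - k) j))
  = if Z.eq_dec l k then Cscal (INR M) (c k) else C0).
{ intros l Hl; apply In_modes in Hl; rewrite csum_mul.
  destruct (Z.eq_dec l k) as [->|Hlk].
  - rewrite Z.sub_diag.
    rewrite csum_ebas_0; apply C_ext; simpl; ring.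
  - change (csum (grid M) (fun a => ebas M (l - k) a)) with (csum (grid M) (ebas M (l - k))).
    rewrite csum_ebas_zero by lia; ring. }
rewrite (csum_ext _ _ _ E).
unfold Pm; destruct (Z.abs k <=? Z.of_nat n)%Z eqn:Hk.
- rewrite (csum_single (modes n) _ k).
  + destruct (Z.eq_dec k k) as [_|]; [|easy].
    apply C_ext; simpl; field; exact HM.
  + apply NoDup_modes.
  + intros a Ha; now destruct (Z.eq_dec a k).
  + apply In_modes; lia.
- rewrite csum_zero; [apply C_ext; simpl; ring|].
  intros a Ha; apply In_modes in Ha; destruct (Z.eq_dec a k); [lia|reflexivity].
Qed.

Lemma Pm_in n c k : (Z.abs k <= Z.of_nat n)%Z -> Pm n c k = c k.
Proof. intros H; unfold Pm; destruct (Z.leb_spec (Z.abs k) (Z.of_nat n)); [easy|lia]. Qed.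

Lemma Pm_out n c k : (Z.of_nat n < Z.abs k)%Z -> Pm n c k = C0.
Proof. intros H; unfold Pm; destruct (Z.leb_spec (Z.abs k) (Z.of_nat n)); [lia|easy]. Qed.

Lemma parseval L n M a b :
  (2 * n < M)%nat ->
  wdot (L / INR M) (grid M) (synth n M a) (synth n M b) = wdot L (modes n) a b.
Proof.
intros H; rewrite wdot_grid_synth; apply wdot_ext; intros k Hk.
apply In_modes in Hk; rewrite coef_synth, Pm_in by lia; reflexivity.
Qed.

Lemma parseval_nrm L n M a :
  (2 * n < M)%nat -> nrm (L / INR M) (grid M) (synth n M a) = nrm L (modes n) a.
Proof. intros H; unfold nrm; now rewrite parseval. Qed.

(** Expand the square of [h] minus its projection onto the modes up to [n]. The intended [h] is a
    nonlinear expression of degree above [n], whose projection is thereby controlled by pointwise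
    bounds. *)
Lemma bessel L n M h :
  0 < L -> (2 * n < M)%nat -> nrm L (modes n) (coef M h) <= nrm (L / INR M) (grid M) h.
Proof.
intros HL H.
assert (HM : 0 < INR M) by (apply lt_0_INR; lia).
assert (Hl : 0 <= L / INR M) by (apply Rlt_le, Rdiv_lt_0_compat; lra).
apply sqrt_le_1_alt.
assert (Hp := wdot_self_nonneg (L / INR M) (grid M) Hl
                (fun j => Csub (h j) (synth n M (coef M h) j))).
rewrite wdot_subl in Hp.
rewrite (wdot_sym _ _ h), wdot_subl in Hp.
rewrite (wdot_sym _ _ (synth n M (coef M h)) (fun j => Csub _ _)), wdot_subl in Hp.
change (fun i => synth n M (coef M h) i) with (synth n M (coef M h)) in Hp.
change (fun i => h i) with h in Hp.
rewrite (wdot_sym _ _ (synth n M (coef M h)) h), parseval, wdot_grid_synth in Hp by assumption.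
lra.
Qed.

(** * Discrete integration by parts *)

Definition dx (L : R) (c : Z -> C) (k : Z) : C := Cmul Ci (Cscal (kappa L k) (c k)).

(* [trigpoly L M d g g'] : [g] is the restriction to the grid of a trigonometric
   polynomial of degree at most [d], and [g'] that of its derivative. *)
Inductive trigpoly (L : R) (M d : nat) : (nat -> C) -> (nat -> C) -> Prop :=
| tp_zero : trigpoly L M d (fun _ => C0) (fun _ => C0)
| tp_step k z g g' : (Z.abs k <= Z.of_nat d)%Z -> trigpoly L M d g g' ->
    trigpoly L M d (fun j => Cadd (Cmul z (ebas M k j)) (g j))
      (fun j => Cadd (Cmul (Cmul Ci (Cscal (kappa L k) z)) (ebas M k j)) (g' j))
| tp_ext g g' h h' : (forall j, g j = h j) -> (forall j, g' j = h' j) ->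
    trigpoly L M d g g' -> trigpoly L M d h h'.

Section TrigPoly.
Variables (L : R) (M : nat).

Lemma tp_add d g g' h h' : trigpoly L M d g g' -> trigpoly L M d h h' ->
  trigpoly L M d (fun j => Cadd (g j) (h j)) (fun j => Cadd (g' j) (h' j)).
Proof.
intros Hg Hh; induction Hg as [|k z g g' Hk Hg IH|g g' p p' E E' Hg IH].
- apply (tp_ext _ _ _ h h'); [intros; ring|intros; ring|exact Hh].
- eapply tp_ext; [| |exact (tp_step _ _ _ k z _ _ Hk IH)]; intros; simpl; ring.
- eapply tp_ext; [| |exact IH]; intros; simpl; now rewrite ?E, ?E'.
Qed.

Lemma kappa_add k l : kappa L (k + l) = kappa L k + kappa L l.
Proof. unfold kappa; rewrite plus_IZR; unfold Rdiv; ring. Qed.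

Lemma kappa_opp k : kappa L (- k) = - kappa L k.
Proof. unfold kappa; rewrite opp_IZR; unfold Rdiv; ring. Qed.

Lemma tp_mono_mul d1 d2 k z g g' : (Z.abs k <= Z.of_nat d1)%Z -> trigpoly L M d2 g g' ->
  trigpoly L M (d1 + d2) (fun j => Cmul (Cmul z (ebas M k j)) (g j))
    (fun j => Cadd (Cmul (Cmul (Cmul Ci (Cscal (kappa L k) z)) (ebas M k j)) (g j))
                (Cmul (Cmul z (ebas M k j)) (g' j))).
Proof.
intros Hk Hg; induction Hg as [|l w g g' Hl Hg IH|g g' p p' E E' Hg IH].
- eapply tp_ext; [| |apply tp_zero]; intros; cbv beta; ring.
- assert (Hkl : (Z.abs (k + l) <= Z.of_nat (d1 + d2))%Z) by lia.
  eapply tp_ext; [| |exact (tp_step _ _ _ (k + l)%Z (Cmul z w) _ _ Hkl IH)]; intros j; simpl.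
  + rewrite ebas_add; ring.
  + rewrite ebas_add, kappa_add; apply C_ext; simpl; ring.
- eapply tp_ext; [| |exact IH]; intros; simpl; now rewrite ?E, ?E'.
Qed.

Lemma tp_mul d1 d2 g g' h h' : trigpoly L M d1 g g' -> trigpoly L M d2 h h' ->
  trigpoly L M (d1 + d2) (fun j => Cmul (g j) (h j))
    (fun j => Cadd (Cmul (g' j) (h j)) (Cmul (g j) (h' j))).
Proof.
intros Hg Hh; induction Hg as [|k z g g' Hk Hg IH|g g' p p' E E' Hg IH].
- eapply tp_ext; [| |apply tp_zero]; intros; cbv beta; ring.
- eapply tp_ext; [| |exact (tp_add _ _ _ _ _ (tp_mono_mul _ _ k z _ _ Hk Hh) IH)];
    intros; simpl; ring.
- eapply tp_ext; [| |exact IH]; intros; simpl; now rewrite ?E, ?E'.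
Qed.

Lemma tp_conj d g g' : trigpoly L M d g g' ->
  trigpoly L M d (fun j => Cconj (g j)) (fun j => Cconj (g' j)).
Proof.
intros Hg; induction Hg as [|k z g g' Hk Hg IH|g g' p p' E E' Hg IH].
- eapply tp_ext; [| |apply tp_zero]; intros; apply C_ext; simpl; ring.
- assert (Hk' : (Z.abs (- k) <= Z.of_nat d)%Z) by lia.
  eapply tp_ext; [| |exact (tp_step _ _ _ (- k)%Z (Cconj z) _ _ Hk' IH)]; intros j; simpl;
    rewrite ebas_opp, ?kappa_opp; apply C_ext; simpl; ring.
- eapply tp_ext; [| |exact IH]; intros; simpl; now rewrite ?E, ?E'.
Qed.

Lemma tp_synth n c : trigpoly L M n (synth n M c) (synth n M (dx L c)).
Proof.
unfold synth.
assert (H : forall l, (forall k, In k l -> (Z.abs k <= Z.of_nat n)%Z) ->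
  trigpoly L M n (fun j => csum l (fun k => Cmul (c k) (ebas M k j)))
                 (fun j => csum l (fun k => Cmul (dx L c k) (ebas M k j)))).
{ induction l as [|k l IH]; intros H.
  - apply tp_zero.
  - eapply tp_ext; [| |apply (tp_step L M n k (c k));
      [apply H; now left|apply IH; intros; apply H; now right]];
      intros; rewrite csum_cons; reflexivity. }
apply H; intros; now apply In_modes.
Qed.

(** A derivative has no mode 0, and every other mode below M sums to zero over the grid. Applied to
    a product of trigonometric polynomials, this is integration by parts. *)
Lemma tp_integral d g g' : (d < M)%nat -> trigpoly L M d g g' -> csum (grid M) g' = C0.
Proof.
intros Hd Hg; induction Hg as [|k z g g' Hk Hg IH|g g' p p' E E' Hg IH].
- now apply csum_zero.
- rewrite csum_add, IH, csum_mul.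
  destruct (Z.eq_dec k 0) as [->|Hk0].
  + unfold kappa, Rdiv; apply C_ext; simpl; ring.
  + change (fun a => ebas M k a) with (ebas M k); rewrite csum_ebas_zero by lia; ring.
- rewrite <- IH; apply csum_ext; auto.
Qed.

End TrigPoly.

(** * Agmon's inequality *)

Lemma sum_lorentzian_le th n :
  1 <= th -> rsum (modes n) (fun k => th / (th * th + IZR k * IZR k)) <= 5.
Proof.
intros Hth.
(* The mode 0 contributes 1 / th <= 1; the pairs k, -k telescope to at most 4. *)
assert (H : rsum (modes n) (fun k => th / (th * th + IZR k * IZR k))
            <= / th + 4 * th * (/ th - / (th + INR n))).
{ induction n as [|n IH].
  - simpl. replace (th / (th * th + 0 * 0)) with (/ th) by (field; lra).
    replace (th + 0) with th by ring; lra.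
  - change (modes (S n)) with (Z.of_nat (S n) :: (- Z.of_nat (S n))%Z :: modes n).
    cbn [rsum fold_right]; fold (rsum (modes n) (fun k => th / (th * th + IZR k * IZR k))).
    rewrite opp_IZR, <- INR_IZR_INZ.
    assert (Hn := pos_INR n).
    (* Half of a pair. With y = n + 1, th^2 + y^2 >= (th + y)^2 / 2 >= (th + n) (th + y) / 2, and
       the reciprocal of the last product telescopes. *)
    assert (E : th / (th * th + INR (S n) * INR (S n))
                <= 2 * th * (/ (th + INR n) - / (th + INR (S n)))).
    { rewrite S_INR; set (x := INR n) in *.
      replace (2 * th * (/ (th + x) - / (th + (x + 1))))
        with (th * (2 / ((th + x) * (th + (x + 1))))) by (field; lra).
      unfold Rdiv at 1; apply Rmult_le_compat_l; [lra|].
      apply Rmult_le_reg_r with (r := th * th + (x + 1) * (x + 1)); [nra|].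
      rewrite Rinv_l by nra.
      apply Rmult_le_reg_r with (r := (th + x) * (th + (x + 1))); [nra|].
      replace (2 / ((th + x) * (th + (x + 1))) * (th * th + (x + 1) * (x + 1)) *
               ((th + x) * (th + (x + 1))))
        with (2 * (th * th + (x + 1) * (x + 1))) by (field; lra).
      assert (H := Rle_0_sqr (th - (x + 1))); unfold Rsqr in H; nra. }
    replace (- INR (S n) * - INR (S n)) with (INR (S n) * INR (S n)) by ring.
    lra. }
eapply Rle_trans; [exact H|].
assert (Hn := pos_INR n).
assert (0 < / (th + INR n)) by (apply Rinv_0_lt_compat; lra).
assert (E : / th <= 1) by (rewrite <- Rinv_1; apply Rinv_le_contravar; lra).
rewrite Rmult_minus_distr_l, Rmult_assoc, Rinv_r by lra.
assert (0 <= 4 * th * / (th + INR n)) by (apply Rmult_le_pos; lra).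
lra.
Qed.

(** The 5 is the bound of [sum_lorentzian_le]. The factor 1 / L comes from sum |c_k|^2 = |c|^2 / L,
    the factor L from sum k^2 |c_k|^2 = |c_x|^2 L / (4 pi^2), where 4 pi^2 >= 1 is dropped. *)
Definition agmon (L : R) : R := 5 / L + 5 * L.

(* Cauchy-Schwarz against the weight [th + k^2 / th], whose inverse has sum at most 5
   when [1 <= th]; the choice is [th = 1 + |c_x| / |c|]. *)
Lemma agmon_le L n c :
  0 < L ->
  let x := nrm L (modes n) c in let q := nrm L (modes n) (dx L c) in
  rsum (modes n) (fun k => cmod (c k)) * rsum (modes n) (fun k => cmod (c k))
  <= agmon L * (x * x + x * q).
Proof.
intros HL x q.
assert (Hx : 0 <= x) by apply nrm_nonneg.
assert (Hq : 0 <= q) by apply nrm_nonneg.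
assert (Ex : rsum (modes n) (fun k => Cnorm2 (c k)) = x * x / L).
{ unfold x; rewrite nrm_sqr by lra; unfold wdot.
  rewrite (rsum_ext _ (fun i => rdot (c i) (c i)) (fun k => Cnorm2 (c k)))
    by (intros; apply rdot_self).
  field; lra. }
assert (HP := PI_RGT_0).
assert (Eq : rsum (modes n) (fun k => IZR k * IZR k * Cnorm2 (c k))
             = q * q * L / (4 * PI * PI)).
{ unfold q; rewrite nrm_sqr by lra; unfold wdot.
  rewrite (rsum_ext _ (fun i => rdot (dx L c i) (dx L c i))
    (fun k => (4 * PI * PI / (L * L)) * (IZR k * IZR k * Cnorm2 (c k)))).
  - rewrite rsum_scal; field; lra.
  - intros k _; rewrite rdot_self; unfold dx, Cnorm2, kappa; simpl; field; lra. }
set (s := rsum (modes n) (fun k => cmod (c k))).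
assert (Ecm : forall f : Z -> R, rsum (modes n) (fun k => f k * (cmod (c k) * cmod (c k)))
              = rsum (modes n) (fun k => f k * Cnorm2 (c k)))
  by (intros f; apply rsum_ext; intros; now rewrite cmod_sqr).
assert (Hth : forall th, 1 <= th -> s * s <= 5 * (th * (x * x / L) + q * q * L / th)).
{ intros th Hth.
  assert (CS := rsum_cauchy_schwarz (modes n)
    (fun k => sqrt (th / (th * th + IZR k * IZR k)))
    (fun k => sqrt ((th * th + IZR k * IZR k) / th) * cmod (c k))).
  assert (HD : forall k, 0 < th * th + IZR k * IZR k) by (intros k; nra).
  assert (Hd : forall k, 0 < th / (th * th + IZR k * IZR k))
    by (intros k; apply Rdiv_lt_0_compat; [lra|apply HD]).
  assert (Hd' : forall k, 0 < (th * th + IZR k * IZR k) / th)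
    by (intros k; apply Rdiv_lt_0_compat; [apply HD|lra]).
  rewrite (rsum_ext _ (fun a => sqrt (th / (th * th + IZR a * IZR a)) *
     (sqrt ((th * th + IZR a * IZR a) / th) * cmod (c a))) (fun k => cmod (c k))) in CS.
  2:{ intros k _; rewrite <- Rmult_assoc, <- sqrt_mult by (apply Rlt_le; auto).
      replace (th / (th * th + IZR k * IZR k) * ((th * th + IZR k * IZR k) / th)) with 1
        by (field; specialize (HD k); split; lra).
      rewrite sqrt_1; ring. }
  rewrite (rsum_ext _ (fun a => sqrt (th / (th * th + IZR a * IZR a)) *
     sqrt (th / (th * th + IZR a * IZR a))) (fun k => th / (th * th + IZR k * IZR k))) in CS
    by (intros k _; apply sqrt_sqrt, Rlt_le, Hd).
  rewrite (rsum_ext _ (fun a => sqrt ((th * th + IZR a * IZR a) / th) * cmod (c a) *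
     (sqrt ((th * th + IZR a * IZR a) / th) * cmod (c a)))
     (fun k => th * Cnorm2 (c k) + / th * (IZR k * IZR k * Cnorm2 (c k)))) in CS.
  2:{ intros k _.
      transitivity ((sqrt ((th * th + IZR k * IZR k) / th) * sqrt ((th * th + IZR k * IZR k) / th))
        * (cmod (c k) * cmod (c k))); [ring|].
      rewrite sqrt_sqrt by (apply Rlt_le, Hd'); rewrite cmod_sqr; field; lra. }
  rewrite rsum_add, !rsum_scal, Ex, Eq in CS.
  assert (Hl := sum_lorentzian_le th n Hth).
  fold s in CS.
  assert (Hc : q * q * L / (4 * PI * PI) <= q * q * L).
  { assert (1 <= 4 * PI * PI) by (assert (2 < PI * 2) by (assert (H := PI2_1); lra); nra).
    assert (0 <= q * q * L) by (apply Rmult_le_pos; nra).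
    apply Rmult_le_reg_r with (r := 4 * PI * PI); [lra|].
    unfold Rdiv; rewrite Rmult_assoc, Rinv_l by nra; nra. }
  assert (Hit : 0 < / th) by (apply Rinv_0_lt_compat; lra).
  assert (Hxx : 0 <= x * x / L) by (apply Rmult_le_pos; [nra|apply Rlt_le, Rinv_0_lt_compat; lra]).
  assert (Hqq : 0 <= q * q * L) by (apply Rmult_le_pos; nra).
  assert (H2 : th * (x * x / L) + / th * (q * q * L / (4 * PI * PI))
               <= th * (x * x / L) + q * q * L / th).
  { unfold Rdiv at 4; rewrite (Rmult_comm _ (/ th)).
    apply Rplus_le_compat_l, Rmult_le_compat_l; lra. }
  assert (0 <= th * (x * x / L) + q * q * L / th).
  { apply Rplus_le_le_0_compat; apply Rmult_le_pos; lra. }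
  eapply Rle_trans; [exact CS|].
  eapply Rle_trans; [apply Rmult_le_compat_l; [|exact H2]|].
  - apply rsum_nonneg; intros; now apply Rlt_le.
  - now apply Rmult_le_compat_r. }
destruct (Rle_lt_or_eq_dec 0 x Hx) as [Hx0|Hx0].
- assert (H := Hth (1 + q / x)).
  assert (H0 : 0 <= q / x) by (apply Rmult_le_pos; [lra|apply Rlt_le, Rinv_0_lt_compat; lra]).
  eapply Rle_trans; [apply H; lra|].
  unfold agmon.
  replace ((1 + q / x) * (x * x / L)) with (/ L * (x * x + x * q)) by (field; lra).
  replace (q * q * L / (1 + q / x)) with (L * (x * q) * (q / (x + q))) by (field; lra).
  assert (H1 : q / (x + q) <= 1).
  { apply Rmult_le_reg_r with (r := x + q); [lra|].
    unfold Rdiv; rewrite Rmult_assoc, Rinv_l by lra; lra. }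
  assert (0 <= x * q) by nra.
  assert (0 <= L * (x * q)) by nra.
  assert (0 <= L * (x * x)) by (apply Rmult_le_pos; nra).
  unfold Rdiv in *; nra.
(* If |c| = 0 the choice of [th] makes no sense, but all coefficients vanish and the constant weight
   1 is enough. *)
- assert (CS := rsum_cauchy_schwarz (modes n) (fun _ => 1) (fun k => cmod (c k))).
  rewrite (rsum_ext _ (fun a => 1 * cmod (c a)) (fun k => cmod (c k))) in CS by (intros; ring).
  rewrite (rsum_ext _ (fun a => cmod (c a) * cmod (c a)) (fun k => Cnorm2 (c k))) in CS
    by (intros; apply cmod_sqr).
  rewrite Ex, <- Hx0 in CS; fold s in CS; rewrite <- Hx0; unfold Rdiv in CS.
  lra.
Qed.

(** * Cubic Fourier coefficients *)

Definition cube (z : C) : C := Cmul (Cmul z (Cconj z)) z.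
(** All three factors are truncated, unlike in [cubic_partial] applied to [c], where the third index
    runs beyond [n]. This is the coefficient of |P_n c|^2 P_n c, which the grid reproduces
    exactly. *)
Definition cub (n : nat) (c : Z -> C) (k : Z) : C := cubic_partial (Pm n c) k n.

Lemma cub_alt n c k : cub n c k =
  csum (modes n) (fun a => csum (modes n) (fun b =>
    Cmul (Cmul (c a) (Cconj (c b))) (Pm n c (k - a + b)%Z))).
Proof.
unfold cub, cubic_partial; rewrite Csymsum_modes; apply csum_ext; intros a Ha.
rewrite Csymsum_modes; apply csum_ext; intros b Hb.
apply In_modes in Ha; apply In_modes in Hb; now rewrite !(Pm_in n c a), !(Pm_in n c b).
Qed.

(** The product of modes a and -b shifts the index, so the third factor is read off at k - a + b, of
    size at most |k| + 2 n; [coef_synth] then asks for |k| + 3 n < M. For |k| <= n, a grid of 4 n +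
    1 points is enough. *)
Lemma coef_cube n M c k :
  (Z.abs k + 3 * Z.of_nat n < Z.of_nat M)%Z ->
  coef M (fun j => cube (synth n M c j)) k = cub n c k.
Proof.
intros H; rewrite cub_alt.
transitivity (csum (modes n) (fun a => csum (modes n) (fun b =>
    Cmul (Cmul (c a) (Cconj (c b))) (coef M (synth n M c) (k - a + b)%Z)))).
- unfold coef.
  rewrite (csum_ext (grid M) _ (fun j => csum (modes n) (fun a => csum (modes n) (fun b =>
    Cmul (Cmul (c a) (Cconj (c b))) (Cmul (synth n M c j) (ebas M (- (k - a + b))%Z j)))))).
  + rewrite csum_exchange, <- csum_scal; apply csum_ext; intros a _.
    rewrite csum_exchange, <- csum_scal; apply csum_ext; intros b _.
    rewrite csum_mul; apply C_ext; simpl; ring.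
  + intros j _; unfold cube.
    set (u := synth n M c j).
    transitivity (Cmul (csum (modes n) (fun a => csum (modes n) (fun b =>
       Cmul (Cmul (c a) (ebas M a j)) (Cconj (Cmul (c b) (ebas M b j))))))
       (Cmul u (ebas M (- k) j))).
    * rewrite (csum_ext (modes n) (fun a => csum (modes n) _)
         (fun a => Cmul (Cmul (c a) (ebas M a j)) (Cconj u))).
      -- rewrite csum_mulr; fold (synth n M c j); fold u; ring.
      -- intros a _; rewrite csum_mul, csum_conj; reflexivity.
    * rewrite <- csum_mulr; apply csum_ext; intros a _.
      rewrite <- csum_mulr; apply csum_ext; intros b _.
      replace (- (k - a + b))%Z%Z with (- k + a + - b)%Z by ring.
      rewrite !ebas_add, (ebas_opp M b).
      replace (Cconj (Cmul (c b) (ebas M b j))) with (Cmul (Cconj (c b)) (Cconj (ebas M b j)))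
        by (apply C_ext; simpl; ring).
      ring.
- apply csum_ext; intros a Ha; apply csum_ext; intros b Hb.
  apply In_modes in Ha; apply In_modes in Hb; rewrite coef_synth by lia; reflexivity.
Qed.

Lemma cmod_cube z : cmod (cube z) = cmod z * cmod z * cmod z.
Proof. unfold cube; now rewrite !cmod_mul, cmod_conj. Qed.

Lemma cube_lip a b S : cmod a <= S -> cmod b <= S ->
  cmod (Csub (cube a) (cube b)) <= 3 * (S * S) * cmod (Csub a b).
Proof.
intros Ha Hb; unfold cube.
replace (Csub (Cmul (Cmul a (Cconj a)) a) (Cmul (Cmul b (Cconj b)) b))
  with (Cadd (Cmul (Csub a b) (Cmul (Cadd a b) (Cconj a)))
             (Cmul (Cmul b b) (Cconj (Csub a b)))) by (apply C_ext; simpl; ring).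
eapply Rle_trans; [apply cmod_add|].
rewrite !cmod_mul, !cmod_conj.
assert (H := cmod_add a b).
assert (H0 := cmod_nonneg (Csub a b)).
assert (H1 := cmod_nonneg a); assert (H2 := cmod_nonneg b); assert (H3 := cmod_nonneg (Cadd a b)).
assert (cmod (Cadd a b) * cmod a <= 2 * S * S) by (apply Rmult_le_compat; lra).
assert (cmod b * cmod b <= S * S) by (apply Rmult_le_compat; lra).
nra.
Qed.

(** Both cubes are sampled on the finer grid belonging to [p]. Bessel reduces the claim to the
    pointwise inequality [cube_lip], where the sum [S] of the moduli of the coefficients bounds both
    functions uniformly. *)
Lemma cub_diff L n p c S :
  0 < L -> (n <= p)%nat ->
  (forall q, rsum (modes q) (fun k => cmod (c k)) <= S) ->
  nrm L (modes n) (fun k => Csub (cub p c k) (cub n c k))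
  <= 3 * (S * S) * nrm L (modes p) (fun k => Csub (c k) (Pm n c k)).
Proof.
intros HL Hnp HS.
set (M := (4 * p + 1)%nat).
assert (Hsyn : forall j, synth n M c j = synth p M (Pm n c) j).
{ intros j; unfold synth; symmetry; apply csum_modes_restrict; [exact Hnp| |];
    intros k Hk; [rewrite Pm_in by assumption|rewrite Pm_out by assumption]; ring. }
assert (HM : 0 < INR M) by (apply lt_0_INR; unfold M; lia).
assert (Hl : 0 <= L / INR M) by (apply Rlt_le, Rdiv_lt_0_compat; lra).
rewrite (nrm_ext _ _ _ (coef M (fun j => Csub (cube (synth p M c j)) (cube (synth n M c j))))).
- eapply Rle_trans; [apply bessel; [exact HL|unfold M; lia]|].
  rewrite <- (parseval_nrm L p M) by (unfold M; lia).
  apply nrm_le_pointwise.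
  + exact Hl.
  + assert (H := Rle_0_sqr S); unfold Rsqr in H; lra.
  + intros j _; rewrite synth_sub, <- Hsyn.
    apply cube_lip; (eapply Rle_trans; [apply cmod_synth|apply HS]).
- intros k Hk; apply In_modes in Hk.
  rewrite <- !(coef_cube _ M c k) by (unfold M; lia).
  unfold coef; rewrite <- !csum_scal, <- csum_sub; apply csum_ext; intros j _.
  apply C_ext; simpl; ring.
Qed.

Lemma Un_cv_rsum {A} (l : list A) (u : A -> nat -> R) (v : A -> R) :
  (forall a, In a l -> Un_cv (u a) (v a)) -> Un_cv (fun n => rsum l (fun a => u a n)) (rsum l v).
Proof.
induction l as [|a l IH]; simpl; intros H.
- intros eps He; exists 0%nat; intros; unfold Rdist; rewrite Rminus_diag, Rabs_R0; exact He.
- apply CV_plus; auto.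
Qed.

Lemma Un_cv_const x : Un_cv (fun _ => x) x.
Proof. intros eps He; exists 0%nat; intros; unfold Rdist; rewrite Rminus_diag, Rabs_R0; exact He. Qed.

Lemma Un_cv_le u x B n0 : Un_cv u x -> (forall n, (n0 <= n)%nat -> u n <= B) -> x <= B.
Proof.
intros Hu HB; destruct (Rle_lt_dec x B) as [H|H]; [exact H|].
destruct (Hu (x - B)) as [n1 Hn1]; [lra|].
assert (H1 := Hn1 (max n0 n1) ltac:(lia)); assert (H2 := HB (max n0 n1) ltac:(lia)).
unfold Rdist in H1; apply Rabs_def2 in H1; lra.
Qed.

Lemma nrm_lim_le L l (c : nat -> Z -> C) (d : Z -> C) B n0 :
  0 < L -> 0 <= B ->
  (forall k, In k l -> Un_cv (fun n => fst (c n k)) (fst (d k)) /\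
             Un_cv (fun n => snd (c n k)) (snd (d k))) ->
  (forall n, (n0 <= n)%nat -> nrm L l (c n) <= B) -> nrm L l d <= B.
Proof.
intros HL HB Hc Hn; apply nrm_le; [exact HB|].
apply Un_cv_le with (u := fun n => wdot L l (c n) (c n)) (n0 := n0).
- unfold wdot; apply CV_mult; [apply Un_cv_const|].
  apply (Un_cv_rsum l (fun k n => rdot (c n k) (c n k))); intros k Hk.
  destruct (Hc k Hk); unfold rdot; apply CV_plus; apply CV_mult; assumption.
- intros n H; assert (H0 := Hn n H); assert (H1 := nrm_nonneg L l (c n)).
  rewrite <- nrm_sqr by lra; nra.
Qed.

Lemma wdot_modes_mono L n p c :
  0 < L -> (n <= p)%nat -> wdot L (modes n) c c <= wdot L (modes p) c c.
Proof.
intros HL H; apply Rmult_le_compat_l; [lra|]; apply rsum_modes_mono; [|exact H].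
intros; rewrite rdot_self; apply Cnorm2_nonneg.
Qed.

Lemma nrm_modes_mono L n p c :
  0 < L -> (n <= p)%nat -> nrm L (modes n) c <= nrm L (modes p) c.
Proof. intros HL H; apply sqrt_le_1_alt; now apply wdot_modes_mono. Qed.

Lemma cmod_le_nrm L n c k :
  0 < L -> (Z.abs k <= Z.of_nat n)%Z -> L * Cnorm2 (c k) <= wdot L (modes n) c c.
Proof.
intros HL Hk; unfold wdot; apply Rmult_le_compat_l; [lra|]; rewrite <- rdot_self.
apply (rsum_mem_le (modes n) (fun k => rdot (c k) (c k)) k).
- intros; rewrite rdot_self; apply Cnorm2_nonneg.
- now apply In_modes.
Qed.

(* The square partial sums [cubic_partial] do not truncate the third index; the terms
   missing in [cub] only involve coefficients beyond [n], which tend to 0. *)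
Lemma cubic_coef_cub L c k N S :
  0 < L ->
  (forall q, rsum (modes q) (fun k => cmod (c k)) <= S) ->
  (forall eta, 0 < eta -> exists n0, forall n p, (n0 <= n)%nat ->
     nrm L (modes p) (fun k => Csub (c k) (Pm n c k)) <= eta) ->
  cubic_coef c k N ->
  Un_cv (fun n => fst (cub n c k)) (fst N) /\ Un_cv (fun n => snd (cub n c k)) (snd N).
Proof.
intros HL HS Ht [H1 H2].
assert (HS0 : 0 <= S).
{ eapply Rle_trans; [|apply (HS 0%nat)]; apply rsum_nonneg; intros; apply cmod_nonneg. }
assert (HsL : 0 < sqrt L) by now apply sqrt_lt_R0.
assert (Hd : forall eta, 0 < eta -> exists n0, forall n, (n0 <= n)%nat ->
   cmod (Csub (cubic_partial c k n) (cub n c k)) <= eta).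
{ intros eta He.
  (* Each coefficient beyond n will be at most eta / (S^2 + 1), and the double sum of |c_a| |c_b|
     costs at most S^2; the added 1 keeps the denominator positive. *)
  destruct (Ht (sqrt L * (eta / (S * S + 1)))) as [n0 Hn0].
  { apply Rmult_lt_0_compat; [exact HsL|apply Rdiv_lt_0_compat; nra]. }
  exists n0; intros n Hn; rewrite cub_alt; unfold cubic_partial.
  rewrite Csymsum_modes, <- csum_sub.
  assert (Htail : forall l, cmod (Csub (c l) (Pm n c l)) <= eta / (S * S + 1)).
  { intros l.
    assert (Ha := Hn0 n (Z.abs_nat l) Hn).
    assert (Hb := cmod_le_nrm L (Z.abs_nat l) (fun k => Csub (c k) (Pm n c k)) l HL ltac:(lia)).
    assert (Hc := nrm_nonneg L (modes (Z.abs_nat l)) (fun k => Csub (c k) (Pm n c k))).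
    rewrite <- nrm_sqr in Hb by lra.
    assert (He' : 0 < eta / (S * S + 1)) by (apply Rdiv_lt_0_compat; nra).
    apply cmod_le_sqr; [lra|].
    assert (HL2 : sqrt L * sqrt L = L) by (apply sqrt_sqrt; lra).
    set (r := eta / (S * S + 1)) in *; set (q := nrm _ _ _) in *.
    assert (q * q <= (sqrt L * r) * (sqrt L * r)) by (apply Rmult_le_compat; lra).
    apply Rmult_le_reg_l with (r := L); [exact HL|].
    replace ((sqrt L * r) * (sqrt L * r)) with ((sqrt L * sqrt L) * (r * r)) in H by ring.
    rewrite HL2 in H; lra. }
  eapply Rle_trans; [apply cmod_csum|].
  apply Rle_trans with (rsum (modes n) (fun a => rsum (modes n) (fun b =>
     (eta / (S * S + 1)) * (cmod (c a) * cmod (c b))))).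
  - apply rsum_le; intros a Ha; rewrite Csymsum_modes, <- csum_sub.
    eapply Rle_trans; [apply cmod_csum|]; apply rsum_le; intros b Hb.
    replace (Csub (Cmul (Cmul (c a) (Cconj (c b))) (c (k - a + b)%Z))
                  (Cmul (Cmul (c a) (Cconj (c b))) (Pm n c (k - a + b)%Z)))
      with (Cmul (Cmul (c a) (Cconj (c b))) (Csub (c (k - a + b)%Z) (Pm n c (k - a + b)%Z))) by ring.
    rewrite !cmod_mul, cmod_conj, (Rmult_comm (eta / _)).
    apply Rmult_le_compat_l; [|apply Htail].
    apply Rmult_le_pos; apply cmod_nonneg.
  - rewrite (rsum_ext _ _ (fun a => (eta / (S * S + 1) * rsum (modes n) (fun b => cmod (c b))) * cmod (c a))).
    + rewrite rsum_scal.
      set (z := rsum (modes n) (fun b => cmod (c b))).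
      assert (0 <= z) by (apply rsum_nonneg; intros; apply cmod_nonneg).
      assert (z <= S) by apply HS.
      apply Rle_trans with (eta / (S * S + 1) * (S * S)).
      * rewrite Rmult_assoc; apply Rmult_le_compat_l; [|apply Rmult_le_compat; lra].
        apply Rlt_le, Rdiv_lt_0_compat; nra.
      * apply Rmult_le_reg_r with (r := S * S + 1); [nra|].
        replace (eta / (S * S + 1) * (S * S) * (S * S + 1)) with (eta * (S * S)) by (field; nra).
        nra.
    + intros a _; rewrite rsum_scal, rsum_scal; ring. }
split; intros eps He.
- destruct (H1 (eps / 2)) as [n1 Hn1]; [lra|]. destruct (Hd (eps / 4)) as [n2 Hn2]; [lra|].
  exists (max n1 n2); intros n Hn.
  assert (Ha := Hn1 n ltac:(lia)); assert (Hb := Hn2 n ltac:(lia)).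
  assert (Hc := fst_le_cmod (Csub (cubic_partial c k n) (cub n c k))); simpl in Hc.
  assert (Hbc := Rle_trans _ _ _ Hc Hb).
  unfold Rdist in *; apply Rabs_def2 in Ha; apply Rabs_le_both in Hbc.
  apply Rabs_def1; lra.
- destruct (H2 (eps / 2)) as [n1 Hn1]; [lra|]. destruct (Hd (eps / 4)) as [n2 Hn2]; [lra|].
  exists (max n1 n2); intros n Hn.
  assert (Ha := Hn1 n ltac:(lia)); assert (Hb := Hn2 n ltac:(lia)).
  assert (Hc := snd_le_cmod (Csub (cubic_partial c k n) (cub n c k))); simpl in Hc.
  assert (Hbc := Rle_trans _ _ _ Hc Hb).
  unfold Rdist in *; apply Rabs_def2 in Ha; apply Rabs_le_both in Hbc.
  apply Rabs_def1; lra.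
Qed.

(** Limit of [cub_diff] as p tends to infinity with n fixed; [cubic_coef_cub] identifies the limit
    of [cub p] with the true coefficients [N]. *)
Lemma cubic_error L n c N S tau :
  0 < L -> 0 <= tau ->
  (forall q, rsum (modes q) (fun k => cmod (c k)) <= S) ->
  (forall eta, 0 < eta -> exists n0, forall n p, (n0 <= n)%nat ->
     nrm L (modes p) (fun k => Csub (c k) (Pm n c k)) <= eta) ->
  (forall k, cubic_coef c k (N k)) ->
  (forall p, nrm L (modes p) (fun k => Csub (c k) (Pm n c k)) <= tau) ->
  nrm L (modes n) (fun k => Csub (N k) (cub n c k)) <= 3 * (S * S) * tau.
Proof.
intros HL Htau HS Ht HN Htail.
assert (HSS := Rle_0_sqr S); unfold Rsqr in HSS.
apply nrm_lim_le with (c := fun p k => Csub (cub p c k) (cub n c k)) (n0 := n).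
- exact HL.
- apply Rmult_le_pos; lra.
- intros k _; destruct (cubic_coef_cub L c k (N k) S HL HS Ht (HN k)) as [H1 H2].
  split; simpl; apply CV_minus; try apply Un_cv_const; assumption.
- intros p Hp; eapply Rle_trans; [apply (cub_diff L n p c S HL Hp HS)|].
  apply Rmult_le_compat_l; [lra|apply Htail].
Qed.

(** * Sobolev norms and uniform tails *)

Definition lap (L : R) (c : Z -> C) (k : Z) : C := Cscal (- (kappa L k ^ 2)) (c k).
(** The complementary projection Q_n; the overview uses it with n = m. *)
Definition tail (n : nat) (c : Z -> C) (k : Z) : C := Csub (c k) (Pm n c k).

Lemma L2sq_wdot L c n : L * symsum (fun k => 1 * Cnorm2 (c k)) n = wdot L (modes n) c c.
Proof.
rewrite symsum_modes; unfold wdot; f_equal; apply rsum_ext; intros; rewrite rdot_self; ring.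
Qed.

Lemma H1sq_wdot L c n : L * symsum (fun k => (1 + kappa L k ^ 2) * Cnorm2 (c k)) n
  = wdot L (modes n) c c + wdot L (modes n) (dx L c) (dx L c).
Proof.
rewrite symsum_modes; unfold wdot; rewrite <- Rmult_plus_distr_l, <- rsum_add; f_equal.
apply rsum_ext; intros; unfold rdot, Cnorm2, dx; simpl; ring.
Qed.

Lemma H2sq_wdot L c n : L * symsum (fun k => (1 + kappa L k ^ 4) * Cnorm2 (c k)) n
  = wdot L (modes n) c c + wdot L (modes n) (lap L c) (lap L c).
Proof.
rewrite symsum_modes; unfold wdot; rewrite <- Rmult_plus_distr_l, <- rsum_add; f_equal.
apply rsum_ext; intros; unfold rdot, Cnorm2, lap; simpl; ring.
Qed.

Lemma L2sq_nrm L c B n : 0 < L -> 0 <= B -> L2sq_le L c (B * B) -> nrm L (modes n) c <= B.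
Proof. intros HL HB H; apply nrm_le; [exact HB|]; rewrite <- L2sq_wdot; apply H. Qed.

Lemma H2sq_nrm L c B n : 0 < L -> 0 <= B -> H2sq_le L c (B * B) ->
  nrm L (modes n) c <= B /\ nrm L (modes n) (lap L c) <= B.
Proof.
intros HL HB H; specialize (H n); cbv beta in H; rewrite H2sq_wdot in H.
assert (H1 := wdot_self_nonneg L (modes n) (Rlt_le _ _ HL) c).
assert (H2 := wdot_self_nonneg L (modes n) (Rlt_le _ _ HL) (lap L c)).
split; apply nrm_le; lra.
Qed.

(** Interpolation: |c_x|^2 = - Re (c, c_xx), followed by Cauchy-Schwarz. *)
Lemma nrm_dx_sqr_le L n c : 0 < L ->
  nrm L (modes n) (dx L c) * nrm L (modes n) (dx L c)
  <= nrm L (modes n) c * nrm L (modes n) (lap L c).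
Proof.
intros HL; rewrite nrm_sqr by lra.
assert (H := wdot_le L (modes n) (Rlt_le _ _ HL) c (lap L c)).
replace (wdot L (modes n) c (lap L c)) with (- wdot L (modes n) (dx L c) (dx L c)) in H.
- apply Rabs_le_both in H; lra.
- unfold wdot; rewrite Ropp_mult_distr_r; f_equal.
  replace (- rsum (modes n) (fun i => rdot (dx L c i) (dx L c i)))
    with (-1 * rsum (modes n) (fun i => rdot (dx L c i) (dx L c i))) by ring.
  rewrite <- rsum_scal; apply rsum_ext; intros; unfold rdot, dx, lap; simpl; ring.
Qed.

Lemma dx_dx L c k : dx L (dx L c) k = lap L c k.
Proof. unfold dx, lap; apply C_ext; simpl; ring. Qed.

Lemma kappa_sqr_mono L n k : 0 < L -> (Z.of_nat n <= Z.abs k)%Z ->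
  kappa L (Z.of_nat n) ^ 2 <= kappa L k ^ 2.
Proof.
intros HL H; unfold kappa, Rdiv.
replace ((2 * PI * IZR k * / L) ^ 2) with ((2 * PI * / L) ^ 2 * (IZR k ^ 2)) by ring.
replace ((2 * PI * IZR (Z.of_nat n) * / L) ^ 2)
  with ((2 * PI * / L) ^ 2 * (IZR (Z.of_nat n) ^ 2)) by ring.
apply Rmult_le_compat_l; [nra|].
simpl; rewrite !Rmult_1_r, <- !mult_IZR; apply IZR_le; nia.
Qed.

Lemma tail_le n c k : cmod (tail n c k) <= cmod (c k).
Proof.
unfold tail; destruct (Z.leb_spec (Z.abs k) (Z.of_nat n)).
- rewrite Pm_in by assumption. replace (Csub (c k) (c k)) with C0 by ring.
  rewrite cmod_C0; apply cmod_nonneg.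
- rewrite Pm_out by assumption. replace (Csub (c k) C0) with (c k) by ring; lra.
Qed.

Lemma nrm_tail_le L n p c : 0 < L -> nrm L (modes p) (tail n c) <= nrm L (modes p) c.
Proof. intros HL; apply nrm_le_eqmod; [lra|]; intros; apply tail_le. Qed.

Lemma lap_tail L n c k : lap L (tail n c) k = tail n (lap L c) k.
Proof.
unfold tail, Pm, lap; destruct (Z.abs k <=? Z.of_nat n)%Z; apply C_ext; simpl; ring.
Qed.

Lemma nrm_tail_dx L n p c : 0 < L ->
  kappa L (Z.of_nat n) ^ 2 * (nrm L (modes p) (tail n c) * nrm L (modes p) (tail n c))
  <= nrm L (modes p) (dx L c) * nrm L (modes p) (dx L c).
Proof.
intros HL; rewrite !nrm_sqr by lra; unfold wdot.
replace (kappa L (Z.of_nat n) ^ 2 * (L * rsum (modes p) (fun i => rdot (tail n c i) (tail n c i))))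
  with (L * (kappa L (Z.of_nat n) ^ 2 * rsum (modes p) (fun i => rdot (tail n c i) (tail n c i)))) by ring.
apply Rmult_le_compat_l; [lra|]; rewrite <- rsum_scal; apply rsum_le; intros k _.
assert (H0 : 0 <= rdot (dx L c k) (dx L c k)) by (rewrite rdot_self; apply Cnorm2_nonneg).
unfold tail; destruct (Z.leb_spec (Z.abs k) (Z.of_nat n)).
- rewrite Pm_in by assumption. replace (Csub (c k) (c k)) with C0 by ring.
  unfold rdot at 1; simpl; lra.
- rewrite Pm_out by assumption. replace (Csub (c k) C0) with (c k) by ring.
  replace (rdot (dx L c k) (dx L c k)) with (kappa L k ^ 2 * Cnorm2 (c k))
    by (unfold rdot, Cnorm2, dx; simpl; ring).
  rewrite rdot_self; apply Rmult_le_compat_r; [apply Cnorm2_nonneg|].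
  apply kappa_sqr_mono; [exact HL|lia].
Qed.

Lemma nrm_tail_lap L n p c : 0 < L ->
  kappa L (Z.of_nat n) ^ 2 * nrm L (modes p) (tail n c) <= nrm L (modes p) (lap L (tail n c)).
Proof.
intros HL.
destruct (Req_dec (kappa L (Z.of_nat n) ^ 2) 0) as [E|E].
{ rewrite E, Rmult_0_l; apply nrm_nonneg. }
assert (Hk : 0 < kappa L (Z.of_nat n) ^ 2) by (assert (H := pow2_ge_0 (kappa L (Z.of_nat n))); lra).
set (K := kappa L (Z.of_nat n) ^ 2) in *.
assert (H : nrm L (modes p) (tail n c) <= / K * nrm L (modes p) (lap L (tail n c))).
{ apply nrm_le_pointwise; [lra|apply Rlt_le, Rinv_0_lt_compat, Hk|].
  intros k _; unfold lap; rewrite cmod_scal, Rabs_Ropp, Rabs_pos_eq by apply pow2_ge_0.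
  unfold tail; destruct (Z.leb_spec (Z.abs k) (Z.of_nat n)).
  - rewrite Pm_in by assumption. replace (Csub (c k) (c k)) with C0 by ring.
    rewrite cmod_C0; lra.
  - assert (H1 := kappa_sqr_mono L n k HL ltac:(lia)); fold K in H1.
    rewrite <- Rmult_assoc.
    assert (1 <= / K * kappa L k ^ 2).
    { apply Rmult_le_reg_l with (r := K); [exact Hk|]; rewrite <- Rmult_assoc, Rinv_r; lra. }
    assert (H2 := cmod_nonneg (Csub (c k) (Pm n c k))); nra. }
apply Rmult_le_reg_l with (r := / K); [apply Rinv_0_lt_compat, Hk|].
rewrite <- Rmult_assoc, Rinv_l, Rmult_1_l; [exact H|exact E].
Qed.

(** Finite sections of every length [p] stand for the norms of the infinite series. The property
    persists when n grows, as [locally_uniform] requires. *)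
Definition small_tail (L eta : R) (n : nat) (c : Z -> C) : Prop :=
  forall p, nrm L (modes p) (tail n c) <= eta /\ nrm L (modes p) (lap L (tail n c)) <= eta.

Lemma tail_tail n p c k : (n <= p)%nat -> tail p c k = tail p (tail n c) k.
Proof.
intros H; unfold tail, Pm.
destruct (Z.leb_spec (Z.abs k) (Z.of_nat p)), (Z.leb_spec (Z.abs k) (Z.of_nat n));
  try lia; ring.
Qed.

Lemma small_tail_mono L eta n p c :
  0 < L -> (n <= p)%nat -> small_tail L eta n c -> small_tail L eta p c.
Proof.
intros HL Hnp H q; destruct (H q) as [H1 H2]; split.
- rewrite (nrm_ext _ _ _ (tail p (tail n c))) by (intros; now apply tail_tail).
  eapply Rle_trans; [now apply nrm_tail_le|exact H1].
- rewrite (nrm_ext _ _ _ (tail p (lap L (tail n c)))).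
  + eapply Rle_trans; [now apply nrm_tail_le|exact H2].
  + intros k _; rewrite lap_tail, (tail_tail n p) by exact Hnp.
    unfold tail at 1 3, Pm; destruct (Z.abs k <=? Z.of_nat p)%Z; [ring|].
    now rewrite lap_tail.
Qed.

(** The partial sums [W] of the squared H^2 norm increase to a limit, and by Pythagoras the tail
    beyond n0 is the missing part of the limit. *)
Lemma small_tail_exists L B c eta :
  0 < L -> H2sq_le L c B -> 0 < eta -> exists n, small_tail L eta n c.
Proof.
intros HL HB He.
set (W := fun n => wdot L (modes n) c c + wdot L (modes n) (lap L c) (lap L c)).
assert (HW : forall n p, (n <= p)%nat -> W n <= W p).
{ intros; unfold W; apply Rplus_le_compat; now apply wdot_modes_mono. }
assert (HWB : forall n, W n <= B) by (intros n; unfold W; rewrite <- H2sq_wdot; apply HB).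
destruct (growing_cv W) as [l Hl].
{ intros n; apply HW; lia. }
{ exists B; intros x [n ->]; apply HWB. }
destruct (Hl (eta * eta)) as [n0 Hn0]; [nra|].
assert (Hlub : forall n, W n <= l).
{ intros n. destruct (Rle_lt_dec (W n) l) as [H|H]; [exact H|].
  destruct (Hl (W n - l)) as [n1 Hn1]; [lra|].
  specialize (Hn1 (max n n1) ltac:(lia)); assert (H1 := HW n (max n n1) ltac:(lia)).
  unfold Rdist in Hn1; apply Rabs_def2 in Hn1; lra. }
specialize (Hn0 n0 (le_n _)); unfold Rdist in Hn0; apply Rabs_def2 in Hn0.
exists n0.
assert (Hsplit : forall d p, wdot L (modes (max n0 p)) (tail n0 d) (tail n0 d)
          = wdot L (modes (max n0 p)) d d - wdot L (modes n0) d d).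
{ intros d p; unfold wdot; rewrite <- Rmult_minus_distr_l; f_equal.
  rewrite <- (rsum_modes_restrict (fun k => rdot (d k) (d k))
     (fun k => rdot (Pm n0 d k) (Pm n0 d k)) n0 (max n0 p)); [|lia| |].
  - rewrite <- rsum_sub; apply rsum_ext; intros k _; unfold tail, Pm.
    destruct (Z.abs k <=? Z.of_nat n0)%Z; unfold rdot; simpl; ring.
  - intros k Hk; now rewrite Pm_in.
  - intros k Hk; rewrite Pm_out by assumption; unfold rdot; simpl; ring. }
intros p.
assert (Hp := Hlub (max n0 p)).
assert (H1 := Hsplit c p); assert (H2 := Hsplit (lap L c) p); unfold W in *.
assert (H3 := wdot_self_nonneg L (modes (max n0 p)) (Rlt_le _ _ HL) (tail n0 c)).
assert (H4 := wdot_self_nonneg L (modes (max n0 p)) (Rlt_le _ _ HL) (tail n0 (lap L c))).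
split.
- eapply Rle_trans; [apply (nrm_modes_mono L p (max n0 p)); [exact HL|lia]|].
  apply nrm_le; lra.
- rewrite (nrm_ext _ _ _ (tail n0 (lap L c))) by (intros; apply lap_tail).
  eapply Rle_trans; [apply (nrm_modes_mono L p (max n0 p)); [exact HL|lia]|].
  apply nrm_le; lra.
Qed.

(** Compactness of [a, b] as a supremum argument: [E] collects the x for which one n serves [a, x].
    Monotonicity in n allows two intervals to be joined by taking a maximum. *)
Lemma locally_uniform (P : nat -> R -> Prop) :
  (forall n p t, (n <= p)%nat -> P n t -> P p t) ->
  (forall s, exists delta n, 0 < delta /\ forall t, Rabs (t - s) < delta -> P n t) ->
  forall a b, a <= b -> exists n, forall t, a <= t <= b -> P n t.
Proof.
intros Hmono Hloc a b Hab.
set (E := fun x => a <= x <= b /\ exists n, forall t, a <= t <= x -> P n t).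
assert (Ha : E a).
{ split; [lra|]. destruct (Hloc a) as (d & n & Hd & Hn); exists n; intros t Ht; apply Hn.
  replace (t - a) with 0 by lra; rewrite Rabs_R0; exact Hd. }
destruct (completeness E) as [x [Hx1 Hx2]].
{ exists b; intros y [Hy _]; lra. }
{ now exists a. }
assert (Hax : a <= x) by now apply Hx1.
assert (Hxb : x <= b) by (apply Hx2; intros y [Hy _]; lra).
destruct (Hloc x) as (d & n & Hd & Hn).
assert (Hy : exists y, E y /\ x - d < y).
{ apply Classical_Prop.NNPP; intros Hc.
  assert (x <= x - d); [|lra].
  apply Hx2; intros y Hy; destruct (Rle_lt_dec y (x - d)); [assumption|].
  exfalso; apply Hc; now exists y. }
destruct Hy as (y & [Hy1 [n1 Hn1]] & Hy2).
(* A point of [E] beyond the supremum x, unless it is b itself; hence b belongs to [E]. *)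
assert (Hz : E (Rmin b (x + d / 2))).
{ split; [split; [apply Rmin_glb; lra|apply Rmin_l]|].
  exists (max n n1); intros t Ht.
  destruct (Rle_lt_dec t y).
  - apply (Hmono n1); [lia|]; apply Hn1; lra.
  - apply (Hmono n); [lia|]; apply Hn.
    assert (H := Rmin_r b (x + d / 2)); apply Rabs_def1; lra. }
assert (Hle := Hx1 _ Hz).
destruct Hz as [_ [n2 Hn2]]; exists n2; intros t Ht; apply Hn2.
split; [lra|].
unfold Rmin in *; destruct (Rle_dec b (x + d / 2)); lra.
Qed.

(** Near s the tail of w(t) is the tail of w(s) plus that of w(t) - w(s); the latter is at most eta
    / 2 for every n by continuity in H^2, so an n found at s works on a neighbourhood. *)
Lemma small_tail_uniform L w a b eta :
  0 < L -> in_Y L w -> a <= b -> 0 < eta ->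
  exists n0, forall n, (n0 <= n)%nat -> forall t, a <= t <= b -> small_tail L eta n (w t).
Proof.
intros HL [[B HB] Hcont] Hab He.
destruct (locally_uniform (fun n t => small_tail L eta n (w t))) with (a := a) (b := b)
  as [n0 Hn0].
- intros n p t Hnp; now apply small_tail_mono.
- intros s.
  destruct (small_tail_exists L B (w s) (eta / 2) HL (HB s)) as [n Hn]; [lra|].
  destruct (Hcont s (eta / 2)) as (d & Hd & Ht); [lra|].
  exists d, n; split; [exact Hd|]; intros t Htd p.
  specialize (Ht t Htd); destruct (Hn p) as [H1 H2].
  set (z := fun k => Csub (w t k) (w s k)) in *.
  replace ((eta / 2) ^ 2) with ((eta / 2) * (eta / 2)) in Ht by ring.
  destruct (H2sq_nrm L z (eta / 2) p HL ltac:(lra) Ht) as [H3 H4].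
  assert (Hz : forall k, tail n (w t) k = Cadd (tail n (w s) k) (tail n z k)).
  { intros k; unfold tail, Pm, z; destruct (Z.abs k <=? Z.of_nat n)%Z; ring. }
  split.
  + rewrite (nrm_ext _ _ _ _ (fun k _ => Hz k)).
    eapply Rle_trans; [apply nrm_add; lra|].
    assert (H5 := nrm_tail_le L n p z HL); lra.
  + rewrite (nrm_ext _ _ _ (fun k => Cadd (lap L (tail n (w s)) k) (tail n (lap L z) k))).
    * eapply Rle_trans; [apply nrm_add; lra|].
      assert (H5 := nrm_tail_le L n p (lap L z) HL); lra.
    * intros k _; rewrite <- lap_tail; unfold lap; rewrite Hz; apply C_ext; simpl; ring.
- exact Hab.
- exists n0; intros n Hn t Ht; apply (small_tail_mono L eta n0); auto.
Qed.

(** * Gronwall's inequality on the line *)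

(** The function exp(rho t) (J - K / rho) is nonincreasing on [a, b], by the mean value theorem. *)
Lemma gronwall (J J' : R -> R) rho K a b :
  0 < rho -> a <= b -> (forall t, derivable_pt_lim J t (J' t)) ->
  (forall t, a <= t <= b -> J' t <= - rho * J t + K) ->
  J b - K / rho <= exp (- (rho * (b - a))) * (J a - K / rho).
Proof.
intros Hr Hab HJ HK.
set (G := fun t => exp (rho * t) * (J t - K / rho)).
set (G' := fun t => exp (rho * t) * rho * (J t - K / rho) + exp (rho * t) * J' t).
assert (HG : forall t, derivable_pt_lim G t (G' t)).
{ intros t; unfold G, G'.
  apply (derivable_pt_lim_mult (fun t => exp (rho * t)) (fun t => J t - K / rho)).
  - apply (derivable_pt_lim_comp (fun t => rho * t) exp t rho); [|apply derivable_pt_lim_exp].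
    assert (Hid := derivable_pt_lim_scal (fun t => t) rho t 1 (derivable_pt_lim_id t)).
    rewrite Rmult_1_r in Hid; exact Hid.
  - replace (J' t) with (J' t - 0) by ring.
    apply (derivable_pt_lim_minus J (fun _ => K / rho)); [apply HJ|apply derivable_pt_lim_const]. }
assert (Hle : G b <= G a).
{ destruct (Req_dec a b) as [->|Hne]; [lra|].
  destruct (MVT_cor2 G G' a b) as (t & Ht & Htab); [lra|intros; apply HG|].
  assert (H := HK t ltac:(lra)).
  assert (G' t <= 0); [|nra].
  unfold G'; assert (He := exp_pos (rho * t)).
  replace (exp (rho * t) * rho * (J t - K / rho) + exp (rho * t) * J' t)
    with (exp (rho * t) * (rho * J t - K + J' t)) by (field; lra).
  nra. }
unfold G in Hle.
apply Rmult_le_reg_l with (r := exp (rho * b)); [apply exp_pos|].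
rewrite <- Rmult_assoc, <- exp_plus.
replace (rho * b + - (rho * (b - a))) with (rho * a) by ring; exact Hle.
Qed.

(* A bounded quantity on the whole line that is damped at rate [rho] has forgotten
   its past: only the forcing [K / rho] remains. *)
Lemma gronwall_line (J J' : nat -> R -> R) rho K B n1 :
  0 < rho -> (forall n t, derivable_pt_lim (J n) t (J' n t)) ->
  (forall n t, (n1 <= n)%nat -> Rabs (J n t) <= B) ->
  (forall a b eta, a <= b -> 0 < eta -> exists n0, forall n, (n0 <= n)%nat ->
     forall t, a <= t <= b -> J' n t <= - rho * J n t + K + eta) ->
  forall t eta, 0 < eta -> exists n0, forall n, (n0 <= n)%nat -> J n t <= K / rho + eta.
Proof.
intros Hr HJ HB HK t eta He.
assert (HB0 : 0 <= B) by (eapply Rle_trans; [apply Rabs_pos|apply (HB n1 t (le_n _))]).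
set (D := B + Rabs K / rho + eta).
assert (HD : 0 < D).
{ unfold D; assert (0 <= Rabs K / rho)
    by (apply Rmult_le_pos; [apply Rabs_pos|apply Rlt_le, Rinv_0_lt_compat, Hr]); lra. }
(* T is fixed before n: by exp x >= x, the factor exp(- rho T) reduces an initial gap of at most [D]
   to eta / 2. The differential inequality is then needed on [t - T, t] only, with error rho eta /
   2. *)
set (T := D / (rho * (eta / 2))).
assert (HT : 0 < T) by (apply Rdiv_lt_0_compat; nra).
destruct (HK (t - T) t (rho * (eta / 2))) as [n0 Hn0]; [lra|nra|].
exists (max n0 n1); intros n Hn.
assert (H := gronwall (J n) (J' n) rho (K + rho * (eta / 2)) (t - T) t Hr ltac:(lra) (HJ n)).
replace (t - (t - T)) with T in H by ring.
replace ((K + rho * (eta / 2)) / rho) with (K / rho + eta / 2) in H by (field; lra).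
assert (H0 : J n t - (K / rho + eta / 2)
    <= exp (- (rho * T)) * (J n (t - T) - (K / rho + eta / 2))).
{ apply H; intros r Hr0; rewrite <- Rplus_assoc; apply Hn0; [lia|lra]. }
assert (Hexp : exp (- (rho * T)) * D <= eta / 2).
{ rewrite exp_Ropp.
  assert (Hx : rho * T <= exp (rho * T)) by (assert (Hy := exp_ineq1_le (rho * T)); lra).
  assert (HrT : rho * T * (eta / 2) = D) by (unfold T; field; lra).
  apply Rmult_le_reg_l with (r := exp (rho * T)); [apply exp_pos|].
  rewrite <- Rmult_assoc, Rinv_r, Rmult_1_l by (assert (Hy := exp_pos (rho * T)); lra).
  nra. }
assert (HJD : J n (t - T) - (K / rho + eta / 2) <= D).
{ assert (Ha := HB n (t - T) ltac:(lia)); apply Rabs_le_both in Ha.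
  assert (Hb : - (K / rho) <= Rabs K / rho).
  { unfold Rdiv; rewrite Ropp_mult_distr_l; apply Rmult_le_compat_r;
      [apply Rlt_le, Rinv_0_lt_compat, Hr|]. rewrite <- Rabs_Ropp; apply Rle_abs. }
  unfold D; lra. }
assert (He1 := exp_pos (- (rho * T))).
assert (exp (- (rho * T)) * (J n (t - T) - (K / rho + eta / 2)) <= exp (- (rho * T)) * D)
  by (apply Rmult_le_compat_l; lra).
lra.
Qed.

(** * Energy identities for the truncated equation *)

Definition Cderiv (f : R -> C) (s : R) (l : C) : Prop :=
  derivable_pt_lim (fun t => fst (f t)) s (fst l) /\
  derivable_pt_lim (fun t => snd (f t)) s (snd l).

Lemma derivable_pt_lim_eq f s l l' : derivable_pt_lim f s l -> l = l' -> derivable_pt_lim f s l'.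
Proof. now intros H <-. Qed.

Lemma Cderiv_const z s : Cderiv (fun _ => z) s C0.
Proof. split; apply derivable_pt_lim_const. Qed.

Lemma Cderiv_add f g s l l' : Cderiv f s l -> Cderiv g s l' ->
  Cderiv (fun t => Cadd (f t) (g t)) s (Cadd l l').
Proof.
intros [H1 H2] [H3 H4]; split; simpl.
- now apply (derivable_pt_lim_plus (fun t => fst (f t)) (fun t => fst (g t))).
- now apply (derivable_pt_lim_plus (fun t => snd (f t)) (fun t => snd (g t))).
Qed.

Lemma Cderiv_sub f g s l l' : Cderiv f s l -> Cderiv g s l' ->
  Cderiv (fun t => Csub (f t) (g t)) s (Csub l l').
Proof.
intros [H1 H2] [H3 H4]; split; simpl.
- now apply (derivable_pt_lim_minus (fun t => fst (f t)) (fun t => fst (g t))).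
- now apply (derivable_pt_lim_minus (fun t => snd (f t)) (fun t => snd (g t))).
Qed.

Lemma Cderiv_mul f g s l l' : Cderiv f s l -> Cderiv g s l' ->
  Cderiv (fun t => Cmul (f t) (g t)) s (Cadd (Cmul l (g s)) (Cmul (f s) l')).
Proof.
intros [H1 H2] [H3 H4]; split; simpl.
- eapply derivable_pt_lim_eq.
  + apply (derivable_pt_lim_minus (fun t => fst (f t) * fst (g t)) (fun t => snd (f t) * snd (g t)));
      [apply (derivable_pt_lim_mult (fun t => fst (f t)) (fun t => fst (g t)))
      |apply (derivable_pt_lim_mult (fun t => snd (f t)) (fun t => snd (g t)))]; eassumption.
  + simpl; ring.
- eapply derivable_pt_lim_eq.
  + apply (derivable_pt_lim_plus (fun t => fst (f t) * snd (g t)) (fun t => snd (f t) * fst (g t)));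
      [apply (derivable_pt_lim_mult (fun t => fst (f t)) (fun t => snd (g t)))
      |apply (derivable_pt_lim_mult (fun t => snd (f t)) (fun t => fst (g t)))]; eassumption.
  + simpl; ring.
Qed.

Lemma Cderiv_conj f s l : Cderiv f s l -> Cderiv (fun t => Cconj (f t)) s (Cconj l).
Proof.
intros [H1 H2]; split; simpl; [exact H1|].
now apply (derivable_pt_lim_opp (fun t => snd (f t))).
Qed.

Lemma Cderiv_eq f s l l' : Cderiv f s l -> l = l' -> Cderiv f s l'.
Proof. now intros H <-. Qed.

Lemma Cderiv_cmul z f s l : Cderiv f s l -> Cderiv (fun t => Cmul z (f t)) s (Cmul z l).
Proof.
intros H; eapply Cderiv_eq; [apply (Cderiv_mul (fun _ => z) f); [apply Cderiv_const|exact H]|].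
simpl; ring.
Qed.

Lemma Cderiv_scal r f s l : Cderiv f s l -> Cderiv (fun t => Cscal r (f t)) s (Cscal r l).
Proof.
intros [H1 H2]; split; simpl.
- now apply (derivable_pt_lim_scal (fun t => fst (f t))).
- now apply (derivable_pt_lim_scal (fun t => snd (f t))).
Qed.

Lemma rsum_deriv {A} (l : list A) (f : A -> R -> R) (f' : A -> R) s :
  (forall a, In a l -> derivable_pt_lim (f a) s (f' a)) ->
  derivable_pt_lim (fun t => rsum l (fun a => f a t)) s (rsum l f').
Proof.
induction l as [|a l IH]; simpl; intros H; [apply derivable_pt_lim_const|].
apply (derivable_pt_lim_plus (f a) (fun t => rsum l (fun a => f a t))); auto.
Qed.

Lemma csum_deriv {A} (l : list A) (f : A -> R -> C) (f' : A -> C) s :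
  (forall a, In a l -> Cderiv (f a) s (f' a)) ->
  Cderiv (fun t => csum l (fun a => f a t)) s (csum l f').
Proof.
intros H; split; simpl.
- apply (rsum_deriv l (fun a t => fst (f a t)) (fun a => fst (f' a))); intros; now apply H.
- apply (rsum_deriv l (fun a t => snd (f a t)) (fun a => snd (f' a))); intros; now apply H.
Qed.

Lemma rdot_deriv f g s l l' : Cderiv f s l -> Cderiv g s l' ->
  derivable_pt_lim (fun t => rdot (f t) (g t)) s (rdot l (g s) + rdot (f s) l').
Proof.
intros [H1 H2] [H3 H4]; unfold rdot; eapply derivable_pt_lim_eq.
- apply (derivable_pt_lim_plus (fun t => fst (f t) * fst (g t)) (fun t => snd (f t) * snd (g t)));
    [apply (derivable_pt_lim_mult (fun t => fst (f t)) (fun t => fst (g t)))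
    |apply (derivable_pt_lim_mult (fun t => snd (f t)) (fun t => snd (g t)))]; eassumption.
- simpl; ring.
Qed.

Lemma wdot_deriv {A} lam (l : list A) (f g : R -> A -> C) (f' g' : A -> C) s :
  (forall a, In a l -> Cderiv (fun t => f t a) s (f' a)) ->
  (forall a, In a l -> Cderiv (fun t => g t a) s (g' a)) ->
  derivable_pt_lim (fun t => wdot lam l (f t) (g t)) s (wdot lam l f' (g s) + wdot lam l (f s) g').
Proof.
intros Hf Hg; unfold wdot.
rewrite <- Rmult_plus_distr_l, <- rsum_add.
apply (derivable_pt_lim_scal (fun t => rsum l (fun i => rdot (f t i) (g t i)))).
apply (rsum_deriv l (fun i t => rdot (f t i) (g t i))
         (fun i => rdot (f' i) (g s i) + rdot (f s i) (g' i))); intros a Ha.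
apply rdot_deriv; auto.
Qed.

Lemma synth_deriv n M (c : R -> Z -> C) c' s j :
  (forall k, Cderiv (fun t => c t k) s (c' k)) ->
  Cderiv (fun t => synth n M (c t) j) s (synth n M c' j).
Proof.
intros H; unfold synth; apply (csum_deriv _ (fun k t => Cmul (c t k) (ebas M k j))); intros k _.
eapply Cderiv_eq; [apply Cderiv_mul; [apply H|apply Cderiv_const]|simpl; ring].
Qed.

Lemma coef_deriv M (h : R -> nat -> C) h' s k :
  (forall j, Cderiv (fun t => h t j) s (h' j)) ->
  Cderiv (fun t => coef M (h t) k) s (coef M h' k).
Proof.
intros H; unfold coef; apply Cderiv_scal.
apply (csum_deriv _ (fun j t => Cmul (h t j) (ebas M (- k) j))); intros j _.
eapply Cderiv_eq; [apply Cderiv_mul; [apply H|apply Cderiv_const]|simpl; ring].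
Qed.

(** The real differential of z -> |z|^2 z at u. Its antilinear part u^2 conj h is the source of the
    term that the correction in the last functional removes. *)
Definition dcube (u h : C) : C :=
  Cadd (Cscal 2 (Cmul (Cmul u (Cconj u)) h)) (Cmul (Cmul u u) (Cconj h)).

Lemma cube_deriv f s l : Cderiv f s l -> Cderiv (fun t => cube (f t)) s (dcube (f s) l).
Proof.
intros H; unfold cube; eapply Cderiv_eq.
- apply Cderiv_mul; [apply Cderiv_mul; [exact H|apply Cderiv_conj, H]|exact H].
- unfold dcube; apply C_ext; simpl; ring.
Qed.

Section Galerkin.
Variables (L gamma mu : R) (m n : nat).
Hypothesis HL : 0 < L.

Let M := (4 * n + 1)%nat.
Let ip := wdot L (modes n).
Let nr := nrm L (modes n).
Let gp := wdot (L / INR M) (grid M).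
Let syn := synth n M.

(** For |k| <= n this is [cub n c k] by [coef_cube]; the grid form makes time derivatives and
    uniform bounds pointwise. *)
Definition nonlin (c : Z -> C) : Z -> C :=
  coef (4 * n + 1) (fun j => cube (synth n (4 * n + 1) c j)).
(** Minus one half of the gradient of the energy, so that the equation reads c' = i [ham_grad] minus
    damping. *)
Definition ham_grad (c g : Z -> C) (k : Z) : C :=
  Csub (Cadd (lap L c k) (nonlin c k)) (g k).
Definition vfield (c g : Z -> C) (k : Z) : C :=
  Csub (Csub (Cmul Ci (ham_grad c g k)) (Cscal gamma (c k))) (Cscal mu (Pm m c k)).
(** The field without i c_xx. It is bounded in terms of |c|, |c_x| and g, so |c_xx| and |[vfield]|
    control each other up to this remainder. *)
Definition vrest (c g : Z -> C) (k : Z) : C :=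
  Csub (Csub (Cmul Ci (Csub (nonlin c k) (g k))) (Cscal gamma (c k))) (Cscal mu (Pm m c k)).
Definition vfield' (c c' g' : Z -> C) (k : Z) : C :=
  Csub (Csub (Cmul Ci (Csub (Cadd (lap L c' k)
     (coef (4 * n + 1) (fun j => dcube (synth n (4 * n + 1) c j) (synth n (4 * n + 1) c' j)) k))
     (g' k))) (Cscal gamma (c' k))) (Cscal mu (Pm m c' k)).

Let HM : 0 < INR M.
Proof. apply lt_0_INR; unfold M; lia. Qed.
Let Hl : 0 <= L / INR M.
Proof. apply Rlt_le, Rdiv_lt_0_compat; [exact HL|exact HM]. Qed.
Let HL0 : 0 <= L := Rlt_le _ _ HL.

Lemma nrm_syn a : nrm (L / INR M) (grid M) (syn a) = nr a.
Proof. apply parseval_nrm; unfold M; lia. Qed.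

(** The norm of the Wiener algebra, which stands in for the supremum: it dominates all values on
    every grid, and [agmon_le] is proved for it. *)
Definition sup1 (c : Z -> C) : R := rsum (modes n) (fun k => cmod (c k)).

Lemma sup1_nonneg c : 0 <= sup1 c.
Proof. apply rsum_nonneg; intros; apply cmod_nonneg. Qed.

Lemma syn_le c j : cmod (syn c j) <= sup1 c.
Proof. apply cmod_synth. Qed.

Lemma ip_nonlin_self c : ip (nonlin c) c = gp (fun j => cube (syn c j)) (syn c).
Proof. symmetry; apply wdot_grid_synth. Qed.

Lemma ip_nonlin_nonneg c : 0 <= ip (nonlin c) c.
Proof.
rewrite ip_nonlin_self; unfold gp, wdot; apply Rmult_le_pos; [exact Hl|].
apply rsum_nonneg; intros j _; unfold cube.
replace (rdot _ _) with (Cnorm2 (syn c j) * Cnorm2 (syn c j))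
  by (unfold rdot, Cnorm2; simpl; ring).
apply Rmult_le_pos; apply Cnorm2_nonneg.
Qed.

Lemma nrm_nonlin c : nr (nonlin c) <= sup1 c * sup1 c * nr c.
Proof.
unfold nr, nonlin; eapply Rle_trans; [apply bessel; [exact HL|lia]|].
rewrite <- (parseval_nrm L n (4 * n + 1)) by lia.
apply nrm_le_pointwise; [exact Hl|apply Rle_0_sqr|].
intros j _; rewrite cmod_cube; apply Rmult_le_compat_r; [apply cmod_nonneg|].
apply Rmult_le_compat; try apply cmod_nonneg; apply syn_le.
Qed.

Lemma ip_i_coef h y :
  ip (fun k => Cmul Ci (coef M h k)) y = gp (fun j => Cmul Ci (h j)) (syn y).
Proof.
unfold gp, syn; rewrite wdot_grid_synth; apply wdot_ext; intros k _; f_equal.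
unfold coef; rewrite (csum_ext _ (fun j => Cmul (Cmul Ci (h j)) (ebas M (- k) j))
  (fun j => Cmul Ci (Cmul (h j) (ebas M (- k) j)))) by (intros; ring).
rewrite csum_mul; apply C_ext; simpl; ring.
Qed.

(** Gauge invariance: i |u|^2 u is orthogonal to u at every grid point. *)
Lemma ip_i_nonlin c : ip (fun k => Cmul Ci (nonlin c k)) c = 0.
Proof.
unfold nonlin; rewrite ip_i_coef.
unfold gp, wdot; rewrite rsum_zero; [ring|]; intros j _.
unfold cube, syn, M, rdot; simpl; ring.
Qed.

Lemma ip_zero a b : (forall k, rdot (a k) (b k) = 0) -> ip a b = 0.
Proof. intros H; unfold ip, wdot; rewrite rsum_zero; [ring|auto]. Qed.

Lemma ip_Pm_self c : ip (Pm m c) c = ip (Pm m c) (Pm m c).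
Proof.
apply wdot_ext; intros k _; unfold Pm; destruct (Z.abs k <=? Z.of_nat m)%Z;
  unfold rdot; simpl; ring.
Qed.

Lemma nr_Pm c : nr (Pm m c) <= nr c.
Proof.
apply nrm_le_eqmod; [exact HL0|]; intros k _; unfold Pm.
destruct (Z.abs k <=? Z.of_nat m)%Z; [lra|rewrite cmod_C0; apply cmod_nonneg].
Qed.

Lemma ip_vfield_self c g :
  ip (vfield c g) c
  = - ip (fun k => Cmul Ci (g k)) c - gamma * ip c c - mu * ip (Pm m c) (Pm m c).
Proof.
rewrite <- ip_Pm_self.
assert (H1 := ip_i_nonlin c).
assert (H2 : ip (fun k => Cmul Ci (lap L c k)) c = 0)
  by (apply ip_zero; intros; unfold rdot, lap; simpl; ring).
unfold ip, vfield, ham_grad in *; rewrite !wdot_subl, !wdot_scall.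
rewrite (wdot_ext L (modes n) (fun i => Cmul Ci (Csub (Cadd (lap L c i) (nonlin c i)) (g i)))
  (fun i => Csub (Cadd (Cmul Ci (lap L c i)) (Cmul Ci (nonlin c i))) (Cmul Ci (g i))) c c)
  by (intros; f_equal; ring).
rewrite wdot_subl, wdot_addl, H1, H2; ring.
Qed.

Lemma ip_lap a b : ip (lap L a) b = - ip (dx L a) (dx L b).
Proof.
unfold ip, wdot; rewrite Ropp_mult_distr_r; f_equal.
replace (- rsum (modes n) (fun i => rdot (dx L a i) (dx L b i)))
  with (-1 * rsum (modes n) (fun i => rdot (dx L a i) (dx L b i))) by ring.
rewrite <- rsum_scal; apply rsum_ext; intros; unfold rdot, dx, lap; simpl; ring.
Qed.

Lemma ip_grad c g b :
  ip (ham_grad c g) b = - ip (dx L c) (dx L b) + ip (nonlin c) b - ip g b.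
Proof. rewrite <- ip_lap; unfold ip, ham_grad; now rewrite wdot_subl, wdot_addl. Qed.

Lemma ip_dx_Pm c : ip (dx L c) (dx L (Pm m c)) = ip (Pm m (dx L c)) (Pm m (dx L c)).
Proof.
apply wdot_ext; intros k _; unfold Pm, dx; destruct (Z.abs k <=? Z.of_nat m)%Z;
  unfold rdot; simpl; ring.
Qed.

(** The Hamiltonian part i a is orthogonal to a = [ham_grad], so only the linear damping and the
    nudging contribute; each is a pairing of the gradient with c or P_m c. *)
Lemma ip_grad_vfield c g :
  ip (ham_grad c g) (vfield c g)
  = gamma * (ip (dx L c) (dx L c) - ip (nonlin c) c + ip g c)
    + mu * (ip (Pm m (dx L c)) (Pm m (dx L c)) - ip (nonlin c) (Pm m c) + ip g (Pm m c)).
Proof.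
rewrite <- ip_dx_Pm.
assert (H1 := ip_grad c g c); assert (H2 := ip_grad c g (Pm m c)).
assert (H3 : ip (fun k => Cmul Ci (ham_grad c g k)) (ham_grad c g) = 0)
  by (apply ip_zero; intros; unfold rdot; simpl; ring).
unfold ip in *; rewrite wdot_sym; unfold vfield; rewrite !wdot_subl, !wdot_scall, H3.
rewrite (wdot_sym _ _ c (ham_grad c g)), (wdot_sym _ _ (Pm m c) (ham_grad c g)), H1, H2; ring.
Qed.

Section Flow.
Variables c c' g g' : R -> Z -> C.
Hypothesis Hc : forall s k, Cderiv (fun t => c t k) s (c' s k).
Hypothesis Hg : forall s k, Cderiv (fun t => g t k) s (g' s k).

Definition mass (t : R) : R := ip (c t) (c t).

Lemma mass_deriv s : derivable_pt_lim mass s (2 * ip (c' s) (c s)).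
Proof.
eapply derivable_pt_lim_eq; [apply (wdot_deriv _ _ c c (c' s) (c' s)); intros; apply Hc|].
unfold ip; rewrite (wdot_sym _ _ (c s)); ring.
Qed.

Lemma syn_deriv s j : Cderiv (fun t => syn (c t) j) s (syn (c' s) j).
Proof. apply synth_deriv; intros; apply Hc. Qed.

Lemma quartic_deriv s :
  derivable_pt_lim (fun t => ip (nonlin (c t)) (c t)) s (4 * ip (nonlin (c s)) (c' s)).
Proof.
assert (H : derivable_pt_lim (fun t => gp (fun j => cube (syn (c t) j)) (syn (c t))) s
              (4 * ip (nonlin (c s)) (c' s))).
{ eapply derivable_pt_lim_eq.
  - apply (wdot_deriv _ _ (fun t j => cube (syn (c t) j)) (fun t j => syn (c t) j)); intros.
    + apply cube_deriv, syn_deriv.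
    + apply syn_deriv.
  - replace (ip (nonlin (c s)) (c' s)) with (gp (fun j => cube (syn (c s) j)) (syn (c' s)))
      by apply wdot_grid_synth.
    (* Differentiating the cube contributes 3 and differentiating the other factor contributes 1. *)
    replace 4 with (3 + 1) by ring; rewrite Rmult_plus_distr_r, Rmult_1_l; f_equal.
    unfold gp; rewrite <- wdot_scall; apply wdot_ext; intros.
    unfold rdot, dcube, cube; simpl; ring. }
intros eps He; destruct (H eps He) as [d Hd]; exists d; intros h Hh Hhd.
rewrite !ip_nonlin_self; now apply Hd.
Qed.

Definition energy (t : R) : R :=
  ip (dx L (c t)) (dx L (c t)) - / 2 * ip (nonlin (c t)) (c t) + 2 * ip (c t) (g t).
Definition energy' (t : R) : R :=
  - 2 * ip (ham_grad (c t) (g t)) (c' t) + 2 * ip (c t) (g' t).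

Lemma dx_deriv (b b' : R -> Z -> C) s k :
  Cderiv (fun t => b t k) s (b' s k) -> Cderiv (fun t => dx L (b t) k) s (dx L (b' s) k).
Proof. intros H; unfold dx; now apply Cderiv_cmul, Cderiv_scal. Qed.

Lemma energy_deriv s : derivable_pt_lim energy s (energy' s).
Proof.
eapply derivable_pt_lim_eq.
- apply (derivable_pt_lim_plus
    (fun t => ip (dx L (c t)) (dx L (c t)) - / 2 * ip (nonlin (c t)) (c t))
    (fun t => 2 * ip (c t) (g t))).
  + apply (derivable_pt_lim_minus (fun t => ip (dx L (c t)) (dx L (c t)))
      (fun t => / 2 * ip (nonlin (c t)) (c t))).
    * apply (wdot_deriv _ _ (fun t => dx L (c t)) (fun t => dx L (c t)) (dx L (c' s)) (dx L (c' s)));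
        intros; apply dx_deriv, Hc.
    * apply (derivable_pt_lim_scal (fun t => ip (nonlin (c t)) (c t))), quartic_deriv.
  + apply (derivable_pt_lim_scal (fun t => ip (c t) (g t))).
    apply (wdot_deriv _ _ c g (c' s) (g' s)); intros; [apply Hc|apply Hg].
- unfold energy'; rewrite ip_grad; unfold ip.
  rewrite (wdot_sym _ _ (dx L (c' s))), (wdot_sym _ _ (g s)); field.
Qed.
End Flow.

(** * Second-order energy *)

(** [vfield] replaces w_s: a solution comes with a single time derivative, whereas [vfield] is a
    polynomial in the real and imaginary parts of finitely many modes of c and g, hence can be
    differentiated again. *)
Definition mod_energy (c g : Z -> C) : R :=
  ip (vfield c g) (vfield c g)
  + gp (fun j => Cmul (syn c j) (syn c j)) (fun j => Cmul (syn (dx L c) j) (syn (dx L c) j)).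

Definition mod_energy'_half (c c' g g' : Z -> C) : R :=
  ip (vfield' c c' g') (vfield c g)
  + (gp (fun j => Cmul (syn c j) (syn c' j)) (fun j => Cmul (syn (dx L c) j) (syn (dx L c) j))
     + gp (fun j => Cmul (syn c j) (syn c j)) (fun j => Cmul (syn (dx L c) j) (syn (dx L c') j))).

Lemma mod_energy_deriv (c c' g g' : R -> Z -> C) s :
  (forall s k, Cderiv (fun t => c t k) s (c' s k)) ->
  (forall s k, Cderiv (fun t => g t k) s (g' s k)) ->
  derivable_pt_lim (fun t => mod_energy (c t) (g t)) s
    (2 * mod_energy'_half (c s) (c' s) (g s) (g' s)).
Proof.
intros Hc Hg; unfold mod_energy, mod_energy'_half; eapply derivable_pt_lim_eq.
- apply (derivable_pt_lim_plus (fun t => ip (vfield (c t) (g t)) (vfield (c t) (g t)))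
   (fun t => gp (fun j => Cmul (syn (c t) j) (syn (c t) j))
     (fun j => Cmul (syn (dx L (c t)) j) (syn (dx L (c t)) j)))).
  + apply (wdot_deriv _ _ (fun t => vfield (c t) (g t)) (fun t => vfield (c t) (g t))
      (vfield' (c s) (c' s) (g' s)) (vfield' (c s) (c' s) (g' s)));
    intros k _; unfold vfield, vfield', ham_grad.
    all: apply Cderiv_sub; [apply Cderiv_sub; [apply Cderiv_cmul, Cderiv_sub;
           [apply Cderiv_add|apply Hg]|apply Cderiv_scal, Hc]|].
    1,4: unfold lap; apply Cderiv_scal, Hc.
    1,3: apply (coef_deriv _ (fun t j => cube (synth n (4 * n + 1) (c t) j)));
         intros j; apply cube_deriv, synth_deriv; intros; apply Hc.
    1,2: apply Cderiv_scal; unfold Pm; destruct (Z.abs k <=? Z.of_nat m)%Z;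
         [apply Hc|apply Cderiv_const].
  + apply (wdot_deriv _ _ (fun t j => Cmul (syn (c t) j) (syn (c t) j))
      (fun t j => Cmul (syn (dx L (c t)) j) (syn (dx L (c t)) j)));
    intros j _; apply Cderiv_mul; apply synth_deriv; intros; try apply dx_deriv; apply Hc.
- rewrite (wdot_sym _ _ (vfield (c s) (g s))); fold ip.
  rewrite !Rmult_plus_distr_l; f_equal; [ring|].
  unfold gp; rewrite <- !wdot_scall; unfold wdot.
  f_equal; f_equal; apply rsum_ext; intros; unfold rdot, syn; simpl; ring.
Qed.

(* The dangerous term [Re (i u^2 conj(u') , u_xx)] of the energy identity is, after one
   integration by parts, half the time derivative of [Re (u^2 conj(u_x)^2)] up to lower order. *)
Lemma second_order_parts a b :
  gp (fun j => Cmul (Cmul (syn a j) (syn a j)) (Cconj (syn b j))) (syn (lap L a))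
  + 2 * gp (fun j => Cmul (Cmul (syn a j) (syn (dx L a) j)) (Cconj (syn b j))) (syn (dx L a))
  + gp (fun j => Cmul (syn a j) (syn a j)) (fun j => Cmul (syn (dx L a) j) (syn (dx L b) j)) = 0.
Proof.
assert (Ha := tp_synth L M n a); assert (Hb := tp_synth L M n b).
assert (Hda := tp_synth L M n (dx L a)).
(* The product a a conj(b) conj(a_x) has degree 4 n; a grid of 4 n + 1 points just integrates its
   derivative to zero. *)
assert (H := tp_mul _ _ _ _ _ _ _ _ (tp_mul _ _ _ _ _ _ _ _ (tp_mul _ _ _ _ _ _ _ _ Ha Ha)
               (tp_conj _ _ _ _ _ Hb)) (tp_conj _ _ _ _ _ Hda)).
apply tp_integral in H; [|unfold M; lia].
apply (f_equal fst) in H; cbn [csum C0 fst] in H.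
unfold gp, wdot.
rewrite <- Rmult_assoc, (Rmult_comm 2), Rmult_assoc, <- !Rmult_plus_distr_l, <- rsum_scal,
  <- !rsum_add.
replace 0 with (L / INR M * 0) by ring; f_equal.
etransitivity; [|exact H]; apply rsum_ext; intros j _.
replace (synth n M (dx L (dx L a)) j) with (syn (lap L a) j)
  by (apply synth_ext; intros; symmetry; apply dx_dx).
unfold syn, rdot; simpl; ring.
Qed.

(** With y = [vfield] and c' = y + i eps, the terms i y_xx and 2 i |u|^2 y are orthogonal to y, so
    these parts leave only eps. The part i u^2 conj(c') does not cancel; writing y = i u_xx +
    [vrest], its pairing with i u_xx is removed by [second_order_parts] together with the part of
    the derivative of the correction that contains c'_x. *)
Lemma mod_energy'_half_eq c c' g g' eps :
  (forall k, (Z.abs k <= Z.of_nat n)%Z -> c' k = Cadd (vfield c g k) (Cmul Ci (eps k))) ->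
  mod_energy'_half c c' g g' =
    - ip (lap L eps) (vfield c g)
    - 2 * gp (fun j => Cmul (Cmul (syn c j) (Cconj (syn c j))) (syn eps j)) (syn (vfield c g))
    + gp (fun j => Cmul Ci (Cmul (Cmul (syn c j) (syn c j)) (Cconj (syn c' j)))) (syn (vrest c g))
    - 2 * gp (fun j => Cmul (Cmul (syn c j) (syn (dx L c) j)) (Cconj (syn c' j))) (syn (dx L c))
    + gp (fun j => Cmul (syn c j) (syn c' j)) (fun j => Cmul (syn (dx L c) j) (syn (dx L c) j))
    - ip (fun k => Cmul Ci (g' k)) (vfield c g)
    - gamma * ip c' (vfield c g) - mu * ip (Pm m c') (vfield c g).
Proof.
intros Hc'; set (y := vfield c g) in *.
assert (Hparts := second_order_parts c c').
assert (Hsc' : forall j, syn c' j = Cadd (syn y j) (Cmul Ci (syn eps j))).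
{ intros j; unfold syn; rewrite <- synth_mul, <- synth_add; now apply synth_ext. }
assert (Hsy : forall j, syn y j = Cadd (Cmul Ci (syn (lap L c) j)) (syn (vrest c g) j)).
{ intros j; unfold syn; rewrite <- synth_mul, <- synth_add; apply synth_ext.
  intros k _; unfold y, vfield, vrest, ham_grad; ring. }
assert (Hlap : ip (fun k => Cmul Ci (lap L c' k)) y = - ip (lap L eps) y).
{ unfold ip, wdot; rewrite Ropp_mult_distr_r; f_equal.
  replace (- rsum (modes n) (fun i => rdot (lap L eps i) (y i)))
    with (-1 * rsum (modes n) (fun i => rdot (lap L eps i) (y i))) by ring.
  rewrite <- rsum_scal; apply rsum_ext; intros k Hk; apply In_modes in Hk.
  unfold lap; rewrite Hc' by exact Hk; fold y; unfold rdot; simpl; ring. }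
set (DF := coef M (fun j => dcube (syn c j) (syn c' j))).
assert (Hnl : ip (fun k => Cmul Ci (DF k)) y
  = - 2 * gp (fun j => Cmul (Cmul (syn c j) (Cconj (syn c j))) (syn eps j)) (syn y)
    + gp (fun j => Cmul (Cmul (syn c j) (syn c j)) (Cconj (syn c' j))) (syn (lap L c))
    + gp (fun j => Cmul Ci (Cmul (Cmul (syn c j) (syn c j)) (Cconj (syn c' j)))) (syn (vrest c g))).
{ unfold DF; rewrite ip_i_coef.
  unfold gp, wdot.
  match goal with |- _ = ?k * (?l * ?A) + ?l * ?B + ?l * ?D =>
    transitivity (l * (k * A + B + D)); [|ring] end.
  f_equal; rewrite <- rsum_scal, <- !rsum_add; apply rsum_ext; intros j _.
  set (z1 := Cmul (Cmul (syn c j) (syn c j)) (Cconj (syn c' j))).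
  transitivity (rdot (Cmul Ci (Cscal 2 (Cmul (Cmul (syn c j) (Cconj (syn c j))) (syn c' j)))) (syn y j)
     + rdot (Cmul Ci z1) (syn y j)).
  - unfold dcube, z1, rdot; simpl; ring.
  - rewrite Rplus_assoc; f_equal.
    + rewrite Hsc'; unfold rdot; simpl; ring.
    + rewrite Hsy; unfold rdot; simpl; ring. }
unfold mod_energy'_half; fold y.
replace (ip (vfield' c c' g') y) with
  (ip (fun k => Cmul Ci (lap L c' k)) y + ip (fun k => Cmul Ci (DF k)) y
   - ip (fun k => Cmul Ci (g' k)) y - gamma * ip c' y - mu * ip (Pm m c') y).
- rewrite Hlap, Hnl; lra.
- unfold ip; rewrite <- !wdot_scall, <- wdot_addl, <- !wdot_subl; apply wdot_ext; intros k _.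
  f_equal; unfold vfield'; fold M; fold syn; change (coef M _ k) with (DF k); ring.
Qed.
End Galerkin.

(** * Differential inequalities *)

Section Inequalities.
Variables (L gamma mu : R) (m n : nat).
Hypotheses (HL : 0 < L) (Hgamma : 0 < gamma) (Hmu : 0 < mu).

Let M := (4 * n + 1)%nat.
Let ip := wdot L (modes n).
Let nr := nrm L (modes n).
Let gp := wdot (L / INR M) (grid M).
Let syn := synth n M.
Let HL0 : 0 <= L := Rlt_le _ _ HL.
Let HM : 0 < INR M.
Proof. apply lt_0_INR; unfold M; lia. Qed.
Let Hl : 0 <= L / INR M.
Proof. apply Rlt_le, Rdiv_lt_0_compat; [exact HL|exact HM]. Qed.

Let nr_nonneg a : 0 <= nr a := nrm_nonneg L (modes n) a.
Let nr_sqr a : nr a * nr a = ip a a := nrm_sqr L (modes n) HL0 a.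

Lemma ip_bounds a b A B : nr a <= A -> nr b <= B -> - (A * B) <= ip a b <= A * B.
Proof.
intros Ha Hb; assert (H := wdot_le L (modes n) HL0 a b).
apply Rabs_le_both in H; fold nr in H; fold ip in H.
assert (nr a * nr b <= A * B) by (apply Rmult_le_compat; auto); lra.
Qed.

Lemma nr_i a : nr (fun k => Cmul Ci (a k)) = nr a.
Proof.
unfold nr, nrm; f_equal; apply wdot_ext; intros; unfold rdot; simpl; ring.
Qed.

Lemma ip_perturb c y eps b :
  (forall k, (Z.abs k <= Z.of_nat n)%Z -> c k = Cadd (y k) (Cmul Ci (eps k))) ->
  ip c b = ip y b + ip (fun k => Cmul Ci (eps k)) b.
Proof.
intros H; unfold ip; rewrite <- wdot_addl; apply wdot_ext; intros k Hk.
apply In_modes in Hk; now rewrite H.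
Qed.

(** The quartic form is at most |u|_oo^2 |u|^2, then Agmon. The cases used are b = c and b = P_m
    c. *)
Lemma ip_nonlin_le c b x : nr c <= x -> nr b <= nr c ->
  ip (nonlin n c) b <= agmon L * (x * x * (x * x) + x * x * x * nr (dx L c)).
Proof.
intros Hx Hb; assert (H0 := nr_nonneg c); assert (Hq := nr_nonneg (dx L c)).
assert (HS := agmon_le L n c HL); simpl in HS; fold nr in HS; fold (sup1 n c) in HS.
assert (HF := nrm_nonlin L n HL c); fold nr in HF.
destruct (ip_bounds (nonlin n c) b _ _ HF Hb) as [_ H].
assert (Ha : 0 <= agmon L).
{ unfold agmon; assert (0 < 5 / L) by (apply Rdiv_lt_0_compat; lra); lra. }
set (S := sup1 n c) in *; set (y := nr c) in *; set (q := nr (dx L c)) in *.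
assert (Hyy : 0 <= y * y <= x * x) by (split; [nra|apply Rmult_le_compat; lra]).
apply Rle_trans with (S * S * (y * y)); [lra|].
apply Rle_trans with (agmon L * (y * y + y * q) * (y * y)).
- apply Rmult_le_compat_r; lra.
- rewrite Rmult_assoc; apply Rmult_le_compat_l; [exact Ha|].
  assert (y * y * (y * y) <= x * x * (x * x)) by (apply Rmult_le_compat; lra).
  assert (y * y * y <= x * x * x) by (apply Rmult_le_compat; lra).
  assert (y * y * y * q <= x * x * x * q) by (apply Rmult_le_compat_r; lra).
  lra.
Qed.

Section OneTime.
Variables (c c' g g' eps : Z -> C).
Hypothesis Hc' : forall k, (Z.abs k <= Z.of_nat n)%Z ->
  c' k = Cadd (vfield L gamma mu m n c g k) (Cmul Ci (eps k)).

(** The identity damps at twice the rate. Half of the term gamma |c|^2 absorbs f, half of mu |P_m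
    c|^2 absorbs v, and the hypothesis on [rho] and [E] turns the remaining halves into rho |c|^2 up
    to mu E. *)
Lemma mass_ineq f v nf V rho E :
  (forall k, g k = Cadd (f k) (Cmul Ci (Cscal mu (v k)))) -> in_Hm m v ->
  nr f <= nf -> nr v <= V ->
  (rho - gamma) * ip c c <= mu * ip (Pm m c) (Pm m c) + mu * E ->
  2 * ip c' c <= - rho * ip c c + (nf * nf / gamma + mu * (V * V) + mu * E)
                 + 2 * nr eps * nr c.
Proof.
intros Hg Hv Hf HV Hrho.
assert (Hy := ip_vfield_self L gamma mu m n c g); fold ip in Hy.
rewrite (ip_perturb c' _ eps c Hc').
assert (Hge : - ip (fun k => Cmul Ci (g k)) c = - ip (fun k => Cmul Ci (f k)) c + mu * ip v (Pm m c)).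
{ unfold ip; rewrite <- wdot_scall.
  (* Since v lies in H_m it sees only P_m c, so that its pairing can be absorbed by the nudging. *)
  assert (E0 : wdot L (modes n) (fun k => Cscal mu (v k)) (Pm m c)
    = wdot L (modes n) (fun k => Cscal mu (v k)) c).
  { apply wdot_ext; intros k _; unfold Pm.
    destruct (Z.leb_spec (Z.abs k) (Z.of_nat m)); [reflexivity|].
    rewrite Hv by assumption; unfold rdot; simpl; ring. }
  rewrite E0.
  rewrite (wdot_ext L (modes n) (fun k => Cmul Ci (g k))
    (fun k => Csub (Cmul Ci (f k)) (Cscal mu (v k))) c c).
  - rewrite wdot_subl; ring.
  - intros k _; rewrite Hg; unfold rdot; simpl; ring. }
destruct (ip_bounds (fun k => Cmul Ci (f k)) c nf (nr c)) as [Hf1 _]; [now rewrite nr_i|lra|].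
destruct (ip_bounds v (Pm m c) V (nr (Pm m c)) HV (Rle_refl _)) as [_ Hv1].
destruct (ip_bounds (fun k => Cmul Ci (eps k)) c (nr eps) (nr c)) as [_ He]; [rewrite nr_i; lra|lra|].
rewrite <- !nr_sqr in *.
assert (Hx := nr_nonneg c); assert (Hp := nr_nonneg (Pm m c)).
set (x := nr c) in *; set (p := nr (Pm m c)) in *.
assert (Y1 : 2 * (nf * x) <= nf * nf / gamma + gamma * (x * x)).
{ assert (H := Rle_0_sqr (nf - gamma * x)); unfold Rsqr in H.
  assert (H1 : 0 <= (nf - gamma * x) * (nf - gamma * x) / gamma)
    by (apply Rmult_le_pos; [exact H|apply Rlt_le, Rinv_0_lt_compat, Hgamma]).
  replace ((nf - gamma * x) * (nf - gamma * x) / gamma)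
    with (nf * nf / gamma + gamma * (x * x) - 2 * (nf * x)) in H1 by (field; lra).
  lra. }
assert (Y2 : mu * (2 * ip v (Pm m c)) <= mu * (V * V + p * p)).
{ apply Rmult_le_compat_l; [lra|]. assert (H := Rle_0_sqr (V - p)); unfold Rsqr in H; lra. }
lra.
Qed.

(** Up to 2 mu E, |c_x|^2 is damped at the rate 2 rho. One half of this is the |c_x|^2 part of -rho
    times the energy; the other half absorbs the quartic terms, which [ip_nonlin_le] makes linear in
    |c_x|. This is the origin of the quotient by rho. *)
Lemma energy_ineq X G G' rho E :
  nr c <= X -> nr g <= G -> nr g' <= G' -> gamma <= rho <= gamma + mu ->
  (rho - gamma) * ip (dx L c) (dx L c)
    <= mu * ip (Pm m (dx L c)) (Pm m (dx L c)) + mu * E ->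
  - 2 * ip (ham_grad L n c g) c' + 2 * ip c g'
  <= - rho * (ip (dx L c) (dx L c) - / 2 * ip (nonlin n c) c + 2 * ip c g)
     + (2 * mu * E + 2 * (gamma + mu) * (agmon L * (X * X * (X * X)) + 2 * (G * X))
        + 2 * (G' * X) + ((gamma + mu) * agmon L * (X * X * X)) * ((gamma + mu) * agmon L * (X * X * X)) / rho)
     + 2 * nr eps * nr (ham_grad L n c g).
Proof.
intros HX HG HG' Hrho Hq.
set (a := ham_grad L n c g).
assert (Hay := ip_grad_vfield L gamma mu m n c g); fold ip in Hay; fold a in Hay.
assert (Hp : ip a c' = ip a (vfield L gamma mu m n c g) + ip (fun k => Cmul Ci (eps k)) a)
  by (unfold ip; rewrite !(wdot_sym _ _ a); now apply ip_perturb).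
rewrite Hp, Hay.
assert (Hx := nr_nonneg c); assert (Hq0 := nr_nonneg (dx L c)).
assert (HPm : nr (Pm m c) <= X) by (eapply Rle_trans; [apply (nr_Pm L m n HL)|exact HX]).
destruct (ip_bounds (fun k => Cmul Ci (eps k)) a (nr eps) (nr a)) as [He _]; [rewrite nr_i; lra|lra|].
destruct (ip_bounds g c G X HG HX) as [Hg1 Hg2].
destruct (ip_bounds g (Pm m c) G X HG HPm) as [Hg3 _].
destruct (ip_bounds c g' X G' HX HG') as [_ Hg4].
destruct (ip_bounds c g X G HX HG) as [Hg5 Hg6].
assert (HN0 := ip_nonlin_nonneg L n HL c); fold ip in HN0.
assert (HN := ip_nonlin_le c c X HX (Rle_refl _)).
assert (HNP : ip (nonlin n c) (Pm m c)
   <= agmon L * (X * X * (X * X) + X * X * X * nr (dx L c)))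
  by exact (ip_nonlin_le c (Pm m c) X HX (nr_Pm L m n HL c)).
rewrite <- (nr_sqr (dx L c)) in *.
set (q := nr (dx L c)) in *; set (N := ip (nonlin n c) c) in *.
set (NP := ip (nonlin n c) (Pm m c)) in *.
set (P := ip (Pm m (dx L c)) (Pm m (dx L c))) in *.
set (ka := agmon L) in *; set (W4 := X * X * (X * X)) in *; set (W3 := X * X * X) in *.
assert (Yq : 2 * ((gamma + mu) * ka * W3 * q)
   <= rho * (q * q) + (gamma + mu) * ka * W3 * ((gamma + mu) * ka * W3) / rho).
{ set (z := (gamma + mu) * ka * W3).
  assert (H := Rle_0_sqr (z - rho * q)); unfold Rsqr in H.
  assert (H1 : 0 <= (z - rho * q) * (z - rho * q) / rho)
    by (apply Rmult_le_pos; [exact H|apply Rlt_le, Rinv_0_lt_compat; lra]).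
  replace ((z - rho * q) * (z - rho * q) / rho)
    with (z * z / rho + rho * (q * q) - 2 * (z * q)) in H1 by (field; lra).
  lra. }
assert (T1 : gamma * N <= gamma * (ka * (W4 + W3 * q))) by (apply Rmult_le_compat_l; lra).
assert (T2 : mu * NP <= mu * (ka * (W4 + W3 * q))) by (apply Rmult_le_compat_l; lra).
assert (T3 : gamma * - (G * X) <= gamma * ip g c) by (apply Rmult_le_compat_l; lra).
assert (T4 : mu * - (G * X) <= mu * ip g (Pm m c)) by (apply Rmult_le_compat_l; lra).
assert (T5 : rho * ip c g <= rho * (X * G)) by (apply Rmult_le_compat_l; lra).
assert (T6 : rho * (X * G) <= (gamma + mu) * (X * G)).
{ apply Rmult_le_compat_r; [|lra]. apply Rmult_le_pos; [lra|].
  eapply Rle_trans; [apply (nr_nonneg g)|exact HG]. }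
assert (T7 : 0 <= rho * N) by (apply Rmult_le_pos; lra).
lra.
Qed.

(** With z = ka X^3, half of the quartic form contributes z |c_x| / 2 <= z^2 / 8 + |c_x|^2 / 2;
    moving the last term to the left explains the factor 2. *)
Lemma energy_lower X G :
  nr c <= X -> nr g <= G ->
  ip (dx L c) (dx L c) <= 2 * ((ip (dx L c) (dx L c) - / 2 * ip (nonlin n c) c + 2 * ip c g)
    + / 2 * (agmon L * (X * X * (X * X)))
    + / 8 * (agmon L * (X * X * X) * (agmon L * (X * X * X))) + 2 * (X * G)).
Proof.
intros HX HG.
destruct (ip_bounds c g X G HX HG) as [H1 _].
assert (HN := ip_nonlin_le c c X HX (Rle_refl _)).
rewrite <- (nr_sqr (dx L c)).
set (q := nr (dx L c)) in *; set (z := agmon L * (X * X * X)) in *.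
assert (H := Rle_0_sqr (z - 2 * q)); unfold Rsqr in H.
assert (agmon L * (X * X * (X * X) + X * X * X * q) = agmon L * (X * X * (X * X)) + z * q)
  by (unfold z; ring).
lra.
Qed.

Let nrs a : nrm (L / INR M) (grid M) (syn a) = nr a := nrm_syn L n a.

Lemma gp_bound P (A B : nat -> C) a b :
  0 <= P -> (forall j, cmod (A j) * cmod (B j) <= P * (cmod (syn a j) * cmod (syn b j))) ->
  Rabs (gp A B) <= P * (nr a * nr b).
Proof.
intros HP H; rewrite <- (nrs a), <- (nrs b).
apply rsum_bound_nrm; [exact Hl|exact HP|].
intros j _; eapply Rle_trans; [apply rdot_le|apply H].
Qed.

Let S := sup1 n c.
Let Sx := sup1 n (dx L c).

Lemma quartic_correction_bound :
  Rabs (gp (fun j => Cmul (syn c j) (syn c j)) (fun j => Cmul (syn (dx L c) j) (syn (dx L c) j)))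
  <= S * S * (nr (dx L c) * nr (dx L c)).
Proof.
apply gp_bound; [apply Rle_0_sqr|]; intros j; rewrite !cmod_mul.
assert (H := syn_le n c j); fold M syn S in H.
apply Rmult_le_compat_r; [apply Rmult_le_pos; apply cmod_nonneg|].
apply Rmult_le_compat; auto using cmod_nonneg.
Qed.

(** The 3 in front of S Sx q y counts two terms from the integration by parts and one from the
    derivative of the correction. The last line collects all terms that vanish with the truncation
    error. *)
Lemma mod_energy_ineq e G' :
  nr eps <= e -> nr (lap L eps) <= e -> nr g' <= G' ->
  let y := nr (vfield L gamma mu m n c g) in
  let r := nr (vrest gamma mu m n c g) in
  let q := nr (dx L c) in
  mod_energy'_half L gamma mu m n c c' g g' <=
    - gamma * (y * y) + S * S * r * y + 3 * (S * Sx * q) * y + G' * y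
    + e * (y + 2 * (S * S) * y + S * S * r + 3 * (S * Sx * q) + (gamma + mu) * y).
Proof.
intros He1 He2 HG' y r q.
rewrite (mod_energy'_half_eq L gamma mu m n c c' g g' eps Hc').
fold M; fold ip gp syn.
assert (HS : 0 <= S) by apply sup1_nonneg; assert (HSx : 0 <= Sx) by apply sup1_nonneg.
assert (HSj : forall j, cmod (syn c j) <= S) by (intros; apply syn_le).
assert (HSxj : forall j, cmod (syn (dx L c) j) <= Sx) by (intros; apply syn_le).
set (Yf := vfield L gamma mu m n c g) in *.
assert (Hy : 0 <= y) by apply nr_nonneg; assert (Hr : 0 <= r) by apply nr_nonneg.
assert (Hq : 0 <= q) by apply nr_nonneg.
assert (He0 : 0 <= e) by (eapply Rle_trans; [apply (nr_nonneg eps)|exact He1]).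
assert (HC' : nr c' <= y + e).
{ unfold nr; rewrite (nrm_ext _ _ c' (fun k => Cadd (Yf k) (Cmul Ci (eps k))))
    by (intros k Hk; apply In_modes in Hk; now apply Hc').
  eapply Rle_trans; [apply nrm_add; exact HL0|].
  assert (H := nr_i eps); unfold nr in *; rewrite H; fold y; lra. }
assert (HSS : 0 <= S * S) by nra.
assert (HSSx : 0 <= S * Sx) by nra.
destruct (ip_bounds (lap L eps) Yf e y He2 (Rle_refl _)) as [T1 _].
assert (T2 : Rabs (gp (fun j => Cmul (Cmul (syn c j) (Cconj (syn c j))) (syn eps j)) (syn Yf))
             <= S * S * (nr eps * y)).
{ apply gp_bound; [exact HSS|]; intros j; rewrite !cmod_mul, cmod_conj, Rmult_assoc.
  apply Rmult_le_compat_r; [apply Rmult_le_pos; apply cmod_nonneg|].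
  apply Rmult_le_compat; auto using cmod_nonneg. }
assert (T3 : Rabs (gp (fun j => Cmul Ci (Cmul (Cmul (syn c j) (syn c j)) (Cconj (syn c' j))))
   (syn (vrest gamma mu m n c g))) <= S * S * (nr c' * r)).
{ apply gp_bound; [exact HSS|]; intros j.
  rewrite cmod_Ci_mul, !cmod_mul, cmod_conj, Rmult_assoc.
  apply Rmult_le_compat_r; [apply Rmult_le_pos; apply cmod_nonneg|].
  apply Rmult_le_compat; auto using cmod_nonneg. }
assert (T4 : Rabs (gp (fun j => Cmul (Cmul (syn c j) (syn (dx L c) j)) (Cconj (syn c' j)))
   (syn (dx L c))) <= S * Sx * (nr c' * q)).
{ apply gp_bound; [exact HSSx|]; intros j; rewrite !cmod_mul, cmod_conj, Rmult_assoc.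
  apply Rmult_le_compat_r; [apply Rmult_le_pos; apply cmod_nonneg|].
  apply Rmult_le_compat; auto using cmod_nonneg. }
assert (T5 : Rabs (gp (fun j => Cmul (syn c j) (syn c' j))
   (fun j => Cmul (syn (dx L c) j) (syn (dx L c) j))) <= S * Sx * (nr c' * q)).
{ apply gp_bound; [exact HSSx|]; intros j; rewrite !cmod_mul.
  replace (cmod (syn c j) * cmod (syn c' j) * (cmod (syn (dx L c) j) * cmod (syn (dx L c) j)))
    with (cmod (syn c j) * cmod (syn (dx L c) j) * (cmod (syn c' j) * cmod (syn (dx L c) j))) by ring.
  apply Rmult_le_compat_r; [apply Rmult_le_pos; apply cmod_nonneg|].
  apply Rmult_le_compat; auto using cmod_nonneg. }
destruct (ip_bounds (fun k => Cmul Ci (g' k)) Yf G' y) as [T6 _]; [now rewrite nr_i|apply Rle_refl|].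
assert (T7 : - (e * y) <= ip (fun k => Cmul Ci (eps k)) Yf)
  by (apply ip_bounds; [now rewrite nr_i|apply Rle_refl]).
assert (T8 : - (e * y) <= ip (Pm m (fun k => Cmul Ci (eps k))) Yf).
{ apply ip_bounds; [|apply Rle_refl].
  eapply Rle_trans; [apply (nr_Pm L m n HL)|]; fold nr; now rewrite nr_i. }
assert (E1 := ip_perturb c' Yf eps Yf Hc').
assert (E2 : ip (Pm m c') Yf = ip (Pm m Yf) Yf + ip (Pm m (fun k => Cmul Ci (eps k))) Yf).
{ unfold ip; rewrite <- wdot_addl; apply wdot_ext; intros k Hk; f_equal.
  apply In_modes in Hk; unfold Pm; destruct (Z.abs k <=? Z.of_nat m)%Z; [now apply Hc'|ring]. }
(* At second order the nudging is used only through its sign; the damping rate stays gamma. *)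
assert (E3 : 0 <= ip (Pm m Yf) Yf).
{ unfold ip; rewrite (ip_Pm_self L m n); apply wdot_self_nonneg; exact HL0. }
assert (E4 : ip Yf Yf = y * y) by (symmetry; apply nr_sqr).
apply Rabs_le_both in T2, T3, T4, T5.
assert (U2 : S * S * (nr eps * y) <= S * S * (e * y)).
{ apply Rmult_le_compat_l; [exact HSS|]; apply Rmult_le_compat_r; lra. }
assert (U3 : S * S * (nr c' * r) <= S * S * ((y + e) * r)).
{ apply Rmult_le_compat_l; [exact HSS|]; apply Rmult_le_compat_r; lra. }
assert (U4 : S * Sx * (nr c' * q) <= S * Sx * ((y + e) * q)).
{ apply Rmult_le_compat_l; [exact HSSx|]; apply Rmult_le_compat_r; lra. }
assert (U7 : gamma * (y * y - e * y) <= gamma * ip c' Yf)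
  by (apply Rmult_le_compat_l; lra).
assert (U8 : mu * (- (e * y)) <= mu * ip (Pm m c') Yf) by (apply Rmult_le_compat_l; lra).
lra.
Qed.

End OneTime.
End Inequalities.

(** * Bounds along a solution *)

Definition energy_forcing (ka gamma mu X G G' rho E : R) : R :=
  2 * mu * E + 2 * (gamma + mu) * (ka * (X * X * (X * X)) + 2 * (G * X)) + 2 * (G' * X)
  + ((gamma + mu) * ka * (X * X * X)) * ((gamma + mu) * ka * (X * X * X)) / rho.

(** The Gronwall limit forcing / rho inserted into [energy_lower]. *)
Definition energy_bound (ka gamma mu X G G' rho E : R) : R :=
  2 * (energy_forcing ka gamma mu X G G' rho E / rho + / 2 * (ka * (X * X * (X * X)))
       + / 8 * (ka * (X * X * X) * (ka * (X * X * X))) + 2 * (X * G)).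

(* [sup2] bounds |w|_oo^2, [rest_bound] the part of w_s without w_xx, and
   [mod_bound] the square of the remaining part of w_s, when |w| <= X and |w_x| <= Q. *)
Definition sup2 (ka X Q : R) : R := ka * (X * X + X * Q).
Definition rest_bound (ka gamma mu X Q G : R) : R := sup2 ka X Q * X + (gamma + mu) * X + G.
(** With y = |[vfield]| and z = S Sx q, Young's inequality 3 z y <= gamma / 4 y^2 + 9 / gamma z^2
    leaves a z^2 that is itself bounded by an affine function of y. [mod_slope] collects the
    coefficients of y, [mod_const] the constant part. *)
Definition mod_slope (ka gamma mu X Q G G' : R) : R :=
  sup2 ka X Q * rest_bound ka gamma mu X Q G + G' + 9 / gamma * (sup2 ka X Q * ka * (Q * Q * Q)).
Definition mod_const (ka gamma mu X Q G : R) : R :=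
  9 / gamma * (sup2 ka X Q * ka * (Q * Q) * (Q * Q + Q * rest_bound ka gamma mu X Q G)).
Definition mod_bound (ka gamma mu X Q G G' : R) : R :=
  2 * (sup2 ka X Q * (Q * Q))
  + 2 * (mod_slope ka gamma mu X Q G G' * mod_slope ka gamma mu X Q G G') / (gamma * gamma)
  + 2 * mod_const ka gamma mu X Q G / gamma + 1.

Lemma le_of_le_add_eps x y : (forall eta, 0 < eta -> x <= y + eta) -> x <= y.
Proof.
intros H; destruct (Rle_lt_dec x y) as [|Hlt]; [assumption|].
specialize (H ((x - y) / 2)); lra.
Qed.

Section Solution.
Variables (L gamma mu nf V : R) (f : FSeq) (m : nat) (v v' w ws : R -> FSeq).
Hypotheses (HL : 0 < L) (Hgamma : 0 < gamma) (Hmu : 0 < mu) (Hnf : 0 <= nf) (HV : 0 <= V).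
Hypothesis Hf : L2sq_le L f (nf * nf).
Hypothesis HvX : in_X L m v v'.
Hypothesis HvV : forall s, L2sq_le L (v s) (V * V).
Hypothesis Hv'V : forall s, L2sq_le L (v' s) (V * V).
Hypothesis Hsol : is_solution L gamma mu m f v w ws.

Let ip n := wdot L (modes n).
Let nr n := nrm L (modes n).
Let HL0 : 0 <= L := Rlt_le _ _ HL.
Let nr_nonneg n a : 0 <= nr n a := nrm_nonneg L (modes n) a.
Let nr_sqr n a : nr n a * nr n a = ip n a a := nrm_sqr L (modes n) HL0 a.
Let ka := agmon L.
Let G := nf + mu * V.
Let G' := mu * V.

Let g (t : R) (k : Z) : C := Cadd (f k) (Cmul Ci (Cscal mu (v t k))).
Let g' (t : R) (k : Z) : C := Cmul Ci (Cscal mu (v' t k)).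
Let vf n t := vfield L gamma mu m n (w t) (g t).
(** Defined by solving w_s = [vfield] + i eps, which thus holds for all modes; the equation enters
    only in [eps_small], through the modes up to n. *)
Let eps (n : nat) (t : R) (k : Z) : C := Cmul (Copp Ci) (Csub (ws t k) (vf n t k)).

Let Hc' n t k : ws t k = Cadd (vf n t k) (Cmul Ci (eps n t k)).
Proof. unfold eps; apply C_ext; simpl; ring. Qed.

Let Hw_deriv s k : Cderiv (fun t => w t k) s (ws s k).
Proof. destruct Hsol as (_ & H & _); exact (H s k). Qed.

Let Hg_deriv s k : Cderiv (fun t => g t k) s (g' s k).
Proof.
destruct HvX as (_ & H & _); unfold g, g'.
eapply Cderiv_eq; [apply Cderiv_add; [apply Cderiv_const|apply Cderiv_cmul, Cderiv_scal, (H s k)]|].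
simpl; ring.
Qed.

Lemma agmon_nonneg : 0 <= agmon L.
Proof. unfold agmon; assert (0 < 5 / L) by (apply Rdiv_lt_0_compat; lra); lra. Qed.

Let HG : 0 <= G.
Proof. unfold G; assert (0 <= mu * V) by (apply Rmult_le_pos; lra); lra. Qed.

Let HG' : 0 <= G'.
Proof. apply Rmult_le_pos; lra. Qed.

Let nr_scal_mu n a : nr n a <= V -> nr n (fun k => Cmul Ci (Cscal mu (a k))) <= mu * V.
Proof.
intros H; assert (Hi := nr_i L n (fun k => Cscal mu (a k))); cbv beta in Hi.
unfold nr; rewrite Hi.
eapply Rle_trans; [apply nrm_scal, HL0|]; rewrite Rabs_pos_eq by lra.
apply Rmult_le_compat_l; [lra|exact H].
Qed.

Let Hnr_g n t : nr n (g t) <= G.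
Proof.
unfold nr, g; eapply Rle_trans; [apply nrm_add, HL0|]; unfold G.
apply Rplus_le_compat; [apply (L2sq_nrm L f); assumption|].
apply nr_scal_mu, L2sq_nrm; auto.
Qed.

Let Hnr_g' n t : nr n (g' t) <= G'.
Proof. apply nr_scal_mu, L2sq_nrm; auto. Qed.

Lemma sup1_sqr n c X Q : nr n c <= X -> nr n (dx L c) <= Q ->
  sup1 n c * sup1 n c <= sup2 ka X Q.
Proof.
intros HX HQ; assert (H := agmon_le L n c HL); simpl in H.
eapply Rle_trans; [exact H|]; apply Rmult_le_compat_l; [apply agmon_nonneg|].
assert (H1 := nr_nonneg n c); assert (H2 := nr_nonneg n (dx L c)); fold (nr n c); fold (nr n (dx L c)).
apply Rplus_le_compat; apply Rmult_le_compat; auto.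
Qed.

Lemma nr_lap_dx n c : nr n (dx L (dx L c)) = nr n (lap L c).
Proof. apply nrm_ext; intros; apply dx_dx. Qed.

Lemma nr_vrest n c gg X s2 G0 : nr n c <= X -> nr n gg <= G0 -> sup1 n c * sup1 n c <= s2 ->
  nr n (vrest gamma mu m n c gg) <= s2 * X + (gamma + mu) * X + G0.
Proof.
intros HX Hgg Hs.
set (A := fun k => Cmul Ci (nonlin n c k)); set (B := fun k => Cmul Ci (Cscal (-1) (gg k))).
set (D := fun k => Cscal (- gamma) (c k)); set (P := fun k => Cscal (- mu) (Pm m c k)).
unfold nr; rewrite (nrm_ext _ _ _ (fun k => Cadd (Cadd (Cadd (A k) (B k)) (D k)) (P k)))
  by (intros; unfold vrest, A, B, D, P; apply C_ext; simpl; ring).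
eapply Rle_trans; [apply nrm_add, HL0|].
assert (H1 : nr n (fun k => Cadd (Cadd (A k) (B k)) (D k)) <= nr n (fun k => Cadd (A k) (B k)) + nr n D)
  by apply nrm_add, HL0.
assert (H2 : nr n (fun k => Cadd (A k) (B k)) <= nr n A + nr n B) by apply nrm_add, HL0.
assert (H3 : nr n A <= s2 * X).
{ unfold A, nr; assert (Hi := nr_i L n (nonlin n c)); rewrite Hi.
  eapply Rle_trans; [apply nrm_nonlin, HL|]; apply Rmult_le_compat; auto;
    [apply Rle_0_sqr|apply nr_nonneg]. }
assert (H4 : nr n B <= G0).
{ unfold B, nr; assert (Hi := nr_i L n (fun k => Cscal (-1) (gg k))); cbv beta in Hi; rewrite Hi.
  eapply Rle_trans; [apply nrm_scal, HL0|]; fold (nr n gg).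
  replace (Rabs (-1)) with 1 by (unfold Rabs; destruct (Rcase_abs (-1)); lra); lra. }
assert (H5 : nr n D <= gamma * X).
{ eapply Rle_trans; [apply nrm_scal, HL0|]; rewrite Rabs_Ropp, Rabs_pos_eq by lra.
  apply Rmult_le_compat_l; [lra|exact HX]. }
assert (H6 : nr n P <= mu * X).
{ eapply Rle_trans; [apply nrm_scal, HL0|]; rewrite Rabs_Ropp, Rabs_pos_eq by lra.
  apply Rmult_le_compat_l; [lra|]. eapply Rle_trans; [apply nr_Pm, HL|exact HX]. }
fold (nr n (fun k => Cadd (Cadd (A k) (B k)) (D k))); fold (nr n P); lra.
Qed.

Lemma vfield_split n c gg k :
  vfield L gamma mu m n c gg k = Cadd (Cmul Ci (lap L c k)) (vrest gamma mu m n c gg k).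
Proof. unfold vfield, vrest, ham_grad; ring. Qed.

Lemma nr_vfield_le n c gg :
  nr n (vfield L gamma mu m n c gg) <= nr n (lap L c) + nr n (vrest gamma mu m n c gg).
Proof.
unfold nr; rewrite (nrm_ext _ _ _ _ (fun k _ => vfield_split n c gg k)).
eapply Rle_trans; [apply nrm_add, HL0|].
assert (Hi := nr_i L n (lap L c)); rewrite Hi; lra.
Qed.

Lemma nr_lap_le n c gg :
  nr n (lap L c) <= nr n (vfield L gamma mu m n c gg) + nr n (vrest gamma mu m n c gg).
Proof.
assert (Hi := nr_i L n (lap L c)).
set (R := fun k => Cscal (-1) (vrest gamma mu m n c gg k)).
unfold nr; rewrite <- Hi.
rewrite (nrm_ext _ _ _ (fun k => Cadd (vfield L gamma mu m n c gg k) (R k)))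
  by (intros; rewrite vfield_split; unfold R; apply C_ext; simpl; ring).
eapply Rle_trans; [apply nrm_add, HL0|]; apply Rplus_le_compat_l.
eapply Rle_trans; [apply nrm_scal, HL0|].
replace (Rabs (-1)) with 1 by (unfold Rabs; destruct (Rcase_abs (-1)); lra); lra.
Qed.

(** A qualitative bound that depends on the solution. It supplies the boundedness in [gronwall_line]
    and the factors of vanishing errors, and never reaches the final constants. *)
Lemma apriori : exists B, 0 < B /\ forall n t,
  nr n (w t) <= B /\ nr n (dx L (w t)) <= B /\ nr n (lap L (w t)) <= B.
Proof.
destruct Hsol as ([[B0 HB0] _] & _ & _).
exists (Rabs B0 + 1); assert (H := Rabs_pos B0); split; [lra|]; intros n t.
set (B := Rabs B0 + 1).
destruct (H2sq_nrm L (w t) B n HL) as [H1 H2]; [unfold B; lra| |].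
{ intros k; eapply Rle_trans; [apply HB0|]. unfold B; assert (H1 := Rle_abs B0); nra. }
repeat split; [exact H1| |exact H2].
assert (H3 := nrm_dx_sqr_le L n (w t) HL).
apply sqr_le_le; [unfold B; lra|]; eapply Rle_trans; [exact H3|].
apply Rmult_le_compat; try apply nr_nonneg; assumption.
Qed.

(** On modes up to n, eps is the coefficient of |w|^2 w minus that of |P_n w|^2 P_n w, which
    [cubic_error] bounds by the L^2 tail of w. Two derivatives cost at most [kn] = kappa_n^2 on
    these modes, while the L^2 tail is at most the H^2 tail divided by [kn]. *)
Lemma eps_small a b eta : a <= b -> 0 < eta -> exists n0, forall n, (n0 <= n)%nat ->
  forall t, a <= t <= b -> nr n (eps n t) <= eta /\ nr n (lap L (eps n t)) <= eta.
Proof.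
intros Hab He; destruct apriori as (B & HB0 & HB).
set (S := sqrt (sup2 ka B B)).
assert (Hs2 : 0 <= sup2 ka B B)
  by (apply Rmult_le_pos; [apply agmon_nonneg|nra]).
assert (HS : forall t q, rsum (modes q) (fun k => cmod (w t k)) <= S).
{ intros t q; destruct (HB q t) as (H1 & H2 & _).
  apply sqr_le_le; [apply sqrt_pos|]; unfold S; rewrite sqrt_sqrt by exact Hs2.
  now apply (sup1_sqr q). }
set (eta' := eta / (3 * (S * S) + 1)).
assert (HSS : 0 <= S * S) by apply Rle_0_sqr.
assert (He' : 0 < eta') by (apply Rdiv_lt_0_compat; lra).
assert (HY : in_Y L w) by apply Hsol.
destruct (small_tail_uniform L w a b eta' HL HY Hab He') as [n0 Hn0].
(* n >= 1 makes kappa_n positive, so that one may divide by [kn]. *)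
exists (max n0 1); intros n Hn t Ht.
assert (Hst := Hn0 n ltac:(lia) t Ht).
destruct Hsol as (_ & _ & Heq).
destruct HY as [[B1 HB1] _].
assert (Htl : forall e, 0 < e -> exists n0, forall n p, (n0 <= n)%nat ->
     nrm L (modes p) (fun k => Csub (w t k) (Pm n (w t) k)) <= e).
{ intros e Hep; destruct (small_tail_exists L B1 (w t) e HL (HB1 t) Hep) as [n1 Hn1].
  exists n1; intros n' p Hn'; now apply (small_tail_mono L e n1 n'). }
assert (HN : exists N : Z -> C, (forall k, cubic_coef (w t) k (N k)) /\
   forall k, (Z.abs k <= Z.of_nat n)%Z -> eps n t k = Csub (N k) (cub n (w t) k)).
{ destruct (functional_choice _ (Heq t)) as [N HN]; exists N; split; [intros; apply HN|].
  intros k Hk; destruct (HN k) as [_ E].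
  unfold eps, vf, vfield, ham_grad, nonlin; rewrite coef_cube by lia.
  apply (f_equal (fun z => Cmul (Copp Ci) z)) in E.
  assert (E0 : ws t k = Cadd (Cmul Ci (Csub (Cadd (lap L (w t) k) (N k)) (g t k)))
    (Cadd (Cscal (- gamma) (w t k)) (Cscal (- mu) (Pm m (w t) k)))).
  { unfold lap, g in *.
    assert (E1 := f_equal fst E); assert (E2 := f_equal snd E); simpl in E1, E2.
    apply C_ext; simpl; lra. }
  rewrite E0; unfold lap; apply C_ext; simpl; ring. }
destruct HN as (N & HN1 & HN2).
set (kn := kappa L (Z.of_nat n) ^ 2).
assert (Hkn : 0 < kn).
{ unfold kn, kappa; apply pow_lt, Rdiv_lt_0_compat; [|exact HL].
  assert (H := PI_RGT_0); apply Rmult_lt_0_compat; [lra|apply IZR_lt; lia]. }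
assert (Hq1 : nr n (eps n t) <= 3 * (S * S) * eta').
{ unfold nr; rewrite (nrm_ext _ _ _ (fun k => Csub (N k) (cub n (w t) k)))
    by (intros k Hk; apply In_modes in Hk; auto).
  apply (cubic_error L n (w t) N S eta'); auto; [lra|]. intros p; apply Hst. }
assert (Hq2 : nr n (eps n t) <= 3 * (S * S) * (eta' / kn)).
{ unfold nr; rewrite (nrm_ext _ _ _ (fun k => Csub (N k) (cub n (w t) k)))
    by (intros k Hk; apply In_modes in Hk; auto).
  apply (cubic_error L n (w t) N S (eta' / kn)); auto.
  - apply Rlt_le, Rdiv_lt_0_compat; lra.
  - intros p; apply Rmult_le_reg_l with (r := kn); [exact Hkn|].
    replace (kn * (eta' / kn)) with eta' by (field; lra).
    eapply Rle_trans; [apply (nrm_tail_lap L n p (w t) HL)|apply Hst]. }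
assert (Hfin : 3 * (S * S) * eta' <= eta).
{ unfold eta'; apply Rmult_le_reg_r with (r := 3 * (S * S) + 1); [lra|].
  replace (3 * (S * S) * (eta / (3 * (S * S) + 1)) * (3 * (S * S) + 1))
    with (eta * (3 * (S * S))) by (field; lra). nra. }
split; [lra|].
apply Rle_trans with (kn * nr n (eps n t)).
- apply nrm_le_pointwise; [exact HL0|lra|]; intros k Hk; apply In_modes in Hk.
  unfold lap; rewrite cmod_scal, Rabs_Ropp, Rabs_pos_eq by apply pow2_ge_0.
  apply Rmult_le_compat_r; [apply cmod_nonneg|].
  assert (E : kappa L k ^ 2 = kappa L (Z.abs k) ^ 2).
  { destruct (Z.abs_eq_or_opp k) as [->| ->]; [reflexivity|rewrite kappa_opp; ring]. }
  rewrite E; replace (Z.abs k) with (Z.of_nat (Z.abs_nat k)) by lia.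
  apply kappa_sqr_mono; [exact HL|lia].
- apply Rle_trans with (kn * (3 * (S * S) * (eta' / kn))); [apply Rmult_le_compat_l; lra|].
  replace (kn * (3 * (S * S) * (eta' / kn))) with (3 * (S * S) * eta') by (field; lra).
  exact Hfin.
Qed.

(** Gronwall bounds the truncations for large n; since the partial sums increase with n, every n
    inherits the bound. *)
Lemma solution_mass rho E :
  0 < rho ->
  (forall n t, (rho - gamma) * ip n (w t) (w t) <= mu * ip n (Pm m (w t)) (Pm m (w t)) + mu * E) ->
  forall n t, ip n (w t) (w t) <= (nf * nf / gamma + mu * (V * V) + mu * E) / rho.
Proof.
intros Hrho HE n t; destruct apriori as (B & HB0 & HB).
apply le_of_le_add_eps; intros eta Heta.
destruct (gronwall_line (fun n => mass L n w) (fun n t => 2 * ip n (ws t) (w t)) rho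
  (nf * nf / gamma + mu * (V * V) + mu * E) (B * B) 0) with (t := t) (eta := eta) as [n0 Hn0].
- exact Hrho.
- intros; apply mass_deriv, Hw_deriv.
- intros n1 t1 _; unfold mass; fold (ip n1); rewrite <- nr_sqr.
  destruct (HB n1 t1) as (H1 & _ & _); assert (H0 := nr_nonneg n1 (w t1)).
  rewrite Rabs_pos_eq by nra; apply Rmult_le_compat; lra.
- intros a b e Hab He.
  destruct (eps_small a b (e / (2 * B)) Hab) as [n1 Hn1]; [apply Rdiv_lt_0_compat; lra|].
  exists n1; intros n2 Hn2 t2 Ht2; destruct (Hn1 n2 Hn2 t2 Ht2) as [H1 _].
  assert (H := mass_ineq L gamma mu m n2 HL Hgamma Hmu (w t2) (ws t2) (g t2) (eps n2 t2)
    (fun k _ => Hc' n2 t2 k) f (v t2) nf V rho E (fun k => eq_refl)).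
  unfold mass; fold (ip n2) in *; eapply Rle_trans; [apply H|].
  + apply HvX.
  + apply L2sq_nrm; auto.
  + apply L2sq_nrm; auto.
  + apply HE.
  + destruct (HB n2 t2) as (H2 & _ & _); fold (nr n2); fold (nr n2) in H1.
    assert (2 * nr n2 (eps n2 t2) * nr n2 (w t2) <= 2 * (e / (2 * B)) * B).
    { apply Rmult_le_compat; try lra; [|apply nr_nonneg].
      assert (H3 := nr_nonneg n2 (eps n2 t2)); lra. }
    replace (2 * (e / (2 * B)) * B) with e in H0 by (field; lra); lra.
- exact Heta.
- eapply Rle_trans; [apply (wdot_modes_mono L n (max n n0)); [exact HL|lia]|].
  apply (Hn0 (max n n0)); lia.
Qed.

Lemma solution_energy X rho E :
  (forall n t, nr n (w t) <= X) -> gamma <= rho <= gamma + mu ->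
  (forall n t, (rho - gamma) * ip n (dx L (w t)) (dx L (w t))
     <= mu * ip n (Pm m (dx L (w t))) (Pm m (dx L (w t))) + mu * E) ->
  forall n t, ip n (dx L (w t)) (dx L (w t)) <= energy_bound ka gamma mu X G G' rho E.
Proof.
intros HX Hrho HE n t; destruct apriori as (B & HB0 & HB).
assert (HX0 : 0 <= X) by (eapply Rle_trans; [apply (nr_nonneg 0 (w 0))|apply HX]).
assert (Hka := agmon_nonneg); fold ka in Hka.
set (s2 := sup2 ka B B).
assert (Hs2 : 0 <= s2) by (apply Rmult_le_pos; [exact Hka|nra]).
assert (HNb : forall n t, nr n (nonlin n (w t)) <= s2 * B).
{ intros n1 t1; destruct (HB n1 t1) as (H1 & H2 & _).
  eapply Rle_trans; [apply nrm_nonlin, HL|].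
  apply Rmult_le_compat; [apply Rle_0_sqr|apply nr_nonneg|now apply (sup1_sqr n1)|exact H1]. }
(* This bound depends on the solution, but only multiplies the truncation error. *)
set (D := B + s2 * B + G + 1).
assert (HsB : 0 <= s2 * B) by nra.
assert (HD : forall n t, nr n (ham_grad L n (w t) (g t)) <= D).
{ intros n1 t1; destruct (HB n1 t1) as (_ & _ & H3).
  set (Gm := fun k => Cscal (-1) (g t1 k)).
  unfold nr; rewrite (nrm_ext _ _ _ (fun k => Cadd (Cadd (lap L (w t1) k) (nonlin n1 (w t1) k)) (Gm k)))
    by (intros; unfold ham_grad, Gm; apply C_ext; simpl; ring).
  eapply Rle_trans; [apply nrm_add, HL0|].
  assert (H4 : nr n1 (fun k => Cadd (lap L (w t1) k) (nonlin n1 (w t1) k))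
     <= nr n1 (lap L (w t1)) + nr n1 (nonlin n1 (w t1))) by apply nrm_add, HL0.
  assert (H5 : nr n1 Gm <= G).
  { eapply Rle_trans; [apply nrm_scal, HL0|].
    replace (Rabs (-1)) with 1 by (unfold Rabs; destruct (Rcase_abs (-1)); lra).
    rewrite Rmult_1_l; apply Hnr_g. }
  assert (H6 := HNb n1 t1).
  fold (nr n1 Gm); fold (nr n1 (fun k => Cadd (lap L (w t1) k) (nonlin n1 (w t1) k))).
  unfold D; lra. }
apply le_of_le_add_eps; intros eta Heta.
set (K := energy_forcing ka gamma mu X G G' rho E).
(* eta / 2, because [energy_lower] doubles the energy. *)
destruct (gronwall_line (fun n => energy L n w g) (fun n => energy' L n w ws g g') rho
  K (B * B + s2 * B * B + 2 * (B * G)) 0) with (t := t) (eta := eta / 2) as [n0 Hn0].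
- lra.
- intros; apply energy_deriv; [exact Hw_deriv|exact Hg_deriv].
- intros n1 t1 _; destruct (HB n1 t1) as (H1 & H2 & _); unfold energy; fold (ip n1).
  rewrite <- nr_sqr.
  destruct (ip_bounds L n1 HL (nonlin n1 (w t1)) (w t1) _ _ (HNb n1 t1) H1) as [H3 H4].
  destruct (ip_bounds L n1 HL (w t1) (g t1) _ _ H1 (Hnr_g n1 t1)) as [H5 H6].
  fold (ip n1) in H3, H4, H5, H6.
  assert (H7 := nr_nonneg n1 (dx L (w t1))).
  assert (nr n1 (dx L (w t1)) * nr n1 (dx L (w t1)) <= B * B) by (apply Rmult_le_compat; lra).
  assert (0 <= nr n1 (dx L (w t1)) * nr n1 (dx L (w t1))) by nra.
  assert (0 <= s2 * B * B) by nra.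
  assert (0 <= B * B) by nra.
  apply Rabs_le; lra.
- intros a b e Hab He.
  assert (HD0 : 0 < D) by (unfold D; lra).
  destruct (eps_small a b (e / (2 * D)) Hab) as [n1 Hn1]; [apply Rdiv_lt_0_compat; lra|].
  exists n1; intros n2 Hn2 t2 Ht2; destruct (Hn1 n2 Hn2 t2 Ht2) as [H1 _].
  assert (H := energy_ineq L gamma mu m n2 HL Hgamma Hmu (w t2) (ws t2) (g t2) (g' t2) (eps n2 t2)
    (fun k _ => Hc' n2 t2 k) X G G' rho E (HX n2 t2) (Hnr_g n2 t2) (Hnr_g' n2 t2) Hrho (HE n2 t2)).
  unfold energy, energy', K, energy_forcing; fold ka in H; fold (nr n2) in H; fold (ip n2) in *.
  assert (2 * nr n2 (eps n2 t2) * nr n2 (ham_grad L n2 (w t2) (g t2)) <= 2 * (e / (2 * D)) * D).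
  { apply Rmult_le_compat; [| |lra|apply HD]; [|apply nr_nonneg].
    assert (H3 := nr_nonneg n2 (eps n2 t2)); lra. }
  replace (2 * (e / (2 * D)) * D) with e in H0 by (field; lra); lra.
- lra.
- set (n1 := max n n0).
  eapply Rle_trans; [apply (wdot_modes_mono L n n1); [exact HL|unfold n1; lia]|].
  assert (H := energy_lower L n1 HL (w t) (g t) X G (HX n1 t) (Hnr_g n1 t)).
  assert (H1 := Hn0 n1 ltac:(unfold n1; lia)); unfold energy in H1.
  fold ka in H; fold (ip n1) in H, H1; fold (ip n1); unfold energy_bound; fold K; lra.
Qed.

(** The delicate term is 3 S Sx q y with y = |[vfield]|. By Agmon Sx^2 is affine in |w_xx|, and
    |w_xx| <= y + |[vrest]|; so the term grows like y^(3/2) and the damping gamma y^2 absorbs it. *)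
Lemma solution_mod_energy X Q :
  (forall n t, nr n (w t) <= X) -> (forall n t, nr n (dx L (w t)) <= Q) ->
  forall n t,
    nr n (lap L (w t)) <= sqrt (mod_bound ka gamma mu X Q G G') + rest_bound ka gamma mu X Q G /\
    nr n (ws t) <= sqrt (mod_bound ka gamma mu X Q G G') + 1.
Proof.
intros HX HQ; destruct apriori as (B & HB0 & HB).
assert (HX0 : 0 <= X) by (eapply Rle_trans; [apply (nr_nonneg 0 (w 0))|apply HX]).
assert (HQ0 : 0 <= Q) by (eapply Rle_trans; [apply (nr_nonneg 0 (dx L (w 0)))|apply HQ]).
assert (Hka := agmon_nonneg); fold ka in Hka.
set (s2 := sup2 ka X Q); set (rr := rest_bound ka gamma mu X Q G).
assert (Hs2 : 0 <= s2) by (apply Rmult_le_pos; [exact Hka|nra]).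
assert (Hrr : 0 <= rr).
{ unfold rr, rest_bound; fold s2. assert (0 <= s2 * X) by nra.
  assert (0 <= (gamma + mu) * X) by nra. lra. }
assert (HS : forall n t, sup1 n (w t) * sup1 n (w t) <= s2) by (intros; now apply (sup1_sqr n)).
assert (Hr : forall n t, nr n (vrest gamma mu m n (w t) (g t)) <= rr).
{ intros; apply nr_vrest; auto. }
set (al := mod_slope ka gamma mu X Q G G'); set (de := mod_const ka gamma mu X Q G).
set (be := 9 / gamma * (s2 * ka * (Q * Q * Q))).
assert (Hig : 0 < / gamma) by (apply Rinv_0_lt_compat, Hgamma).
set (D := let s := s2 in
  (B + rr) + 2 * s2 * (B + rr) + s2 * rr + 3 * (sqrt (s2 * sup2 ka B B) * B)
  + (gamma + mu) * (B + rr) + 1).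
assert (Hs2B : 0 <= sup2 ka B B) by (apply Rmult_le_pos; [exact Hka|nra]).
assert (HD0 : 0 < D).
{ unfold D. assert (H1 := sqrt_pos (s2 * sup2 ka B B)).
  assert (0 <= sqrt (s2 * sup2 ka B B) * B) by nra.
  assert (0 <= s2 * (B + rr)) by nra. assert (0 <= s2 * rr) by nra.
  assert (0 <= (gamma + mu) * (B + rr)) by nra. lra. }
set (K := gamma * (s2 * (Q * Q)) + 2 * (al * al) / gamma + 2 * de).
set (Z := mod_bound ka gamma mu X Q G G').
assert (HZ : K / gamma + s2 * (Q * Q) + 1 = Z).
{ unfold K, Z, mod_bound; fold s2 al de; field; lra. }
assert (Hcorr : forall n t, - (s2 * (Q * Q)) <=
  mod_energy L gamma mu m n (w t) (g t) - nr n (vf n t) * nr n (vf n t) <= s2 * (Q * Q)).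
{ intros n t; apply Rabs_le_both; unfold mod_energy, vf; rewrite nr_sqr; fold (ip n).
  match goal with |- Rabs (?a + ?b - ?c) <= _ => replace (a + b - c) with b by ring end.
  eapply Rle_trans; [apply quartic_correction_bound, HL|].
  apply Rmult_le_compat; [apply Rle_0_sqr| |apply HS|].
  - apply Rmult_le_pos; apply nrm_nonneg.
  - apply Rmult_le_compat; try apply nrm_nonneg; apply HQ. }
assert (HY : forall n t, nr n (vf n t) <= B + rr).
{ intros n t; destruct (HB n t) as (_ & _ & H3).
  eapply Rle_trans; [apply nr_vfield_le|]; apply Rplus_le_compat; [exact H3|apply Hr]. }
assert (HJ : forall a b e, a <= b -> 0 < e -> exists n0, forall n, (n0 <= n)%nat ->
  forall t, a <= t <= b ->
  2 * mod_energy'_half L gamma mu m n (w t) (ws t) (g t) (g' t)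
  <= - gamma * mod_energy L gamma mu m n (w t) (g t) + K + e).
{ intros a b e Hab He.
  destruct (eps_small a b (e / (2 * D)) Hab) as [n1 Hn1]; [apply Rdiv_lt_0_compat; lra|].
  exists n1; intros n Hn t Ht; destruct (Hn1 n Hn t Ht) as [He1 He2].
  assert (H := mod_energy_ineq L gamma mu m n HL Hgamma Hmu (w t) (ws t) (g t) (g' t) (eps n t)
    (fun k _ => Hc' n t k) _ G' He1 He2 (Hnr_g' n t)); cbv zeta in H.
  fold (nr n) in H; fold (vf n t) in H.
  assert (Hy := HY n t); assert (Hq := HQ n t); assert (Hrn := Hr n t).
  assert (HlapY := nr_lap_le n (w t) (g t)); fold (vf n t) in HlapY.
  assert (Hs := HS n t).
  destruct (HB n t) as (HB1 & HB2 & HB3).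
  assert (Hsx : sup1 n (dx L (w t)) * sup1 n (dx L (w t)) <=
     sup2 ka (nr n (dx L (w t))) (nr n (lap L (w t)))).
  { apply (sup1_sqr n); [lra|rewrite nr_lap_dx; lra]. }
  assert (HsxB : sup1 n (dx L (w t)) * sup1 n (dx L (w t)) <= sup2 ka B B).
  { apply (sup1_sqr n); [exact HB2|rewrite nr_lap_dx; exact HB3]. }
  assert (Hy0 := nr_nonneg n (vf n t)); assert (Hr0 := nr_nonneg n (vrest gamma mu m n (w t) (g t))).
  assert (Hq0 := nr_nonneg n (dx L (w t))); assert (Hh0 := nr_nonneg n (lap L (w t))).
  assert (HS0 := sup1_nonneg n (w t)); assert (HSx0 := sup1_nonneg n (dx L (w t))).
  set (y := nr n (vf n t)) in *; set (q := nr n (dx L (w t))) in *; set (h := nr n (lap L (w t))) in *.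
  set (r := nr n (vrest gamma mu m n (w t) (g t))) in *.
  set (S := sup1 n (w t)) in *; set (Sx := sup1 n (dx L (w t))) in *.
  set (J := mod_energy L gamma mu m n (w t) (g t)) in *.
  assert (HSS0 : 0 <= S * S) by nra; assert (HSxSx0 : 0 <= Sx * Sx) by nra.
  (* [T1] and [T3] each spend gamma / 4 of the damping; the remaining gamma / 2 becomes the rate
     gamma after doubling the half derivative. *)
  assert (T1 : 3 * (S * Sx * q) * y <= gamma / 4 * (y * y) + de + be * y).
  { assert (Hsx2 : Sx * Sx <= ka * (Q * Q + Q * (y + rr))).
    { eapply Rle_trans; [exact Hsx|]; apply Rmult_le_compat_l; [exact Hka|].
      apply Rplus_le_compat; apply Rmult_le_compat; lra. }
    assert (Hz : (S * Sx * q) * (S * Sx * q) <= s2 * (ka * (Q * Q + Q * (y + rr))) * (Q * Q)).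
    { replace ((S * Sx * q) * (S * Sx * q)) with ((S * S) * (Sx * Sx) * (q * q)) by ring.
      apply Rmult_le_compat; [now apply Rmult_le_pos|nra| |apply Rmult_le_compat; lra].
      apply Rmult_le_compat; lra. }
    set (z := S * Sx * q) in *.
    assert (Hsq := Rle_0_sqr (6 * z - gamma * y)); unfold Rsqr in Hsq.
    assert (H1 : 0 <= (6 * z - gamma * y) * (6 * z - gamma * y) * / gamma * / 4).
    { apply Rmult_le_pos; [apply Rmult_le_pos; lra|lra]. }
    replace ((6 * z - gamma * y) * (6 * z - gamma * y) * / gamma * / 4)
      with (9 / gamma * (z * z) + gamma / 4 * (y * y) - 3 * z * y) in H1 by (field; lra).
    assert (H2 : 9 / gamma * (z * z) <= 9 / gamma * (s2 * (ka * (Q * Q + Q * (y + rr))) * (Q * Q))).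
    { apply Rmult_le_compat_l; [unfold Rdiv; lra|exact Hz]. }
    replace (9 / gamma * (s2 * (ka * (Q * Q + Q * (y + rr))) * (Q * Q)))
      with (de + be * y) in H2 by (unfold de, be, mod_const; fold s2 rr; ring).
    lra. }
  assert (T2 : S * S * r * y <= s2 * rr * y).
  { apply Rmult_le_compat_r; [exact Hy0|]; apply Rmult_le_compat; lra. }
  assert (T3 : al * y <= gamma / 4 * (y * y) + al * al / gamma).
  { assert (Hsq := Rle_0_sqr (2 * al - gamma * y)); unfold Rsqr in Hsq.
    assert (H1 : 0 <= (2 * al - gamma * y) * (2 * al - gamma * y) * / gamma * / 4).
    { apply Rmult_le_pos; [apply Rmult_le_pos; lra|lra]. }
    replace ((2 * al - gamma * y) * (2 * al - gamma * y) * / gamma * / 4)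
      with (al * al / gamma + gamma / 4 * (y * y) - al * y) in H1 by (field; lra).
    lra. }
  assert (T4 : al * y = s2 * rr * y + G' * y + be * y)
    by (unfold al, be, mod_slope; fold s2 rr; ring).
  assert (T5 : y + 2 * (S * S) * y + S * S * r + 3 * (S * Sx * q) + (gamma + mu) * y <= D).
  { assert (S * S * y <= s2 * (B + rr)) by (apply Rmult_le_compat; lra).
    assert (S * S * r <= s2 * rr) by (apply Rmult_le_compat; lra).
    assert (S * Sx <= sqrt (s2 * sup2 ka B B)).
    { apply sqr_le_le; [apply sqrt_pos|].
      rewrite sqrt_sqrt by (apply Rmult_le_pos; assumption).
      replace (S * Sx * (S * Sx)) with ((S * S) * (Sx * Sx)) by ring.
      apply Rmult_le_compat; lra. }
    assert (S * Sx * q <= sqrt (s2 * sup2 ka B B) * B).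
    { apply Rmult_le_compat; try lra. now apply Rmult_le_pos. }
    assert ((gamma + mu) * y <= (gamma + mu) * (B + rr)) by (apply Rmult_le_compat_l; lra).
    unfold D; cbv zeta; lra. }
  assert (T6 : e / (2 * D) * (y + 2 * (S * S) * y + S * S * r + 3 * (S * Sx * q) + (gamma + mu) * y)
               <= e / 2).
  { apply Rle_trans with (e / (2 * D) * D).
    - apply Rmult_le_compat_l; [apply Rlt_le, Rdiv_lt_0_compat; lra|exact T5].
    - right; field; lra. }
  assert (T7 : gamma * (J - y * y) <= gamma * (s2 * (Q * Q))).
  { apply Rmult_le_compat_l; [lra|]. apply (Hcorr n t). }
  unfold K; lra. }
intros n t.
destruct (gronwall_line (fun n t => mod_energy L gamma mu m n (w t) (g t))
  (fun n t => 2 * mod_energy'_half L gamma mu m n (w t) (ws t) (g t) (g' t)) gamma K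
  ((B + rr) * (B + rr) + s2 * (Q * Q)) 0) with (t := t) (eta := 1) as [n0 Hn0].
- exact Hgamma.
- intros; apply (mod_energy_deriv L gamma mu m n0 w ws g g'); [exact Hw_deriv|exact Hg_deriv].
- intros n1 t1 _; assert (H1 := Hcorr n1 t1); assert (H2 := HY n1 t1).
  assert (H3 := nr_nonneg n1 (vf n1 t1)).
  assert (nr n1 (vf n1 t1) * nr n1 (vf n1 t1) <= (B + rr) * (B + rr)) by (apply Rmult_le_compat; lra).
  assert (0 <= nr n1 (vf n1 t1) * nr n1 (vf n1 t1)) by nra.
  assert (0 <= (B + rr) * (B + rr)) by nra.
  apply Rabs_le; lra.
- exact HJ.
- lra.
(* A single instant suffices: |eps| <= 1 is the 1 added in the bound of [ws], whereas the 1 inside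
   [mod_bound] is the [eta] of [gronwall_line]. *)
- destruct (eps_small t t 1) as [n2 Hn2]; [lra|lra|].
  set (p := max n (max n0 n2)).
  assert (H1 := Hn0 p ltac:(unfold p; lia)); cbv beta in H1.
  destruct (Hn2 p ltac:(unfold p; lia) t ltac:(lra)) as [H2 _].
  assert (H3 := Hcorr p t).
  assert (HYZ : nr p (vf p t) <= sqrt Z).
  { apply sqr_le_le; [apply sqrt_pos|]. rewrite sqrt_sqrt; [lra|].
    assert (0 <= nr p (vf p t) * nr p (vf p t)) by (assert (H4 := nr_nonneg p (vf p t)); nra).
    lra. }
  split.
  + eapply Rle_trans; [apply (nrm_modes_mono L n p); [exact HL|unfold p; lia]|].
    assert (H4 := nr_lap_le p (w t) (g t)); assert (H5 := Hr p t).
    fold (vf p t) in H4; fold (nr p); lra.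
  + eapply Rle_trans; [apply (nrm_modes_mono L n p); [exact HL|unfold p; lia]|].
    rewrite (nrm_ext _ _ _ _ (fun k _ => Hc' p t k)).
    eapply Rle_trans; [apply nrm_add, HL0|].
    assert (Hi := nr_i L p (eps p t)); rewrite Hi; fold (nr p); lra.
Qed.

End Solution.

(** * Growth of the bounds in mu *)

Lemma mul_le a b a' b' : 0 <= a -> 0 <= b -> a <= a' -> b <= b' -> a * b <= a' * b'.
Proof. intros; apply Rmult_le_compat; assumption. Qed.

(** The worst term is the square of (gamma + mu) |w|^3 over gamma, hence La^2 lam^6 when |w| <= xi
    lam. The bootstrap takes lam = La, giving La^8, and later lam = 1, giving La^2. *)
Lemma energy_bound_crude ka gamma xi nf V :
  0 <= ka -> 0 < gamma -> 0 <= xi -> 0 <= nf -> 0 <= V ->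
  exists c, 0 <= c /\ forall mu lam, 0 < mu -> 1 <= lam ->
    energy_bound ka gamma mu (xi * lam) (nf + mu * V) (mu * V) gamma 0
    <= c * ((1 + mu) ^ 2 * lam ^ 6).
Proof.
intros Hka Hg Hxi Hnf HV.
assert (Hig : 0 < / gamma) by now apply Rinv_0_lt_compat.
set (A := ka * xi ^ 4); set (B := ka * xi ^ 3); set (D := (nf + V) * xi).
assert (HA : 0 <= A) by (apply Rmult_le_pos; [|apply pow_le]; assumption).
assert (HB : 0 <= B) by (apply Rmult_le_pos; [|apply pow_le]; assumption).
assert (HD : 0 <= D) by (apply Rmult_le_pos; lra).
assert (HVx : 0 <= V * xi) by now apply Rmult_le_pos.
set (g1 := gamma + 1).
exists (2 * ((2 * g1 * A + 4 * g1 * D + 2 * (V * xi) + g1 * B * (g1 * B) * / gamma) * / gamma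
       + / 2 * A + / 8 * (B * B) + 2 * D)).
assert (H0 : 0 <= g1 * A) by (apply Rmult_le_pos; unfold g1; lra).
assert (H1 : 0 <= g1 * D) by (apply Rmult_le_pos; unfold g1; lra).
assert (H2 : 0 <= g1 * B) by (apply Rmult_le_pos; unfold g1; lra).
assert (H3 : 0 <= g1 * B * (g1 * B) * / gamma)
  by (apply Rmult_le_pos; [now apply Rmult_le_pos|lra]).
assert (H4 : 0 <= B * B) by now apply Rmult_le_pos.
split.
{ assert (0 <= (2 * g1 * A + 4 * g1 * D + 2 * (V * xi) + g1 * B * (g1 * B) * / gamma) * / gamma)
    by (apply Rmult_le_pos; lra).
  lra. }
intros mu lam Hmu Hlam.
set (La := 1 + mu); set (T := La ^ 2 * lam ^ 6).
assert (HLa : 1 <= La) by (unfold La; lra).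
assert (Hl1 : forall k, 1 <= lam ^ k) by (intros; now apply pow_R1_Rle).
assert (HLa2 : La <= La ^ 2) by nra.
assert (M1 : La * lam ^ 4 <= T).
{ apply mul_le; [lra|specialize (Hl1 4%nat); lra|lra|apply Rle_pow; [lra|lia]]. }
assert (M2 : La ^ 2 * lam <= T).
{ apply mul_le; [nra|lra|lra|]. rewrite <- (pow_1 lam) at 1; apply Rle_pow; [lra|lia]. }
assert (M3 : La * lam <= T) by nra.
assert (M4 : lam ^ 4 <= T) by (specialize (Hl1 4%nat); nra).
assert (M5 : lam ^ 6 <= T) by (unfold T; specialize (Hl1 6%nat); nra).
assert (Hgm : 0 <= gamma + mu <= g1 * La) by (unfold g1, La; nra).
set (G := nf + mu * V).
assert (HG : 0 <= G <= (nf + V) * La).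
{ unfold G, La; assert (0 <= mu * V) by (apply Rmult_le_pos; lra).
  assert (0 <= mu * nf) by (apply Rmult_le_pos; lra). lra. }
assert (HGX : 0 <= G * (xi * lam) <= D * (La * lam)).
{ split; [apply Rmult_le_pos; [lra|apply Rmult_le_pos; lra]|].
  replace (D * (La * lam)) with ((nf + V) * La * (xi * lam)) by (unfold D; ring).
  apply Rmult_le_compat_r; [apply Rmult_le_pos; lra|lra]. }
assert (HGX' : G * (xi * lam) <= D * T)
  by (eapply Rle_trans; [apply HGX|apply Rmult_le_compat_l; lra]).
assert (T1 : (gamma + mu) * (ka * (xi * lam * (xi * lam) * (xi * lam * (xi * lam)))) <= g1 * A * T).
{ replace (ka * (xi * lam * (xi * lam) * (xi * lam * (xi * lam)))) with (A * lam ^ 4)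
    by (unfold A; ring).
  apply Rle_trans with (g1 * La * (A * lam ^ 4)).
  - apply Rmult_le_compat_r; [apply Rmult_le_pos; [exact HA|specialize (Hl1 4%nat); lra]|lra].
  - replace (g1 * La * (A * lam ^ 4)) with (g1 * A * (La * lam ^ 4)) by ring.
    now apply Rmult_le_compat_l. }
assert (T2 : (gamma + mu) * (G * (xi * lam)) <= g1 * D * T).
{ apply Rle_trans with (g1 * La * (D * (La * lam))); [apply mul_le; lra|].
  replace (g1 * La * (D * (La * lam))) with (g1 * D * (La ^ 2 * lam)) by ring.
  now apply Rmult_le_compat_l. }
assert (T3 : mu * V * (xi * lam) <= V * xi * T).
{ apply Rle_trans with (V * xi * (La * lam)); [|now apply Rmult_le_compat_l].
  replace (mu * V * (xi * lam)) with (V * xi * (mu * lam)) by ring.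
  apply Rmult_le_compat_l; [exact HVx|]; apply Rmult_le_compat_r; unfold La; lra. }
set (z := (gamma + mu) * ka * (xi * lam * (xi * lam) * (xi * lam))).
assert (Hz : 0 <= z <= g1 * B * (La * lam ^ 3)).
{ unfold z.
  replace ((gamma + mu) * ka * (xi * lam * (xi * lam) * (xi * lam)))
    with ((gamma + mu) * (B * lam ^ 3)) by (unfold B; ring).
  assert (0 <= B * lam ^ 3) by (apply Rmult_le_pos; [exact HB|specialize (Hl1 3%nat); lra]).
  split; [apply Rmult_le_pos; lra|].
  replace (g1 * B * (La * lam ^ 3)) with (g1 * La * (B * lam ^ 3)) by ring.
  apply Rmult_le_compat_r; lra. }
assert (T4 : z * z / gamma <= g1 * B * (g1 * B) * / gamma * T).
{ apply Rle_trans with (g1 * B * (La * lam ^ 3) * (g1 * B * (La * lam ^ 3)) / gamma).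
  - apply Rmult_le_compat_r; [lra|]; apply mul_le; lra.
  - right; unfold T, Rdiv; ring. }
assert (T5 : ka * (xi * lam * (xi * lam) * (xi * lam * (xi * lam))) <= A * T).
{ replace (ka * (xi * lam * (xi * lam) * (xi * lam * (xi * lam)))) with (A * lam ^ 4)
    by (unfold A; ring). now apply Rmult_le_compat_l. }
assert (T6 : ka * (xi * lam * (xi * lam) * (xi * lam)) * (ka * (xi * lam * (xi * lam) * (xi * lam)))
             <= B * B * T).
{ replace (ka * (xi * lam * (xi * lam) * (xi * lam)) * (ka * (xi * lam * (xi * lam) * (xi * lam))))
    with (B * B * lam ^ 6) by (unfold B; ring). now apply Rmult_le_compat_l. }
assert (T7 : energy_forcing ka gamma mu (xi * lam) G (mu * V) gamma 0 / gamma
  <= (2 * g1 * A + 4 * g1 * D + 2 * (V * xi) + g1 * B * (g1 * B) * / gamma) * / gamma * T).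
{ apply Rle_trans with ((2 * g1 * A + 4 * g1 * D + 2 * (V * xi)
      + g1 * B * (g1 * B) * / gamma) * T * / gamma); [|right; ring].
  apply Rmult_le_compat_r; [lra|]; unfold energy_forcing; fold z; lra. }
unfold energy_bound; lra.
Qed.

(** For |w| bounded independently of mu the forcing is quadratic in mu, and the quotient by rho =
    gamma + mu removes one power. *)
Lemma energy_bound_sharp ka gamma X nf V :
  0 <= ka -> 0 < gamma -> 0 <= X -> 0 <= nf -> 0 <= V ->
  exists c, 0 <= c /\ forall mu, 0 < mu ->
    energy_bound ka gamma mu X (nf + mu * V) (mu * V) (gamma + mu) 1 <= c * (1 + mu).
Proof.
intros Hka Hg HX Hnf HV.
set (A := ka * (X * X * (X * X))); set (B := ka * (X * X * X)); set (D := (nf + V) * X).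
assert (HXX : 0 <= X * X) by now apply Rmult_le_pos.
assert (HA : 0 <= A) by (repeat apply Rmult_le_pos; assumption).
assert (HB : 0 <= B) by (repeat apply Rmult_le_pos; assumption).
assert (HBB : 0 <= B * B) by now apply Rmult_le_pos.
assert (HD : 0 <= D) by (apply Rmult_le_pos; lra).
assert (HVX : 0 <= V * X) by now apply Rmult_le_pos.
exists (2 * (2 + 2 * A + 4 * D + 2 * (V * X) + B * B + / 2 * A + / 8 * (B * B) + 2 * D)).
split; [lra|]; intros mu Hmu.
set (rho := gamma + mu); set (G := nf + mu * V).
assert (HGX : G * X <= D * (1 + mu)).
{ replace (D * (1 + mu)) with ((nf + V) * (1 + mu) * X) by (unfold D; ring).
  apply Rmult_le_compat_r; [exact HX|]; unfold G.
  assert (0 <= mu * nf) by (apply Rmult_le_pos; lra). lra. }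
assert (Hr : 0 < rho) by (unfold rho; lra).
assert (E : energy_forcing ka gamma mu X G (mu * V) rho 1 / rho
  = 2 * (mu / rho) + 2 * (A + 2 * (G * X)) + 2 * (V * X) * (mu / rho) + B * B).
{ unfold energy_forcing, A, B; fold rho; field; lra. }
assert (Hmr : 0 <= mu / rho <= 1).
{ split; [apply Rlt_le, Rdiv_lt_0_compat; lra|].
  apply Rmult_le_reg_r with (r := rho); [exact Hr|].
  unfold Rdiv; rewrite Rmult_assoc, Rinv_l by lra; unfold rho; lra. }
assert (Hmr2 : 2 * (V * X) * (mu / rho) <= 2 * (V * X) * 1) by (apply Rmult_le_compat_l; lra).
unfold energy_bound; rewrite E; fold A B.
assert (0 <= mu * A) by (apply Rmult_le_pos; lra).
assert (0 <= mu * D) by (apply Rmult_le_pos; lra).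
assert (0 <= mu * (V * X)) by (apply Rmult_le_pos; lra).
assert (0 <= mu * (B * B)) by (apply Rmult_le_pos; lra).
lra.
Qed.

(** For |w_x| <= theta b and 1 + mu <= b^2, [sup2] is O(b), [rest_bound] O(b^2), [mod_slope] O(b^4),
    [mod_const] O(b^6), and [mod_bound] O(b^8). The free parameter is b = La in the first use and b
    = sqrt La in the second. *)
Lemma mod_bound_growth ka gamma X theta nf V :
  0 <= ka -> 0 < gamma -> 0 <= X -> 0 <= theta -> 0 <= nf -> 0 <= V ->
  exists c, 0 <= c /\ forall mu b, 0 < mu -> 1 <= b -> 1 + mu <= b * b ->
    sqrt (mod_bound ka gamma mu X (theta * b) (nf + mu * V) (mu * V))
      + rest_bound ka gamma mu X (theta * b) (nf + mu * V) <= c * b ^ 4 /\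
    sqrt (mod_bound ka gamma mu X (theta * b) (nf + mu * V) (mu * V)) + 1 <= c * b ^ 4.
Proof.
intros Hka Hg HX Hth Hnf HV.
assert (Hig : 0 < / gamma) by now apply Rinv_0_lt_compat.
set (sg := ka * (X * X + X * theta)).
assert (Hsg : 0 <= sg).
{ apply Rmult_le_pos; [exact Hka|].
  assert (0 <= X * X) by now apply Rmult_le_pos. assert (0 <= X * theta) by now apply Rmult_le_pos. lra. }
set (r0 := sg * X + (gamma + 1) * X + (nf + V)).
assert (HsX : 0 <= sg * X) by now apply Rmult_le_pos.
assert (HgX : 0 <= (gamma + 1) * X) by (apply Rmult_le_pos; lra).
assert (Hr0 : 0 <= r0) by (unfold r0; lra).
set (n9 := 9 / gamma); assert (Hn9 : 0 <= n9) by (unfold n9, Rdiv; lra).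
set (be := n9 * (sg * ka * (theta * theta * theta))).
set (de := n9 * (sg * ka * (theta * theta) * (theta * theta + theta * r0))).
assert (Hsk : 0 <= sg * ka) by now apply Rmult_le_pos.
assert (Htt : 0 <= theta * theta) by now apply Rmult_le_pos.
assert (Htr : 0 <= theta * r0) by now apply Rmult_le_pos.
assert (Hbe : 0 <= be).
{ apply Rmult_le_pos; [exact Hn9|]; apply Rmult_le_pos; [exact Hsk|].
  apply Rmult_le_pos; [exact Htt|exact Hth]. }
assert (Hde : 0 <= de).
{ apply Rmult_le_pos; [exact Hn9|]; apply Rmult_le_pos; [|lra].
  apply Rmult_le_pos; [exact Hsk|exact Htt]. }
set (s0 := sg * r0 + V + be).
assert (Hsr : 0 <= sg * r0) by now apply Rmult_le_pos.
assert (Hs0 : 0 <= s0) by (unfold s0; lra).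
set (c0 := 2 * (sg * (theta * theta)) + 2 * (s0 * s0) / (gamma * gamma) + 2 * de / gamma + 1).
assert (Hst : 0 <= sg * (theta * theta)) by now apply Rmult_le_pos.
assert (Hss : 0 <= s0 * s0) by now apply Rmult_le_pos.
assert (Higg : 0 < / (gamma * gamma)) by (apply Rinv_0_lt_compat; nra).
assert (Hc0 : 0 <= c0).
{ unfold c0, Rdiv. assert (0 <= 2 * (s0 * s0) * / (gamma * gamma)) by (apply Rmult_le_pos; lra).
  assert (0 <= 2 * de * / gamma) by (apply Rmult_le_pos; lra). lra. }
exists (sqrt c0 + r0 + 1); split; [assert (H := sqrt_pos c0); lra|].
intros mu b Hmu Hb Hmb.
set (Q := theta * b); set (G := nf + mu * V).
assert (HQ : 0 <= Q) by (apply Rmult_le_pos; lra).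
assert (HmV : 0 <= mu * V <= V * (b * b)).
{ split; [apply Rmult_le_pos; lra|]. rewrite Rmult_comm; apply Rmult_le_compat_l; lra. }
assert (HG : 0 <= G <= (nf + V) * (b * b)).
{ split; [unfold G; lra|]. unfold G. assert (nf * 1 <= nf * (b * b)) by (apply Rmult_le_compat_l; lra). lra. }
assert (Hs2 : 0 <= sup2 ka X Q <= sg * b).
{ unfold sup2. assert (0 <= X * X) by now apply Rmult_le_pos. assert (0 <= X * Q) by now apply Rmult_le_pos.
  split; [apply Rmult_le_pos; lra|].
  replace (sg * b) with (ka * (X * X * b + X * Q)) by (unfold sg, Q; ring).
  apply Rmult_le_compat_l; [exact Hka|].
  assert (X * X * 1 <= X * X * b) by (apply Rmult_le_compat_l; lra). lra. }
set (s2 := sup2 ka X Q) in *.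
assert (Hbb : b <= b * b) by nra.
assert (Hb0 : 0 <= b * b) by nra.
assert (Hrr : 0 <= rest_bound ka gamma mu X Q G <= r0 * (b * b)).
{ unfold rest_bound; fold s2.
  assert (0 <= s2 * X) by (apply Rmult_le_pos; lra).
  assert (0 <= (gamma + mu) * X) by (apply Rmult_le_pos; lra).
  assert (s2 * X <= sg * (b * b) * X).
  { apply Rmult_le_compat_r; [exact HX|].
    assert (sg * b <= sg * (b * b)) by (apply Rmult_le_compat_l; lra). lra. }
  assert ((gamma + mu) * X <= (gamma + 1) * (b * b) * X).
  { apply Rmult_le_compat_r; [exact HX|].
    assert (gamma * 1 <= gamma * (b * b)) by (apply Rmult_le_compat_l; lra). lra. }
  unfold r0; lra. }
set (rr := rest_bound ka gamma mu X Q G) in *.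
assert (Hb3 : b * b <= b ^ 4) by nra.
assert (Hb34 : b ^ 3 <= b ^ 4) by (apply Rle_pow; [exact Hb|lia]).
assert (Hb38 : b ^ 3 <= b ^ 8) by (apply Rle_pow; [exact Hb|lia]).
assert (Hb68 : b ^ 6 <= b ^ 8) by (apply Rle_pow; [exact Hb|lia]).
assert (Hb18 : 1 <= b ^ 8) by now apply pow_R1_Rle.
assert (Hb14 : 1 <= b ^ 4) by now apply pow_R1_Rle.
assert (Hslope : 0 <= mod_slope ka gamma mu X Q G (mu * V) <= s0 * b ^ 4).
{ unfold mod_slope; fold s2 rr n9.
  assert (A1 : 0 <= s2 * rr <= sg * b * (r0 * (b * b))) by (split; [apply Rmult_le_pos|apply mul_le]; lra).
  assert (A2 : 0 <= n9 * (s2 * ka * (Q * Q * Q)) <= be * b ^ 4).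
  { assert (0 <= Q * Q) by now apply Rmult_le_pos.
    assert (0 <= Q * Q * Q) by now apply Rmult_le_pos.
    assert (0 <= s2 * ka) by (apply Rmult_le_pos; lra).
    split; [apply Rmult_le_pos; [exact Hn9|now apply Rmult_le_pos]|].
    replace (be * b ^ 4) with (n9 * (sg * b * ka * (Q * Q * Q))) by (unfold be, Q; ring).
    apply Rmult_le_compat_l; [exact Hn9|]; apply Rmult_le_compat_r; [assumption|].
    apply Rmult_le_compat_r; lra. }
  assert (A3 : sg * b * (r0 * (b * b)) <= sg * r0 * b ^ 4).
  { replace (sg * b * (r0 * (b * b))) with (sg * r0 * b ^ 3) by ring.
    now apply Rmult_le_compat_l. }
  assert (A4 : V * (b * b) <= V * b ^ 4) by now apply Rmult_le_compat_l.
  unfold s0; lra. }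
set (sl := mod_slope ka gamma mu X Q G (mu * V)) in *.
assert (Hconst : mod_const ka gamma mu X Q G <= de * b ^ 8).
{ unfold mod_const; fold s2 rr n9.
  apply Rle_trans with (de * b ^ 6); [|now apply Rmult_le_compat_l].
  assert (B1 : Q * Q + Q * rr <= (theta * theta + theta * r0) * b ^ 3).
  { assert (Q * rr <= Q * (r0 * (b * b))) by (apply Rmult_le_compat_l; lra).
    assert (Q * Q <= theta * theta * b ^ 3).
    { replace (Q * Q) with (theta * theta * (b * b)) by (unfold Q; ring).
      apply Rmult_le_compat_l; [exact Htt|]; nra. }
    unfold Q in *; lra. }
  assert (0 <= Q * Q) by now apply Rmult_le_pos.
  assert (0 <= Q * rr) by (apply Rmult_le_pos; lra).
  assert (0 <= s2 * ka) by (apply Rmult_le_pos; lra).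
  replace (de * b ^ 6) with (n9 * (sg * b * ka * (Q * Q) * ((theta * theta + theta * r0) * b ^ 3)))
    by (unfold de, Q; ring).
  apply Rmult_le_compat_l; [exact Hn9|]; apply mul_le; [now apply Rmult_le_pos|lra| |exact B1].
  apply Rmult_le_compat_r; [assumption|]; apply Rmult_le_compat_r; lra. }
assert (Hmod : mod_bound ka gamma mu X Q G (mu * V) <= c0 * (b ^ 4 * b ^ 4)).
{ unfold mod_bound; fold s2 sl.
  replace (b ^ 4 * b ^ 4) with (b ^ 8) by ring.
  assert (C1 : s2 * (Q * Q) <= sg * (theta * theta) * b ^ 8).
  { apply Rle_trans with (sg * (theta * theta) * b ^ 3); [|now apply Rmult_le_compat_l].
    replace (sg * (theta * theta) * b ^ 3) with (sg * b * (Q * Q)) by (unfold Q; ring).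
    apply Rmult_le_compat_r; [now apply Rmult_le_pos|lra]. }
  assert (C2 : sl * sl <= s0 * s0 * b ^ 8).
  { replace (s0 * s0 * b ^ 8) with (s0 * b ^ 4 * (s0 * b ^ 4)) by ring. apply mul_le; lra. }
  assert (C3 : 2 * (sl * sl) / (gamma * gamma) <= 2 * (s0 * s0) / (gamma * gamma) * b ^ 8).
  { apply Rle_trans with (2 * (s0 * s0) * b ^ 8 / (gamma * gamma)); [|right; unfold Rdiv; ring].
    apply Rmult_le_compat_r; lra. }
  assert (C4 : 2 * mod_const ka gamma mu X Q G / gamma <= 2 * de / gamma * b ^ 8).
  { apply Rle_trans with (2 * de * b ^ 8 / gamma); [|right; unfold Rdiv; ring].
    apply Rmult_le_compat_r; lra. }
  unfold c0; lra. }
assert (Hsq : sqrt (mod_bound ka gamma mu X Q G (mu * V)) <= sqrt c0 * b ^ 4).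
{ replace (sqrt c0 * b ^ 4) with (sqrt (c0 * (b ^ 4 * b ^ 4))); [now apply sqrt_le_1_alt|].
  rewrite sqrt_mult by (assumption || nra). rewrite sqrt_square by lra; reflexivity. }
assert (r0 * (b * b) <= r0 * b ^ 4) by now apply Rmult_le_compat_l.
assert (0 <= r0 * b ^ 4) by (apply Rmult_le_pos; lra).
assert (0 <= r0 * (b * b)) by now apply Rmult_le_pos.
split; lra.
Qed.

(** * The bootstrap *)

Lemma wdot_Pm_tail L n m c :
  wdot L (modes n) c c = wdot L (modes n) (Pm m c) (Pm m c) + wdot L (modes n) (tail m c) (tail m c).
Proof.
unfold wdot; rewrite <- Rmult_plus_distr_l, <- rsum_add; f_equal; apply rsum_ext; intros k _.
unfold tail, Pm; destruct (Z.abs k <=? Z.of_nat m)%Z; unfold rdot; simpl; ring.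
Qed.

(** High modes satisfy |c_x| >= kappa_m |c|, and kappa_m = 2 pi m / L >= m / L >= B. It is applied
    to c = w and to c = w_x. *)
Lemma tail_le_one L n m c B :
  0 < L -> 0 <= B -> L * B <= INR m -> 0 < INR m ->
  wdot L (modes n) (dx L c) (dx L c) <= B * B ->
  wdot L (modes n) (tail m c) (tail m c) <= 1.
Proof.
intros HL HB Hm Hm0 H.
assert (H1 := nrm_tail_dx L m n c HL); rewrite !nrm_sqr in H1 by lra.
assert (HP := PI2_1).
assert (Hk : INR m / L <= kappa L (Z.of_nat m)).
{ unfold kappa, Rdiv; apply Rmult_le_compat_r; [apply Rlt_le, Rinv_0_lt_compat, HL|].
  rewrite <- INR_IZR_INZ; unfold Rdiv in HP; nra. }
assert (HBk : B <= INR m / L).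
{ apply Rmult_le_reg_r with (r := L); [exact HL|].
  unfold Rdiv; rewrite Rmult_assoc, Rinv_l by lra; lra. }
assert (HmL : 0 < INR m / L) by (apply Rdiv_lt_0_compat; lra).
set (k := kappa L (Z.of_nat m)) in *.
set (x := wdot L (modes n) (tail m c) (tail m c)) in *.
assert (B * B <= k ^ 2) by (simpl; rewrite Rmult_1_r; apply Rmult_le_compat; lra).
assert (0 < k ^ 2) by (apply pow_lt; lra).
apply Rmult_le_reg_l with (r := k ^ 2); lra.
Qed.

Lemma sqr_le_pos_sqr a b : 0 <= a -> a <= b -> a * a <= b * b.
Proof. intros; apply Rmult_le_compat; lra. Qed.

(** The three terms of the quotient are the squares of the three summands of R_0, and the cross
    terms are nonnegative. The term [mu * 1] is the defect E = 1 of the high modes. *)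
Lemma bigR0_sqr mu gamma nf V :
  0 < mu -> 0 < gamma -> 0 <= nf -> 0 <= V ->
  (nf * nf / gamma + mu * (V * V) + mu * 1) / (gamma + mu) <= bigR0 mu gamma nf V ^ 2.
Proof.
intros Hmu Hg Hnf HV; unfold bigR0.
assert (Hp : 0 < gamma * (gamma + mu)) by (apply Rmult_lt_0_compat; lra).
set (s := sqrt (gamma * (gamma + mu))).
assert (Hs : 0 < s) by now apply sqrt_lt_R0.
assert (Hss : s * s = gamma * (gamma + mu)) by (apply sqrt_sqrt; lra).
assert (Hr : 0 < mu / (gamma + mu)) by (apply Rdiv_lt_0_compat; lra).
set (r := sqrt (mu / (gamma + mu))).
assert (Hr0 : 0 <= r) by apply sqrt_pos.
assert (Hrr : r * r = mu / (gamma + mu)) by (apply sqrt_sqrt; lra).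
assert (Hns : 0 <= nf / s) by (apply Rmult_le_pos; [lra|apply Rlt_le, Rinv_0_lt_compat, Hs]).
assert (HrV : 0 <= r * V) by now apply Rmult_le_pos.
assert (E1 : nf / s * (nf / s) = nf * nf / gamma / (gamma + mu)).
{ replace (nf / s * (nf / s)) with (nf * nf / (s * s)) by (field; lra).
  rewrite Hss; field; lra. }
assert (E2 : r * V * (r * V) = mu * (V * V) / (gamma + mu)).
{ replace (r * V * (r * V)) with ((r * r) * (V * V)) by ring. rewrite Hrr; field; lra. }
replace ((nf * nf / gamma + mu * (V * V) + mu * 1) / (gamma + mu))
  with (nf / s * (nf / s) + r * V * (r * V) + r * r) by (rewrite E1, E2, Hrr; field; lra).
set (a := nf / s) in *; set (b := r * V) in *.
assert (0 <= a * b) by now apply Rmult_le_pos.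
assert (0 <= a * r) by now apply Rmult_le_pos.
assert (0 <= b * r) by now apply Rmult_le_pos.
simpl; lra.
Qed.

(** One [K], chosen before mu and the data, serves all bounds and the threshold on m; mu enters only
    through explicit powers of 1 + mu. *)
Lemma uniform_bounds gamma nf L V :
  0 < gamma -> 0 <= nf -> 0 < L -> 0 <= V ->
  exists K, 0 < K /\ forall mu f m v v' w ws,
    0 < mu -> L2sq_le L f (nf * nf) -> in_X L m v v' ->
    (forall s, L2sq_le L (v s) (V * V)) -> (forall s, L2sq_le L (v' s) (V * V)) ->
    is_solution L gamma mu m f v w ws -> K * (1 + mu) ^ 4 <= INR m ->
    forall s,
      L2sq_le L (w s) (bigR0 mu gamma nf V ^ 2) /\
      H1sq_le L (w s) (K * (1 + mu)) /\
      H2sq_le L (w s) (K * (1 + mu) ^ 4) /\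
      L2sq_le L (ws s) (K * (1 + mu) ^ 4).
Proof.
intros Hg Hnf HL HV.
assert (Hig : 0 < / gamma) by now apply Rinv_0_lt_compat.
assert (Hka := agmon_nonneg L HL).
assert (HVV : 0 <= V * V) by now apply Rmult_le_pos.
assert (Hnn : 0 <= nf * nf / gamma) by (apply Rmult_le_pos; [now apply Rmult_le_pos|lra]).
set (c0 := nf * nf / gamma / gamma + V * V / gamma + 1).
assert (Hc0 : 1 <= c0).
{ unfold c0; assert (0 <= nf * nf / gamma / gamma) by (apply Rmult_le_pos; lra).
  assert (0 <= V * V / gamma) by (apply Rmult_le_pos; lra). lra. }
set (X := nf * nf / gamma / gamma + V * V + 1).
assert (HX : 1 <= X).
{ unfold X; assert (0 <= nf * nf / gamma / gamma) by (apply Rmult_le_pos; lra). lra. }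
destruct (energy_bound_crude (agmon L) gamma c0 nf V) as (c1 & Hc1 & B1); try lra.
destruct (energy_bound_crude (agmon L) gamma X nf V) as (c3 & Hc3 & B3); try lra.
destruct (mod_bound_growth (agmon L) gamma X (sqrt c3) nf V) as (c4 & Hc4 & B4);
  try lra; try apply sqrt_pos.
destruct (energy_bound_sharp (agmon L) gamma X nf V) as (c5 & Hc5 & B5); try lra.
destruct (mod_bound_growth (agmon L) gamma X (sqrt c5) nf V) as (c6 & Hc6 & B6);
  try lra; try apply sqrt_pos.
(* X^2 + c5 serves the H^1 norm, X^2 + c6^2 the H^2 norm, c6^2 the norm of w_s; the last two terms
   make m large enough for the tails of w and of w_x. *)
exists (X * X + c5 + c6 * c6 + L * (1 + c1) + L * (1 + c4)).
assert (HXX : 1 <= X * X) by nra.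
assert (Hcc6 : 0 <= c6 * c6) by now apply Rmult_le_pos.
assert (HLc1 : 0 <= L * (1 + c1)) by (apply Rmult_le_pos; lra).
assert (HLc4 : 0 <= L * (1 + c4)) by (apply Rmult_le_pos; lra).
set (K := X * X + c5 + c6 * c6 + L * (1 + c1) + L * (1 + c4)).
split; [unfold K; lra|].
intros mu f m v v' w ws Hmu Hf HvX Hv Hv' Hsol Hm.
set (La := 1 + mu) in *.
assert (HLa : 1 <= La) by (unfold La; lra).
assert (HLa4 : 1 <= La ^ 4) by now apply pow_R1_Rle.
assert (HLL4 : La <= La ^ 4).
{ rewrite <- (pow_1 La) at 1; apply Rle_pow; [exact HLa|lia]. }
assert (HL0 : 0 <= L) by lra.
assert (Hm0 : 0 < INR m).
{ eapply Rlt_le_trans; [|exact Hm]; apply Rmult_lt_0_compat; [unfold K; lra|lra]. }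
assert (HmK : forall c, 0 <= c -> L * (1 + c) <= K -> L * ((1 + c) * La ^ 4) <= INR m).
{ intros c Hc HcK; eapply Rle_trans; [|exact Hm]; rewrite <- Rmult_assoc.
  apply Rmult_le_compat_r; lra. }
assert (Smass := solution_mass L gamma mu nf V f m v v' w ws HL Hg Hmu Hnf HV Hf HvX Hv Hsol).
assert (Senergy := solution_energy L gamma mu nf V f m v v' w ws HL Hg Hmu Hnf HV Hf HvX Hv Hv' Hsol).
assert (Smod := solution_mod_energy L gamma mu nf V f m v v' w ws HL Hg Hmu Hnf HV Hf HvX Hv Hv' Hsol).
assert (Hdrop : forall n c, (gamma - gamma) * wdot L (modes n) c c
   <= mu * wdot L (modes n) (Pm m c) (Pm m c) + mu * 0).
{ intros n c; assert (H := wdot_self_nonneg L (modes n) HL0 (Pm m c)).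
  assert (0 <= mu * wdot L (modes n) (Pm m c) (Pm m c)) by (apply Rmult_le_pos; lra). lra. }
assert (Hkeep : forall n c, wdot L (modes n) (tail m c) (tail m c) <= 1 ->
   (gamma + mu - gamma) * wdot L (modes n) c c
   <= mu * wdot L (modes n) (Pm m c) (Pm m c) + mu * 1).
{ intros n c H; rewrite (wdot_Pm_tail L n m c).
  replace (gamma + mu - gamma) with mu by ring.
  assert (mu * wdot L (modes n) (tail m c) (tail m c) <= mu * 1) by (apply Rmult_le_compat_l; lra).
  lra. }
assert (W0 : forall n t, nrm L (modes n) (w t) <= c0 * La).
{ intros n t; assert (H := Smass gamma 0 Hg (fun n t => Hdrop n (w t)) n t).
  assert (HcL : 1 <= c0 * La) by nra.
  apply nrm_le; [lra|]; eapply Rle_trans; [exact H|].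
  (* As c0 La >= 1, the bound c0 La of |w|^2 is weakened to its square. The order of m does not
     suffer, since the tail of w_x in [W5] asks for La^4 as well. *)
  apply Rle_trans with (c0 * La); [|nra].
  replace ((nf * nf / gamma + mu * (V * V) + mu * 0) / gamma)
    with (nf * nf / gamma / gamma + V * V / gamma * mu) by (field; lra).
  assert (0 <= nf * nf / gamma / gamma * mu) by (apply Rmult_le_pos; [apply Rmult_le_pos|]; lra).
  assert (0 <= V * V / gamma) by (apply Rmult_le_pos; lra).
  unfold c0, La; lra. }
assert (W1 : forall n t, wdot L (modes n) (dx L (w t)) (dx L (w t))
   <= ((1 + c1) * La ^ 4) * ((1 + c1) * La ^ 4)).
{ intros n t.
  eapply Rle_trans; [apply (Senergy (c0 * La) gamma 0 W0); [lra|intros; apply Hdrop]|].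
  eapply Rle_trans; [apply B1; lra|]; fold La.
  replace (La ^ 2 * La ^ 6) with (La ^ 4 * La ^ 4) by ring.
  assert (0 <= La ^ 4 * La ^ 4) by nra. nra. }
assert (W2 : forall n t, wdot L (modes n) (w t) (w t) <= bigR0 mu gamma nf V ^ 2
   /\ nrm L (modes n) (w t) <= X).
{ intros n t.
  assert (H := Smass (gamma + mu) 1 ltac:(lra)
    (fun n t => Hkeep n (w t) (tail_le_one L n m (w t) ((1 + c1) * La ^ 4) HL ltac:(nra)
       (HmK c1 Hc1 ltac:(unfold K; lra)) Hm0 (W1 n t))) n t).
  split; [eapply Rle_trans; [exact H|now apply bigR0_sqr]|].
  apply nrm_le; [lra|]; eapply Rle_trans; [exact H|].
  apply Rle_trans with X; [|nra].
  apply Rmult_le_reg_r with (r := gamma + mu); [lra|].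
  unfold Rdiv at 1; rewrite Rmult_assoc, Rinv_l, Rmult_1_r by lra.
  replace (X * (gamma + mu)) with (nf * nf / gamma + V * V * gamma + gamma
    + (nf * nf / gamma / gamma * mu + V * V * mu + mu)) by (unfold X; field; lra).
  assert (0 <= nf * nf / gamma / gamma * mu) by (apply Rmult_le_pos; [apply Rmult_le_pos|]; lra).
  assert (0 <= V * V * gamma) by (apply Rmult_le_pos; lra).
  lra. }
assert (W2X : forall n t, nrm L (modes n) (w t) <= X) by (intros; apply W2).
(* The rate gamma again, now with |w| <= X independently of mu: lam = 1 in the crude bound. *)
assert (W3 : forall n t, nrm L (modes n) (dx L (w t)) <= sqrt c3 * La).
{ intros n t; apply nrm_le; [apply Rmult_le_pos; [apply sqrt_pos|lra]|].
  replace (sqrt c3 * La * (sqrt c3 * La)) with (sqrt c3 * sqrt c3 * La ^ 2) by ring.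
  rewrite sqrt_sqrt by exact Hc3.
  eapply Rle_trans; [apply (Senergy X gamma 0 W2X); [lra|intros; apply Hdrop]|].
  assert (H := B3 mu 1 Hmu ltac:(lra)); rewrite Rmult_1_r, pow1, Rmult_1_r in H; exact H. }
(* [mod_bound_growth] with b = La, phrased for the derivative of w_x so that [tail_le_one] applies
   to w_x. *)
assert (W4 : forall n t, wdot L (modes n) (dx L (dx L (w t))) (dx L (dx L (w t)))
   <= ((1 + c4) * La ^ 4) * ((1 + c4) * La ^ 4)).
{ intros n t; rewrite <- nrm_sqr by exact HL0.
  rewrite (nrm_ext _ _ _ _ (fun k _ => dx_dx L (w t) k)).
  apply sqr_le_pos_sqr; [apply nrm_nonneg|].
  eapply Rle_trans; [apply (Smod X (sqrt c3 * La) W2X W3)|].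
  eapply Rle_trans; [apply (B4 mu La); [exact Hmu|exact HLa|fold La; nra]|].
  apply Rmult_le_compat_r; lra. }
(* The tail of w_x is now at most 1, which admits rho = gamma + mu and E = 1 in the energy. *)
assert (W5 : forall n t, wdot L (modes n) (dx L (w t)) (dx L (w t)) <= c5 * La).
{ intros n t; eapply Rle_trans; [apply (Senergy X (gamma + mu) 1 W2X)|].
  - lra.
  - intros n1 t1; apply Hkeep.
    apply (tail_le_one L n1 m (dx L (w t1)) ((1 + c4) * La ^ 4)); auto; [nra|].
    apply HmK; [exact Hc4|unfold K; lra].
  - apply B5, Hmu. }
set (b := sqrt La).
assert (Hbb : b * b = La) by (apply sqrt_sqrt; lra).
assert (Hb : 1 <= b) by (unfold b; rewrite <- sqrt_1; apply sqrt_le_1_alt; exact HLa).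
assert (W5' : forall n t, nrm L (modes n) (dx L (w t)) <= sqrt c5 * b).
{ intros n t; apply nrm_le; [apply Rmult_le_pos; [apply sqrt_pos|lra]|].
  replace (sqrt c5 * b * (sqrt c5 * b)) with (sqrt c5 * sqrt c5 * (b * b)) by ring.
  rewrite sqrt_sqrt, Hbb by exact Hc5; apply W5. }
assert (Hb8 : c6 * b ^ 4 * (c6 * b ^ 4) = c6 * c6 * La ^ 4) by (rewrite <- Hbb; ring).
destruct (B6 mu b Hmu Hb) as [B6a B6b]; [fold La; lra|].
assert (W6 : forall n t, wdot L (modes n) (lap L (w t)) (lap L (w t)) <= c6 * c6 * La ^ 4
  /\ wdot L (modes n) (ws t) (ws t) <= c6 * c6 * La ^ 4).
{ intros n t; destruct (Smod X (sqrt c5 * b) W2X W5' n t) as [H1 H2].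
  rewrite <- Hb8, <- !nrm_sqr by exact HL0.
  split; apply sqr_le_pos_sqr; try apply nrm_nonneg; lra. }
assert (WX : forall n t, wdot L (modes n) (w t) (w t) <= X * X).
{ intros n t; rewrite <- nrm_sqr by exact HL0; apply sqr_le_pos_sqr; [apply nrm_nonneg|apply W2X]. }
assert (HcK : c6 * c6 * La ^ 4 + X * X <= K * La ^ 4).
{ assert (X * X * 1 <= X * X * La ^ 4) by (apply Rmult_le_compat_l; lra).
  assert (0 <= (c5 + L * (1 + c1) + L * (1 + c4)) * La ^ 4) by (apply Rmult_le_pos; lra).
  unfold K; lra. }
intros s; repeat split; intros n.
- rewrite L2sq_wdot; apply W2.
- rewrite H1sq_wdot; assert (H1 := WX n s); assert (H2 := W5 n s).
  assert (X * X * 1 <= X * X * La) by (apply Rmult_le_compat_l; lra).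
  assert (0 <= (c6 * c6 + L * (1 + c1) + L * (1 + c4)) * La) by (apply Rmult_le_pos; lra).
  unfold K; lra.
- rewrite H2sq_wdot; assert (H1 := WX n s); assert (H2 := proj1 (W6 n s)); lra.
- rewrite L2sq_wdot; assert (H2 := proj2 (W6 n s)); lra.
Qed.

(** * Reading the hypotheses *)

Lemma L2norm_is_nonneg L c r : L2norm_is L c r -> 0 <= r.
Proof.
intros H; destruct (Rle_lt_dec 0 r) as [|Hr]; [assumption|].
destruct (H (- r)) as [n0 Hn0]; [lra|]; specialize (Hn0 n0 (le_n _)).
unfold Rdist in Hn0; apply Rabs_def2 in Hn0.
assert (H1 := sqrt_pos (L * symsum (fun k => Cnorm2 (c k)) n0)); lra.
Qed.

Lemma symsum_growing L c : 0 < L -> forall n p, (n <= p)%nat ->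
  0 <= L * symsum (fun k => Cnorm2 (c k)) n <= L * symsum (fun k => Cnorm2 (c k)) p.
Proof.
intros HL n p H; rewrite !symsum_modes; split.
- apply Rmult_le_pos; [lra|]; apply rsum_nonneg; intros; apply Cnorm2_nonneg.
- apply Rmult_le_compat_l; [lra|]; apply rsum_modes_mono; [intros; apply Cnorm2_nonneg|exact H].
Qed.

Lemma L2norm_is_sq_le L c r : 0 < L -> L2norm_is L c r -> L2sq_le L c (r * r).
Proof.
intros HL H n.
replace (L * symsum (fun k => 1 * Cnorm2 (c k)) n) with (L * symsum (fun k => Cnorm2 (c k)) n)
  by (rewrite !symsum_modes; f_equal; apply rsum_ext; intros; ring).
set (u := fun n => sqrt (L * symsum (fun k => Cnorm2 (c k)) n)).
assert (Hr := L2norm_is_nonneg L c r H).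
assert (Hu : u n <= r).
{ destruct (Rle_lt_dec (u n) r) as [|Hlt]; [assumption|].
  destruct (H (u n - r)) as [n0 Hn0]; [lra|].
  specialize (Hn0 (max n n0) ltac:(lia)); fold (u (max n n0)) in Hn0.
  assert (u n <= u (max n n0)) by (apply sqrt_le_1_alt, symsum_growing; [exact HL|lia]).
  unfold Rdist in Hn0; apply Rabs_def2 in Hn0; lra. }
assert (H0 := proj1 (symsum_growing L c HL n n (le_n _))).
rewrite <- (sqrt_sqrt _ H0); fold (u n); apply sqr_le_pos_sqr; [apply sqrt_pos|exact Hu].
Qed.

Lemma L2norm_is_exists L c B : 0 < L -> L2sq_le L c B -> exists r, L2norm_is L c r.
Proof.
intros HL HB.
destruct (growing_cv (fun n => sqrt (L * symsum (fun k => Cnorm2 (c k)) n))) as [r Hr].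
- intros n; apply sqrt_le_1_alt, symsum_growing; [exact HL|lia].
- exists (sqrt B); intros x [n ->]; apply sqrt_le_1_alt.
  eapply Rle_trans; [|apply (HB n)]; right.
  rewrite !symsum_modes; f_equal; apply rsum_ext; intros; ring.
- now exists r.
Qed.

Lemma wsum_le_weaken wt L c B B' : B <= B' -> wsum_le wt L c B -> wsum_le wt L c B'.
Proof. intros H H0 n; eapply Rle_trans; [apply H0|exact H]. Qed.

(** The supremum runs over numbers that are norms; the bound [B] guarantees that each [v s] has one,
    so no time escapes the supremum. *)
Lemma L2norm_lub_bound L (v : R -> FSeq) a B :
  0 < L -> (forall s, L2sq_le L (v s) B) ->
  is_lub (fun r => exists s, L2norm_is L (v s) r) a ->
  0 <= a /\ forall s, L2sq_le L (v s) (a * a).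
Proof.
intros HL HB [Ha _].
assert (H : forall s, exists r, 0 <= r <= a /\ L2sq_le L (v s) (r * r)).
{ intros s; destruct (L2norm_is_exists L (v s) B HL (HB s)) as [r Hr]; exists r.
  repeat split; [now apply L2norm_is_nonneg in Hr|apply Ha; now exists s|now apply L2norm_is_sq_le]. }
split; [destruct (H 0) as (r & Hr & _); lra|].
intros s; destruct (H s) as (r & Hr & H1).
eapply wsum_le_weaken; [|exact H1]; apply sqr_le_pos_sqr; lra.
Qed.

(* Constants are functions of (mu, gamma, ||f||, L, |v|_X) only. *)
Theorem theorem4p2 :
  exists (R1 R2 Rp : R -> R -> R -> R -> R -> R) (m0 : R -> R -> R -> R -> R -> nat),
    (forall mu gamma nf L V, 0 < mu -> 0 < gamma -> 0 < nf -> 0 < L -> 0 <= V ->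
       0 < R1 mu gamma nf L V /\ 0 < R2 mu gamma nf L V /\ 0 < Rp mu gamma nf L V) /\
    (forall gamma nf L V, 0 < gamma -> 0 < nf -> 0 < L -> 0 <= V ->
       exists K M, forall mu, M <= mu ->
         R1 mu gamma nf L V <= K * sqrt mu /\
         R2 mu gamma nf L V <= K * mu ^ 2 /\
         Rp mu gamma nf L V <= K * mu ^ 2 /\
         INR (m0 mu gamma nf L V) <= K * mu ^ 4) /\
    (forall (L gamma mu nf V : R) (f : FSeq) (m : nat) (v v' : R -> FSeq),
       0 < L -> 0 < gamma -> 0 < mu ->
       L2norm_is L f nf -> (exists k, f k <> C0) ->
       in_X L m v v' -> Xnorm_is L v v' V ->
       (m0 mu gamma nf L V <= m)%nat ->
       forall w ws : R -> FSeq,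
         is_solution L gamma mu m f v w ws ->
         forall s,
           L2sq_le L (w s) (bigR0 mu gamma nf V ^ 2) /\
           H1sq_le L (w s) (R1 mu gamma nf L V ^ 2) /\
           H2sq_le L (w s) (R2 mu gamma nf L V ^ 2) /\
           L2sq_le L (ws s) (Rp mu gamma nf L V ^ 2)).
Proof.
(* A choice function of (gamma, nf, L, V) alone yields constants that cannot depend on f, v, m or w.
   Positivity is asked for all real parameters, hence the default 1 outside the admissible range. *)
destruct (functional_choice (fun (p : R * R * R * R) K =>
  let '(gamma, nf, L, V) := p in
  0 < K /\ (0 < gamma -> 0 <= nf -> 0 < L -> 0 <= V -> forall mu f m v v' w ws,
    0 < mu -> L2sq_le L f (nf * nf) -> in_X L m v v' ->
    (forall s, L2sq_le L (v s) (V * V)) -> (forall s, L2sq_le L (v' s) (V * V)) ->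
    is_solution L gamma mu m f v w ws -> K * (1 + mu) ^ 4 <= INR m ->
    forall s,
      L2sq_le L (w s) (bigR0 mu gamma nf V ^ 2) /\
      H1sq_le L (w s) (K * (1 + mu)) /\
      H2sq_le L (w s) (K * (1 + mu) ^ 4) /\
      L2sq_le L (ws s) (K * (1 + mu) ^ 4)))) as [K HK].
{ intros [[[gamma nf] L] V].
  destruct (Classical_Prop.classic (0 < gamma /\ 0 <= nf /\ 0 < L /\ 0 <= V)) as [(H1 & H2 & H3 & H4)|H].
  - destruct (uniform_bounds gamma nf L V H1 H2 H3 H4) as (K & HK0 & HK); exists K; auto.
  - exists 1; split; [lra|]; intros; exfalso; apply H; auto. }
assert (HK0 : forall gamma nf L V, 0 < K (gamma, nf, L, V))
  by (intros gamma nf L V; exact (proj1 (HK (gamma, nf, L, V)))).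
exists (fun mu gamma nf L V => sqrt (K (gamma, nf, L, V) * (1 + mu))),
  (fun mu gamma nf L V => sqrt (K (gamma, nf, L, V)) * (1 + mu) ^ 2),
  (fun mu gamma nf L V => sqrt (K (gamma, nf, L, V)) * (1 + mu) ^ 2),
  (fun mu gamma nf L V => Z.to_nat (up (K (gamma, nf, L, V) * (1 + mu) ^ 4))).
split; [|split].
- intros mu gamma nf L V Hmu _ _ _ _; assert (HK1 := HK0 gamma nf L V).
  assert (0 < sqrt (K (gamma, nf, L, V)) * (1 + mu) ^ 2)
    by (apply Rmult_lt_0_compat; [now apply sqrt_lt_R0|apply pow_lt; lra]).
  split; [|now split].
  apply sqrt_lt_R0, Rmult_lt_0_compat; lra.
- intros gamma nf L V _ _ _ _; assert (HK1 := HK0 gamma nf L V).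
  set (k := K (gamma, nf, L, V)) in *.
  assert (Hk := sqrt_pos k); assert (Hk2 := sqrt_pos (2 * k)).
  (* [sqrt (2 * k)] serves R1 through 1 + mu <= 2 mu, [4 * sqrt k] serves R2 and Rp, and
     [16 * k + 1] serves m0, where the 1 pays for the rounding by [up]. *)
  exists (sqrt (2 * k) + 4 * sqrt k + 16 * k + 1), 1; intros mu Hmu.
  assert (Hmu2 : (1 + mu) ^ 2 <= 4 * mu ^ 2) by nra.
  assert (Hmu4 : (1 + mu) ^ 4 <= 16 * mu ^ 4).
  { replace ((1 + mu) ^ 4) with ((1 + mu) ^ 2 * (1 + mu) ^ 2) by ring.
    replace (16 * mu ^ 4) with (4 * mu ^ 2 * (4 * mu ^ 2)) by ring.
    apply sqr_le_pos_sqr; [apply pow2_ge_0|exact Hmu2]. }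
  assert (H2 : sqrt k * (1 + mu) ^ 2 <= (sqrt (2 * k) + 4 * sqrt k + 16 * k + 1) * mu ^ 2).
  { apply Rle_trans with (sqrt k * (4 * mu ^ 2)); [now apply Rmult_le_compat_l|].
    assert (0 <= (sqrt (2 * k) + 16 * k + 1) * mu ^ 2)
      by (apply Rmult_le_pos; [lra|apply pow2_ge_0]).
    lra. }
  assert (Hm4 : 1 <= mu ^ 4) by now apply pow_R1_Rle.
  repeat split; try exact H2.
  + apply Rle_trans with (sqrt (2 * k) * sqrt mu).
    * rewrite <- sqrt_mult by lra; apply sqrt_le_1_alt; nra.
    * apply Rmult_le_compat_r; [apply sqrt_pos|lra].
  + assert (Hk4 : 0 <= k * (1 + mu) ^ 4) by (apply Rmult_le_pos; [lra|apply pow_le; lra]).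
    destruct (archimed (k * (1 + mu) ^ 4)) as [Hu1 Hu2].
    assert (0 <= up (k * (1 + mu) ^ 4))%Z by (apply le_IZR; lra).
    rewrite INR_IZR_INZ, Z2Nat.id by assumption.
    assert (k * (1 + mu) ^ 4 <= k * (16 * mu ^ 4)) by (apply Rmult_le_compat_l; lra).
    assert (0 <= (sqrt (2 * k) + 4 * sqrt k) * mu ^ 4) by (apply Rmult_le_pos; lra).
    lra.
- intros L gamma mu nf V f m v v' HL Hg Hmu Hf _ HX HV Hm w ws Hsol s.
  (* Each of the suprema a of |v| and b of |v_s| is at most V = a + b, so V bounds both. *)
  destruct HV as (a & b & Ha & Hb & ->).
  assert (HX' := HX); destruct HX' as (_ & _ & _ & B & HB).
  destruct (L2norm_lub_bound L v a B HL (fun s => proj1 (HB s)) Ha) as [Ha0 Hva].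
  destruct (L2norm_lub_bound L v' b B HL (fun s => proj2 (HB s)) Hb) as [Hb0 Hvb].
  assert (Hnf := L2norm_is_nonneg L f nf Hf).
  destruct (HK (gamma, nf, L, a + b)) as [HK1 HK2].
  set (k := K (gamma, nf, L, a + b)) in *.
  assert (Hk4 : 0 <= k * (1 + mu) ^ 4) by (apply Rmult_le_pos; [lra|apply pow_le; lra]).
  assert (Hup : k * (1 + mu) ^ 4 <= INR m).
  { destruct (archimed (k * (1 + mu) ^ 4)) as [Hu1 _].
    assert (0 <= up (k * (1 + mu) ^ 4))%Z by (apply le_IZR; lra).
    apply le_INR in Hm; rewrite INR_IZR_INZ, Z2Nat.id in Hm by assumption; lra. }
  destruct (HK2 Hg Hnf HL ltac:(lra) mu f m v v' w ws Hmu (L2norm_is_sq_le L f nf HL Hf) HX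
    (fun s => wsum_le_weaken _ _ _ _ _ (sqr_le_pos_sqr a (a + b) Ha0 ltac:(lra)) (Hva s))
    (fun s => wsum_le_weaken _ _ _ _ _ (sqr_le_pos_sqr b (a + b) Hb0 ltac:(lra)) (Hvb s))
    Hsol Hup s) as (R0 & R1 & R2 & R3).
  assert (E1 : sqrt (k * (1 + mu)) ^ 2 = k * (1 + mu)) by (apply pow2_sqrt, Rmult_le_pos; lra).
  assert (E2 : (sqrt k * (1 + mu) ^ 2) ^ 2 = k * (1 + mu) ^ 4).
  { replace ((sqrt k * (1 + mu) ^ 2) ^ 2) with (sqrt k * sqrt k * (1 + mu) ^ 4) by ring.
    rewrite sqrt_sqrt by lra; reflexivity. }
  rewrite E1, E2; auto.
Qed.
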